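(* Let $\chi_1(t)=(1+\log t)\chi(t)$. For each zero $\rho$ of the Riemann zeta function on the critical line with multiplicity $m_\rho$ and each integer $0\le k<m_\rho$, $$\lim_{\lambda\to0}\sqrt{\log\tfrac1\lambda}\,(\chi_1,X^\lambda_{\rho,k})=0\quad(k\geq1),\qquad \lim_{\lambda\to0}\sqrt{\log\tfrac1\lambda}\,(\chi_1,X^\lambda_{\rho,0})=\frac{\rho-1}{\rho^2}.$$
   Context: $K=L^2(]0,\infty[,dt)$ over $\mathbb{C}$ with scalar product $(f,g)=\int_0^\infty f\overline g\,dt$; $\chi$ is the indicator of $]0,1]$. The Mellin transform $\widehat f(s)=\int_0^\infty f(t)t^{s-1}dt$ is an isometry from $K$ onto $L^2(\{s=\frac12+i\tau\},\frac{d\tau}{2\pi})$. $V$ is the unitary operator on $K$ acting in Mellin variables as multiplication by $V(s)=\left(\frac{s}{1-s}\right)^3\frac{\zeta(1-s)}{\zeta(s)}$ on $\mathrm{Re}(s)=\frac12$. $Q_\lambda$ is orthogonal projection of $K$ onto $L^2([\lambda,\infty[,dt)$. $\psi_{w,k}(t)=(\log(1/t))^k t^{-w}\chi(t)$ for $\mathrm{Re}(w)<\frac12$. For $\mathrm{Re}(s)=\frac12$, $Y^\lambda_{s,k}$ denotes the $L^2$-limit (which exists) of $V^{-1}Q_\lambda V(\psi_{w,k})$ as $w\to s$ with $\mathrm{Re}(w)<\frac12$, and for $0<\lambda<1$, $X^\lambda_{\rho,k}:=\left(\log\frac1\lambda\right)^{-\frac12-k}Y^\lambda_{\rho,k}$.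 *)

(* Defs.v *)
From mathcomp Require Import all_boot all_order all_algebra.
From mathcomp Require Import all_classical all_reals all_analysis.
From mathcomp Require Import complex.
Import Order.TTheory GRing.Theory Num.Theory.
Import numFieldNormedType.Exports.

Set Implicit Arguments.
Unset Strict Implicit.
Unset Printing Implicit Defensive.

Local Open Scope classical_set_scope.
Local Open Scope ring_scope.
Local Open Scope complex_scope.

Section Definitions.
Variable R : realType.
Implicit Types (f g h F : R -> R[i]) (w s : R[i]) (zeta : R[i] -> R[i]).

(* The topology of the complex plane is the one of R[i]^o, i.e. of R[i]
   normed over itself. *)

Definition analytic_at (f : R[i] -> R[i]) (s0 : R[i]) : Prop :=
  exists a : nat -> R[i], \forall s \near (s0 : R[i]^o),
    series (fun n => a n * (s - s0) ^+ n : R[i]^o) @ \oo --> (f s : R[i]^o).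

Definition zero_of_multiplicity (f : R[i] -> R[i]) (s0 : R[i]) (m : nat) : Prop :=
  (0 < m)%N /\
  exists g : R[i] -> R[i], [/\ analytic_at g s0, g s0 != 0 &
    \forall s \near (s0 : R[i]^o), f s = (s - s0) ^+ m * g s].

(* t ^ s for t > 0 *)
Definition cpow (t : R) (s : R[i]) : R[i] :=
  (expR (complex.Re s * ln t))%:C * (cos (complex.Im s * ln t) +i* sin (complex.Im s * ln t)).

(* The analytic continuation of the Dirichlet series to the plane minus 1;
   the value of zeta at 1 is irrelevant. *)
Definition is_riemann_zeta zeta : Prop :=
  (forall s, 1 < complex.Re s ->
     series (fun n => cpow n.+1%:R (- s) : R[i]^o) @ \oo --> (zeta s : R[i]^o)) /\
  (forall s, s != 1 -> analytic_at zeta s).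

Definition cintegral (D : set R) f : R[i] :=
  Rintegral lebesgue_measure D (fun t => complex.Re (f t)) +i*
  Rintegral lebesgue_measure D (fun t => complex.Im (f t)).

Definition sqL2norm (D : set R) f : \bar R :=
  (\int[lebesgue_measure]_(t in D) (complex.Re (f t) ^+ 2 + complex.Im (f t) ^+ 2)%:E)%E.

Definition L2 (D : set R) f : Prop :=
  [/\ measurable_fun D (fun t => complex.Re (f t)),
      measurable_fun D (fun t => complex.Im (f t)) &
      (sqL2norm D f < +oo)%E].

(* K = L2 `]0, +oo[; elements are represented by functions, and only their
   restrictions to ]0, +oo[ matter. *)
Definition inner f g : R[i] := cintegral `]0, +oo[ (fun t => f t * conjc (g t)).

Definition line (tau : R) : R[i] := 2^-1 +i* tau.

(* F(tau) is the Mellin transform of f at 1/2 + i tau: the integral need not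
   converge absolutely for f in K, so it is, as in Plancherel's theorem, the
   limit in L2(dtau) of the truncated integrals. *)
Definition is_mellin f F : Prop :=
  [/\ L2 `]0, +oo[ f, L2 setT F &
    sqL2norm setT (fun tau =>
      cintegral `[n.+1%:R^-1, n.+1%:R] (fun t => f t * cpow t (line tau - 1))
      - F tau) @[n --> \oo] --> 0%E].

Definition Vmult zeta (s : R[i]) : R[i] :=
  (s / (1 - s)) ^+ 3 * (zeta (1 - s) / zeta s).

(* The graph of V: g = V f in K. *)
Definition is_V zeta f g : Prop :=
  exists F, is_mellin f F /\ is_mellin g (fun tau => Vmult zeta (line tau) * F tau).

Definition Q (lam : R) f : R -> R[i] := fun t => if lam <= t then f t else 0.

(* h = V^-1 Q_lam V f *)
Definition is_VinvQV zeta (lam : R) f h : Prop :=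
  exists g, is_V zeta f g /\ is_V zeta h (Q lam g).

Definition chi (t : R) : R[i] := if 0 < t <= 1 then 1 else 0.

Definition chi1 (t : R) : R[i] := (1 + ln t)%:C * chi t.

Definition psi (w : R[i]) (k : nat) (t : R) : R[i] :=
  ((ln t^-1) ^+ k)%:C * cpow t (- w) * chi t.

(* Y = lim V^-1 Q_lam V psi_{w,k} in K, as w --> s with Re w < 1/2 *)
Definition is_Y zeta (lam : R) (s : R[i]) (k : nat) (Y : R -> R[i]) : Prop :=
  L2 `]0, +oo[ Y /\
  exists H : R[i] -> R -> R[i],
    (forall w, complex.Re w < 2^-1 -> is_VinvQV zeta lam (psi w k) (H w)) /\
    sqL2norm `]0, +oo[ (fun t => H w t - Y t)
      @[w --> within [set w | complex.Re w < 2^-1] (nbhs (s : R[i]^o))] --> 0%E.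

Definition X_of_Y (lam : R) (k : nat) (Y : R -> R[i]) : R -> R[i] :=
  fun t => ((ln lam^-1) `^ (- 2^-1 - k%:R))%:C * Y t.

End Definitions.

(* Main.v *)
(** Write S(t) = sin (2 pi t) / (pi t) and let K be convolution by
    t^-1 1_{t >= 1}, whose Mellin multiplier is 1 / (1 - s).  On the critical
    line the functional equation reads zeta (1 - s) = (1 - s) S^(s) zeta (s), so
    V chi_1 = S - K S =: G, a bounded function, and V psi_{w,k} is an explicit
    function which is O(t^(-3/4)) near 0, uniformly for w near rho.  Since V is
    unitary, (chi_1, V^-1 Q V psi) = (G, Q V psi)
    = (chi_1, psi) - int_0^lambda G conj (V psi), and the last integral is
    O(lambda^(1/8)).  Letting w -> rho, (chi_1, Y_{rho,k}) stays bounded, and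
    for k = 0 it tends to the limit of (chi_1, psi_{w,0}), which is
    (rho - 1) / rho^2 because conj rho = 1 - rho.  Multiplying by
    (log (1 / lambda))^-k gives the result.

    The functional equation comes from the Fourier series of {x} - {x}^2: its
    Mellin transform continues zeta to the left, and summing it term by term
    over the dilates of the Fejer kernel exchanges s and 1 - s.  All
    continuations run along horizontal segments, by the identity theorem for
    power series.  That |V| = 1 almost everywhere uses that the zeros of zeta on
    the line are isolated.  V is only known on Mellin transforms defined as
    L^2-limits, and these are paired with integrable, almost everywhere
    continuous functions through a Parseval formula with Abel kernels
    exp (- eps |tau|). *)

Require Import Defs.
From mathcomp Require Import all_boot all_order all_algebra.
From mathcomp Require Import all_classical all_reals all_analysis.
From mathcomp Require Import measurable_realfun complex ring lra.
Import Order.TTheory GRing.Theory Num.Theory.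
Import numFieldNormedType.Exports.

Set Implicit Arguments.
Unset Strict Implicit.
Unset Printing Implicit Defensive.

Local Open Scope classical_set_scope.
Local Open Scope ring_scope.
Local Open Scope complex_scope.

(** * Complex-valued functions and integrals *)

(** The Dirichlet series lives on Re s > 1, whereas the Mellin integral of [S] converges absolutely
    only for 0 < Re s < 1. The Fejer kernel is an average of u S(u); its transform exists for 0 < Re
    s < 2 and carries the identity from Re s = 3/2 to the critical line. Since V(s) = s^3 S^(s) / (1
    - s)^2, the function V psi_{w,k} is obtained by applying 1 - K twice to S, which yields s^2 / (1
    - s)^2, and by splitting the remaining s as (s - w) + w in front of k! / (s - w)^(k+1); no
    derivative is taken. The exponent 3/4 lies above 1/2, so powers of the logarithm are absorbed
    uniformly up to Re w = 1/2, and below 1, so t^(-3/4) is integrable at 0 against the bounded G.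
    The rate 1/8 is half of the remaining gap 1/4. The elements of K related by V are known only
    through L^2-limits. They are never identified with explicit functions: only their scalar
    products with chi_1, with G and with the restriction of G to ]0, lambda[ are compared. *)

Notation cabs := Normc.normc.

Section ComplexModulus.
Variable R : realType.
Implicit Types z w : R[i].

Lemma cabsE z : cabs z = Num.sqrt (complex.Re z ^+ 2 + complex.Im z ^+ 2).
Proof. by case: z. Qed.

Lemma sqr_cabs z : cabs z ^+ 2 = complex.Re z ^+ 2 + complex.Im z ^+ 2.
Proof. by rewrite cabsE sqr_sqrtr// addr_ge0// sqr_ge0. Qed.

Lemma normC_cabs z : `|z| = (cabs z)%:C.
Proof. by rewrite normc_def cabsE. Qed.

Lemma cabs_ge0 z : 0 <= cabs z.
Proof. by rewrite cabsE sqrtr_ge0. Qed.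

Lemma cabsD z w : cabs (z + w) <= cabs z + cabs w.
Proof. exact: le_normcD. Qed.

Lemma cabsN z : cabs (- z) = cabs z.
Proof. exact: normcN. Qed.

Lemma cabsB z w : cabs (z - w) <= cabs z + cabs w.
Proof. by rewrite -(cabsN w) cabsD. Qed.

Lemma cabs_dist z w : cabs (z - w) = cabs (w - z).
Proof. by rewrite -cabsN opprB. Qed.

Lemma cabs_real (r : R) : cabs r%:C = `|r|.
Proof. by rewrite cabsE /= expr0n addr0 sqrtr_sqr. Qed.

Lemma cabsJ z : cabs (conjc z) = cabs z.
Proof. by rewrite !cabsE; case: z => a b /=; rewrite sqrrN. Qed.

Lemma cabs0 : cabs (0 : R[i]) = 0.
Proof. by rewrite (cabs_real 0) normr0. Qed.

Lemma Re_le_cabs z : `|complex.Re z| <= cabs z.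
Proof. by rewrite -sqrtr_sqr cabsE ler_wsqrtr// lerDl sqr_ge0. Qed.

Lemma Im_le_cabs z : `|complex.Im z| <= cabs z.
Proof. by rewrite -sqrtr_sqr cabsE ler_wsqrtr// lerDr sqr_ge0. Qed.

Lemma cabs_le_ReIm z : cabs z <= `|complex.Re z| + `|complex.Im z|.
Proof.
rewrite -(@ler_pXn2r _ 2)// ?nnegrE ?cabs_ge0 ?addr_ge0//.
rewrite sqr_cabs sqrrD !real_normK ?num_real//.
have := mulr_ge0 (normr_ge0 (complex.Re z)) (normr_ge0 (complex.Im z)); lra.
Qed.

Lemma cabs_eq0 z : (cabs z == 0) = (z == 0).
Proof.
apply/eqP/eqP => [/Normc.eq0_normc //|->].
by rewrite cabsE /= expr0n addr0 sqrtr0.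
Qed.

Lemma cabs_gt0 z : (0 < cabs z) = (z != 0).
Proof. by rewrite lt_def cabs_ge0 andbT cabs_eq0. Qed.

Lemma cabsX z n : cabs (z ^+ n) = cabs z ^+ n.
Proof.
elim: n => [|n ih]; first by rewrite !expr0 (cabs_real 1) normr1.
by rewrite !exprS Normc.normcM ih.
Qed.

Lemma cabs_sum (I : Type) (r : seq I) (P : pred I) (F : I -> R[i]) :
  cabs (\sum_(i <- r | P i) F i) <= \sum_(i <- r | P i) cabs (F i).
Proof.
elim/big_ind2: _ => [|x1 x2 y1 y2 h1 h2|//]; first by rewrite (cabs_real 0) normr0.
by rewrite (le_trans (cabsD _ _))// lerD.
Qed.

Lemma ReM z w : complex.Re (z * w) =
  complex.Re z * complex.Re w - complex.Im z * complex.Im w.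
Proof. by case: z; case: w. Qed.

Lemma ImM z w : complex.Im (z * w) =
  complex.Re z * complex.Im w + complex.Im z * complex.Re w.
Proof. by case: z; case: w. Qed.

Lemma ReD z w : complex.Re (z + w) = complex.Re z + complex.Re w.
Proof. by case: z; case: w. Qed.

Lemma ImD z w : complex.Im (z + w) = complex.Im z + complex.Im w.
Proof. by case: z; case: w. Qed.

Lemma ReN z : complex.Re (- z) = - complex.Re z.
Proof. by case: z. Qed.

Lemma ImN z : complex.Im (- z) = - complex.Im z.
Proof. by case: z. Qed.

Lemma ReJ z : complex.Re (conjc z) = complex.Re z.
Proof. by case: z. Qed.

Lemma ImJ z : complex.Im (conjc z) = - complex.Im z.
Proof. by case: z. Qed.

Lemma cplx_eqP z w : complex.Re z = complex.Re w -> complex.Im z = complex.Im w -> z = w.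
Proof. by case: z; case: w => a b c d /= -> ->. Qed.

(** The norm of [R[i]^o] takes values in [R[i]] itself, so balls have complex radii, which
    positivity forces to be real. Passing to the real modulus [cabs] makes squeeze arguments over
    [R] available. *)
Lemma cvgC_cabs (T : Type) (F : set_system T) (FF : Filter F) (f : T -> R[i]) (l : R[i]) :
  f @ F --> (l : R[i]^o) <-> cabs (f x - l) @[x --> F] --> 0.
Proof.
split => [/(@cvgrPdist_lt _ R[i]^o _ _ FF) h|/(@cvgrPdist_lt _ R^o) h].
  apply/(@cvgrPdist_lt _ R^o) => e e0.
  have : 0 < e%:C by rewrite ltcR.
  move=> /h; apply: filterS => x; rewrite normC_cabs ltcR cabs_dist.
  by rewrite sub0r normrN ger0_norm// cabs_ge0.
apply/(@cvgrPdist_lt _ R[i]^o) => -[e e']; rewrite ltcE /= => /andP[/eqP -> e0].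
move: (h _ e0); apply: filterS => x.
rewrite sub0r normrN ger0_norm ?cabs_ge0// normC_cabs => ?.
by rewrite ltcE /= eqxx/= cabs_dist.
Qed.

Lemma cvgC_ReIm (T : Type) (F : set_system T) (FF : Filter F) (f : T -> R[i]) (l : R[i]) :
  f @ F --> (l : R[i]^o) <->
  (complex.Re (f x) @[x --> F] --> complex.Re l /\
   complex.Im (f x) @[x --> F] --> complex.Im l).
Proof.
rewrite cvgC_cabs; split => [h|[hr hi]].
  have {}h e : 0 < e -> \forall x \near F, cabs (f x - l) < e.
    move=> e0; move/(@cvgrPdist_lt _ R^o) : h => /(_ _ e0); apply: filterS => x.
    by rewrite sub0r normrN ger0_norm ?cabs_ge0.
  split; apply/(@cvgrPdist_lt _ R^o) => e /h; apply: filterS => x;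
    apply: le_lt_trans; rewrite distrC.
    by rewrite -ReN -ReD Re_le_cabs.
  by rewrite -ImN -ImD Im_le_cabs.
apply: (@squeeze_cvgr _ _ _ _ (cst 0) (fun x => `|complex.Re (f x) - complex.Re l|
   + `|complex.Im (f x) - complex.Im l|)).
- apply: nearW => x /=; rewrite cabs_ge0/=.
  by rewrite -ReN -ImN -ReD -ImD cabs_le_ReIm.
- exact: cvg_cst.
- rewrite -[X in _ --> X](addr0 0); apply: cvgD;
    by apply/norm_cvg0P/subr_cvg0.
Qed.

Lemma cvgC_unique (T : Type) (F : set_system T) {FF : ProperFilter F} (f : T -> R[i]) (l m : R[i]) :
  f @ F --> (l : R[i]^o) -> f @ F --> (m : R[i]^o) -> l = m.
Proof.
move=> /cvgC_ReIm[hr hi] /cvgC_ReIm[kr ki]; apply: cplx_eqP.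
  exact: (cvg_unique _ hr kr).
exact: (cvg_unique _ hi ki).
Qed.

Lemma cvgC_cst (T : Type) (F : set_system T) {FF : Filter F} (z : R[i]) :
  (fun=> z) @ F --> (z : R[i]^o).
Proof. exact: (@cvg_cst R[i]^o). Qed.

Lemma cvgCD (T : Type) (F : set_system T) {FF : Filter F} (f g : T -> R[i]) (l m : R[i]) :
  f @ F --> (l : R[i]^o) -> g @ F --> (m : R[i]^o) ->
  (fun x => f x + g x) @ F --> (l + m : R[i]^o).
Proof. exact: (@cvgD R[i] R[i]^o T F FF f g l m). Qed.

Lemma cvgCB (T : Type) (F : set_system T) {FF : Filter F} (f g : T -> R[i]) (l m : R[i]) :
  f @ F --> (l : R[i]^o) -> g @ F --> (m : R[i]^o) ->
  (fun x => f x - g x) @ F --> (l - m : R[i]^o).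
Proof. exact: (@cvgB R[i] R[i]^o T F FF f g l m). Qed.

Lemma cvgCM (T : Type) (F : set_system T) {FF : Filter F} (f g : T -> R[i]) (l m : R[i]) :
  f @ F --> (l : R[i]^o) -> g @ F --> (m : R[i]^o) ->
  (fun x => f x * g x) @ F --> (l * m : R[i]^o).
Proof. exact: (@cvgM R[i] T F FF f g l m). Qed.

End ComplexModulus.

#[global] Arguments Normc.normc {R} _ : simpl never.

Section ComplexIntegral.
Context d (T : measurableType d) (R : realType).
Implicit Types (D : set T) (f g : T -> R[i]).

Definition cmeasurable D f :=
  measurable_fun D (fun x => complex.Re (f x)) /\ measurable_fun D (fun x => complex.Im (f x)).

Lemma cmeasurable_cst D (z : R[i]) : cmeasurable D (fun=> z).
Proof. by split; exact: measurable_cst. Qed.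

Lemma cmeasurable_real D (f : T -> R) : measurable_fun D f -> cmeasurable D (fun x => (f x)%:C).
Proof. by move=> mf; split => //=; exact: measurable_cst. Qed.

Lemma cmeasurableD D f g : cmeasurable D f -> cmeasurable D g ->
  cmeasurable D (fun x => f x + g x).
Proof.
move=> [rf jf] [rg jg]; split.
  by under eq_fun do rewrite ReD; exact: measurable_funD.
by under eq_fun do rewrite ImD; exact: measurable_funD.
Qed.

Lemma cmeasurableM D f g : cmeasurable D f -> cmeasurable D g ->
  cmeasurable D (fun x => f x * g x).
Proof.
move=> [rf jf] [rg jg]; split.
  under eq_fun do rewrite ReM.
  by apply: measurable_funB; exact: measurable_funM.
under eq_fun do rewrite ImM.
by apply: measurable_funD; exact: measurable_funM.
Qed.

Lemma cmeasurableN D f : cmeasurable D f -> cmeasurable D (fun x => - f x).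
Proof.
move=> mf; under [X in cmeasurable _ X]eq_fun do rewrite -mulN1r.
by apply: cmeasurableM => //; exact: cmeasurable_cst.
Qed.

Lemma cmeasurableB D f g : cmeasurable D f -> cmeasurable D g ->
  cmeasurable D (fun x => f x - g x).
Proof. by move=> mf mg; apply: cmeasurableD => //; exact: cmeasurableN. Qed.

Lemma cmeasurableJ D f : cmeasurable D f -> cmeasurable D (fun x => conjc (f x)).
Proof.
move=> [rf jf]; split.
  by under eq_fun do rewrite ReJ.
by under eq_fun do rewrite ImJ; exact: measurableT_comp.
Qed.

Lemma measurable_cabs D f : cmeasurable D f -> measurable_fun D (fun x => cabs (f x)).
Proof.
move=> [rf jf]; under eq_fun do rewrite cabsE.
apply: (@measurableT_comp _ _ _ _ _ _ (@Num.sqrt R : R -> R)).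
  by apply: continuous_measurable_fun; exact: sqrt_continuous.
by apply: measurable_funD; exact: measurable_funX.
Qed.

Lemma cmeasurable_cvg D (f_ : nat -> T -> R[i]) f : measurable D ->
  (forall n, cmeasurable D (f_ n)) ->
  (forall x, D x -> f_ n x @[n --> \oo] --> (f x : R[i]^o)) -> cmeasurable D f.
Proof.
move=> mD mf_ h; split.
  apply: (measurable_fun_cvg (h := fun n x => complex.Re (f_ n x))) => //.
    by move=> n; have [] := mf_ n.
  by move=> x Dx; have /cvgC_ReIm[] := h _ Dx.
apply: (measurable_fun_cvg (h := fun n x => complex.Im (f_ n x))) => //.
  by move=> n; have [] := mf_ n.
by move=> x Dx; have /cvgC_ReIm[] := h _ Dx.
Qed.

Variable mu : {measure set T -> \bar R}.

Definition cintegrable D f :=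
  mu.-integrable D (fun x => (complex.Re (f x))%:E) /\
  mu.-integrable D (fun x => (complex.Im (f x))%:E).

Definition cint D f : R[i] :=
  Rintegral mu D (fun t => complex.Re (f t)) +i* Rintegral mu D (fun t => complex.Im (f t)).

Variable D : set T.
Hypothesis mD : measurable D.

Lemma cintegrable_meas f : cintegrable D f -> cmeasurable D f.
Proof. by case=> /measurable_int/measurable_EFinP ? /measurable_int/measurable_EFinP. Qed.

Lemma le_cintegrable f (g : T -> R) : cmeasurable D f ->
  mu.-integrable D (fun x => (g x)%:E) -> (forall x, D x -> cabs (f x) <= g x) ->
  cintegrable D f.
Proof.
move=> [rf jf] ig fg; split; apply: (le_integrable mD) ig => //.
- exact/measurable_EFinP.
- move=> x Dx /=; rewrite lee_fin (le_trans (Re_le_cabs _))// (le_trans (fg _ Dx))//.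
  exact: ler_norm.
- exact/measurable_EFinP.
- move=> x Dx /=; rewrite lee_fin (le_trans (Im_le_cabs _))// (le_trans (fg _ Dx))//.
  exact: ler_norm.
Qed.

Lemma cintegrable_cabs f : cintegrable D f -> mu.-integrable D (fun x => (cabs (f x))%:E).
Proof.
move=> cf; have [rf jf] := cf.
apply: (le_integrable mD) (integrableD mD (integrable_abse rf) (integrable_abse jf)).
  by apply/measurable_EFinP; apply: measurable_cabs; exact: cintegrable_meas.
move=> x Dx /=; rewrite lee_fin ger0_norm ?cabs_ge0//.
by rewrite (le_trans (cabs_le_ReIm _))// ler_norm.
Qed.

Lemma cintegrable_abs f : cmeasurable D f ->
  mu.-integrable D (fun x => (cabs (f x))%:E) -> cintegrable D f.
Proof. by move=> mf; move/(le_cintegrable mf); apply. Qed.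

Lemma cintegrable_ltyP f : cintegrable D f <->
  cmeasurable D f /\ (\int[mu]_(x in D) (cabs (f x))%:E < +oo)%E.
Proof.
split=> [cf|[mf h]].
  split; first exact: cintegrable_meas.
  have /integrableP[_] := cintegrable_cabs cf; apply: le_lt_trans.
  apply: ge0_le_integral => //.
  - by move=> x _; rewrite lee_fin cabs_ge0.
  - by apply/measurable_EFinP; apply: measurable_cabs; exact: cintegrable_meas.
  - apply: measurableT_comp => //.
    by apply/measurable_EFinP; apply: measurable_cabs; exact: cintegrable_meas.
  - by move=> x _ /=; rewrite lee_fin ler_norm.
apply: cintegrable_abs => //; apply/integrableP; split.
  by apply/measurable_EFinP; exact: measurable_cabs.
by under eq_integral do rewrite abse_EFin ger0_norm ?cabs_ge0//.
Qed.

Lemma cintegrableD f g : cintegrable D f -> cintegrable D g -> cintegrable D (fun x => f x + g x).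
Proof.
move=> [rf jf] [rg jg]; split.
  by under [X in _.-integrable _ X]eq_fun do rewrite ReD EFinD; exact: integrableD.
by under [X in _.-integrable _ X]eq_fun do rewrite ImD EFinD; exact: integrableD.
Qed.

Lemma cintD f g : cintegrable D f -> cintegrable D g ->
  cint D (fun x => f x + g x) = cint D f + cint D g.
Proof.
move=> [rf jf] [rg jg]; rewrite /cint.
under eq_Rintegral do rewrite ReD.
under [in X in _ +i* X]eq_Rintegral do rewrite ImD.
by rewrite !RintegralD.
Qed.

Lemma cintegrableZ (z : R[i]) f : cintegrable D f -> cintegrable D (fun x => z * f x).
Proof.
move=> [rf jf]; split.
  under [X in _.-integrable _ X]eq_fun do rewrite ReM EFinB !EFinM.
  by apply: integrableB => //; exact: integrableZl.
under [X in _.-integrable _ X]eq_fun do rewrite ImM EFinD !EFinM.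
by apply: integrableD => //; exact: integrableZl.
Qed.

Lemma cintZ (z : R[i]) f : cintegrable D f -> cint D (fun x => z * f x) = z * cint D f.
Proof.
move=> [rf jf]; rewrite /cint; apply: cplx_eqP => /=.
  under eq_Rintegral do rewrite ReM.
  rewrite RintegralB//; first by rewrite !RintegralZl// ReM.
    exact: (integrableZl mD (complex.Re z) rf).
  exact: (integrableZl mD (complex.Im z) jf).
under eq_Rintegral do rewrite ImM.
rewrite RintegralD//; first by rewrite !RintegralZl// ImM.
  exact: (integrableZl mD (complex.Re z) jf).
exact: (integrableZl mD (complex.Im z) rf).
Qed.

Lemma cintegrableZr (z : R[i]) f : cintegrable D f -> cintegrable D (fun x => f x * z).
Proof. by move=> h; under [X in cintegrable _ X]eq_fun do rewrite mulrC; exact: cintegrableZ. Qed.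

Lemma cintZr (z : R[i]) f : cintegrable D f -> cint D (fun x => f x * z) = cint D f * z.
Proof.
by move=> h; under [in LHS]eq_fun do rewrite mulrC; rewrite cintZ// mulrC.
Qed.

Lemma cintegrableN f : cintegrable D f -> cintegrable D (fun x => - f x).
Proof.
by move=> h; under [X in cintegrable _ X]eq_fun do rewrite -mulN1r; exact: cintegrableZ.
Qed.

Lemma cintN f : cintegrable D f -> cint D (fun x => - f x) = - cint D f.
Proof.
by move=> h; under [in LHS]eq_fun do rewrite -mulN1r; rewrite cintZ// mulN1r.
Qed.

Lemma cintegrableB f g : cintegrable D f -> cintegrable D g -> cintegrable D (fun x => f x - g x).
Proof. by move=> hf hg; apply: cintegrableD => //; exact: cintegrableN. Qed.

Lemma cintB f g : cintegrable D f -> cintegrable D g ->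
  cint D (fun x => f x - g x) = cint D f - cint D g.
Proof. by move=> hf hg; rewrite cintD// ?cintN//; exact: cintegrableN. Qed.

Lemma cintegrableJ f : cintegrable D f -> cintegrable D (fun x => conjc (f x)).
Proof.
move=> [rf jf]; split.
  by under [X in _.-integrable _ X]eq_fun do rewrite ReJ.
by under [X in _.-integrable _ X]eq_fun do rewrite ImJ EFinN; exact: integrableN.
Qed.

Lemma cintJ f : cintegrable D f -> cint D (fun x => conjc (f x)) = conjc (cint D f).
Proof.
move=> [rf jf]; rewrite /cint /=; congr (_ +i* _).
  by apply: eq_Rintegral => x _; rewrite ReJ.
under eq_Rintegral do rewrite ImJ -mulN1r.
by rewrite RintegralZl// mulN1r.
Qed.

Lemma eq_cint f g : {in D, f =1 g} -> cint D f = cint D g.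
Proof.
by move=> fg; rewrite /cint; congr (_ +i* _); apply: eq_Rintegral => x xD; rewrite fg.
Qed.

Lemma eq_cintegrable f g : {in D, f =1 g} -> cintegrable D f -> cintegrable D g.
Proof.
move=> fg [rf jf]; split; [apply: (eq_integrable mD) rf|apply: (eq_integrable mD) jf];
  by move=> x xD; rewrite fg.
Qed.

(** The real and imaginary parts are bounded separately. This costs a factor 2, which recurs as
    [*+ 2] in the estimates below and is harmless for limits and orders of magnitude. *)
Lemma le_cabs_cint f (M : R) : cintegrable D f ->
  (\int[mu]_(x in D) (cabs (f x))%:E <= M%:E)%E -> cabs (cint D f) <= M *+ 2.
Proof.
move=> cf hM; have ic := cintegrable_cabs cf; have [rf jf] := cf.
have hM' : Rintegral mu D (fun x => cabs (f x)) <= M.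
  rewrite -lee_fin /Rintegral fineK//.
  exact: integrable_fin_num.
rewrite (le_trans (cabs_le_ReIm _))//= mulr2n lerD//.
  rewrite (le_trans (le_normr_Rintegral mD rf))// (le_trans _ hM')//.
  apply: le_Rintegral => //; first exact: (integrable_norm rf).
  by move=> x _; exact: Re_le_cabs.
rewrite (le_trans (le_normr_Rintegral mD jf))// (le_trans _ hM')//.
apply: le_Rintegral => //; first exact: (integrable_norm jf).
by move=> x _; exact: Im_le_cabs.
Qed.

Lemma cint_ae_eq f g : cmeasurable D f -> cmeasurable D g ->
  {ae mu, forall x, D x -> f x = g x} -> cint D f = cint D g.
Proof.
move=> [rf jf] [rg jg] fg; rewrite /cint /Rintegral; congr (fine _ +i* fine _);
  (apply: ae_eq_integral => //; [exact/measurable_EFinP..|]);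
  by apply: filterS fg => x h Dx; rewrite h.
Qed.

Lemma cintegrable_ae_eq f g : cmeasurable D g ->
  {ae mu, forall x, D x -> f x = g x} -> cintegrable D f -> cintegrable D g.
Proof.
move=> mg fg /cintegrable_ltyP[mf h]; apply/cintegrable_ltyP; split => //.
suff -> : (\int[mu]_(x in D) (cabs (g x))%:E = \int[mu]_(x in D) (cabs (f x))%:E)%E by [].
apply: ae_eq_integral => //.
- by apply/measurable_EFinP; exact: measurable_cabs.
- by apply/measurable_EFinP; exact: measurable_cabs.
- by apply: filterS fg => x hx Dx; rewrite hx.
Qed.

Lemma cint_dominated (f_ : nat -> T -> R[i]) f (g : T -> R) :
  (forall n, cmeasurable D (f_ n)) -> cmeasurable D f ->
  {ae mu, forall x, D x -> f_ n x @[n --> \oo] --> (f x : R[i]^o)} ->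
  mu.-integrable D (fun x => (g x)%:E) ->
  (forall n x, D x -> cabs (f_ n x) <= g x) ->
  cintegrable D f /\ cint D (f_ n) @[n --> \oo] --> (cint D f : R[i]^o).
Proof.
move=> mf_ [rf jf] ff ig fg.
have [ir _ cr] : [/\ mu.-integrable D (fun x => (complex.Re (f x))%:E),
  (fun n => \int[mu]_(x in D) `|(complex.Re (f_ n x))%:E - (complex.Re (f x))%:E|) n @[n --> \oo] --> 0 &
  (fun n => \int[mu]_(x in D) (complex.Re (f_ n x))%:E) n @[n --> \oo] -->
    (\int[mu]_(x in D) (complex.Re (f x))%:E)]%E.
  apply: (dominated_convergence mD (g := fun x => (g x)%:E)) => //.
  - by move=> n; apply/measurable_EFinP; have [] := mf_ n.
  - exact/measurable_EFinP.
  - apply: filterS ff => x h Dx; apply: cvg_EFin; first exact: nearW.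
    by have /cvgC_ReIm[] := h Dx.
  - apply: aeW => x n Dx; rewrite lee_fin.
    by rewrite (le_trans (Re_le_cabs _))// fg.
have [ij _ cj] : [/\ mu.-integrable D (fun x => (complex.Im (f x))%:E),
  (fun n => \int[mu]_(x in D) `|(complex.Im (f_ n x))%:E - (complex.Im (f x))%:E|) n @[n --> \oo] --> 0 &
  (fun n => \int[mu]_(x in D) (complex.Im (f_ n x))%:E) n @[n --> \oo] -->
    (\int[mu]_(x in D) (complex.Im (f x))%:E)]%E.
  apply: (dominated_convergence mD (g := fun x => (g x)%:E)) => //.
  - by move=> n; apply/measurable_EFinP; have [] := mf_ n.
  - exact/measurable_EFinP.
  - apply: filterS ff => x h Dx; apply: cvg_EFin; first exact: nearW.
    by have /cvgC_ReIm[] := h Dx.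
  - apply: aeW => x n Dx; rewrite lee_fin.
    by rewrite (le_trans (Im_le_cabs _))// fg.
split; first by [].
apply/cvgC_ReIm; split => /=.
  by apply: fine_cvg; rewrite fineK//; exact: integrable_fin_num.
by apply: fine_cvg; rewrite fineK//; exact: integrable_fin_num.
Qed.

Lemma cint_series (f_ : nat -> T -> R[i]) f :
  (forall n, cmeasurable D (f_ n)) ->
  (forall x, D x -> series (fun n => f_ n x : R[i]^o) @ \oo --> (f x : R[i]^o)) ->
  (\sum_(0 <= n <oo) \int[mu]_(x in D) (cabs (f_ n x))%:E < +oo)%E ->
  cintegrable D f /\
  series (fun n => cint D (f_ n) : R[i]^o) @ \oo --> (cint D f : R[i]^o).
Proof.
move=> mf_ ff sf.
have mabs n : measurable_fun D (fun x => (cabs (f_ n x))%:E).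
  by apply/measurable_EFinP; exact: measurable_cabs.
pose g x : \bar R := (\sum_(0 <= n <oo) (cabs (f_ n x))%:E)%E.
have mg : measurable_fun D g.
  by apply: ge0_emeasurable_sum => // n x _ _; rewrite lee_fin cabs_ge0.
have g0 x : (0 <= g x)%E by apply: nneseries_ge0 => n _ _; rewrite lee_fin cabs_ge0.
have ig : mu.-integrable D g.
  apply/integrableP; split => //.
  under eq_integral do rewrite gee0_abs//.
  by rewrite integral_nneseries// => n x _; rewrite lee_fin cabs_ge0.
have mfs n : cmeasurable D (fun x => series (fun k => f_ k x : R[i]^o) n).
  elim: n => [|n ih].
    by under [X in cmeasurable _ X]eq_fun do rewrite /series /= big_geq//; exact: cmeasurable_cst.
  under [X in cmeasurable _ X]eq_fun do rewrite seriesSr.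
  exact: cmeasurableD.
have ifn n : cintegrable D (f_ n).
  apply/cintegrable_ltyP; split => //; apply: le_lt_trans sf.
  have h k : (0 <= \int[mu]_(x in D) (cabs (f_ k x))%:E)%E.
    by apply: integral_ge0 => x _; rewrite lee_fin cabs_ge0.
  apply: le_trans (nneseries_lim_ge n.+1 _) => [|k *]; last exact: h.
  by rewrite big_nat_recr//= leeDr// sume_ge0.
have mf : cmeasurable D f by apply: (cmeasurable_cvg mD mfs).
have aeg : {ae mu, forall x, D x -> g x \is a fin_num} by exact: (integrable_ae mD).
(* [cint_dominated] asks for domination at every point, but the sum [g] of the moduli is finite only
   almost everywhere. Partial sums and limit are set to 0 where it is infinite, which changes no
   integral. *)
pose h_ n x := if g x \is a fin_num then series (fun k => f_ k x : R[i]^o) n else 0.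
pose h x := if g x \is a fin_num then f x else 0.
have mgf : measurable (D `&` [set x | g x \is a fin_num]).
  exact: emeasurable_fin_num.
have meas_if (u : T -> R[i]) : cmeasurable D u ->
    cmeasurable D (fun x => if g x \is a fin_num then u x else 0).
  have mb : measurable_fun D (fun x => g x \is a fin_num).
    by apply: (measurable_fun_bool true); exact: mgf.
  move=> [ru ju]; split.
    under eq_fun do rewrite (fun_if (@complex.Re R)).
    apply: measurable_fun_if => //.
    by apply: measurable_funS ru => //; exact: subIsetl.
  under eq_fun do rewrite (fun_if (@complex.Im R)).
  apply: measurable_fun_if => //.
  by apply: measurable_funS ju => //; exact: subIsetl.
have [ih ch] : cintegrable D h /\ cint D (h_ n) @[n --> \oo] --> (cint D h : R[i]^o).
  apply: (@cint_dominated _ _ (fun x => fine (g x))).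
  - by move=> n; exact: meas_if.
  - exact: meas_if.
  - apply: aeW => x Dx; rewrite /h_ /h; case: ifP => _; first exact: ff.
    exact: (@cvg_cst R[i]^o).
  - have := ig; apply: (le_integrable mD).
      apply/measurable_EFinP; exact: (measurableT_comp (fine_measurable measurableT)).
    move=> x Dx; rewrite [leRHS]gee0_abs//= ger0_norm ?fine_ge0//.
    by have := g0 x; case: (g x) => //= *; exact: leey.
  - move=> n x Dx; rewrite /h_; case: ifPn => gx; last first.
      by rewrite cabs0 fine_ge0.
    rewrite -lee_fin fineK// (le_trans _ (nneseries_lim_ge n _))//.
      by rewrite sumEFin lee_fin; exact: cabs_sum.
    by move=> k *; rewrite lee_fin cabs_ge0.
have aehf : {ae mu, forall x, D x -> h x = f x}.
  by apply: filterS aeg => x hx Dx; rewrite /h hx.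
split; first exact: (cintegrable_ae_eq mf aehf).
rewrite -(cint_ae_eq (meas_if _ mf) mf aehf).
suff -> : series (fun n => cint D (f_ n) : R[i]^o) = (fun n => cint D (h_ n)) by [].
apply/funext => n; apply/esym.
rewrite (@cint_ae_eq _ (fun x => series (fun k => f_ k x : R[i]^o) n))//; last 2 first.
- exact: meas_if.
- by apply: filterS aeg => x hx Dx; rewrite /h_ hx.
elim: n => [|n ih'].
  rewrite /series /= big_geq// (@eq_cint _ (fun=> 0)); last by move=> x _; rewrite big_geq.
  by rewrite /cint /= /Rintegral integral0.
have isn : cintegrable D (fun x => series (fun k => f_ k x : R[i]^o) n).
  elim: (n) => [|k ihk].
    by under [X in cintegrable _ X]eq_fun do rewrite /series /= big_geq//;
      split; exact: integrable0.
  under [X in cintegrable _ X]eq_fun do rewrite seriesSr.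
  exact: cintegrableD.
rewrite seriesSr -ih' -cintD//; apply: eq_cint => x _.
by rewrite seriesSr.
Qed.

End ComplexIntegral.

(** * Complex powers and the Mellin transform *)

Section Cpow.
Variable R : realType.
Implicit Types (t u : R) (s z : R[i]).

Lemma cpowD t s z : cpow t (s + z) = cpow t s * cpow t z.
Proof.
case: s z => a b [c e]; rewrite /cpow /= mulrDl expRD !mulrDl cosD sinD.
by apply: cplx_eqP => /=; ring.
Qed.

Lemma Re_cpow t s :
  complex.Re (cpow t s) = expR (complex.Re s * ln t) * cos (complex.Im s * ln t).
Proof. by rewrite /cpow /= mul0r subr0. Qed.

Lemma Im_cpow t s :
  complex.Im (cpow t s) = expR (complex.Re s * ln t) * sin (complex.Im s * ln t).
Proof. by rewrite /cpow /= mul0r addr0. Qed.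

Lemma cpow0 t : cpow t 0 = 1.
Proof. by rewrite /cpow /= !mul0r expR0 cos0 sin0; apply: cplx_eqP => /=; ring. Qed.

Lemma cpow1 s : cpow 1 s = 1.
Proof. by rewrite /cpow ln1 !mulr0 expR0 cos0 sin0; apply: cplx_eqP => /=; ring. Qed.

Lemma cpowNr t s : cpow t s * cpow t (- s) = 1.
Proof. by rewrite -cpowD subrr cpow0. Qed.

Lemma cpow_neq0 t s : cpow t s != 0.
Proof. by apply/eqP => h; have /eqP := cpowNr t s; rewrite h mul0r eq_sym oner_eq0. Qed.

Lemma cpowN t s : cpow t (- s) = (cpow t s)^-1.
Proof. by apply: (mulfI (cpow_neq0 t s)); rewrite cpowNr divff// cpow_neq0. Qed.

Lemma cpowM t u s : 0 < t -> 0 < u -> cpow (t * u) s = cpow t s * cpow u s.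
Proof.
move=> t0 u0; case: s => a b; rewrite /cpow /= lnM ?posrE// !mulrDr expRD cosD sinD.
by apply: cplx_eqP => /=; ring.
Qed.

Lemma cpowV t s : 0 < t -> cpow t^-1 s = cpow t (- s).
Proof.
move=> t0; rewrite cpowN; apply: (mulfI (cpow_neq0 t s)).
by rewrite -cpowM ?invr_gt0// divff ?gt_eqF// cpow1 divff// cpow_neq0.
Qed.

Lemma cabs_cpow t s : cabs (cpow t s) = expR (complex.Re s * ln t).
Proof.
rewrite /cpow Normc.normcM cabs_real ger0_norm ?expR_ge0// cabsE /=.
by rewrite cos2Dsin2 sqrtr1 mulr1.
Qed.

Lemma conj_cpow t s : conjc (cpow t s) = cpow t (conjc s).
Proof.
by case: s => a b; rewrite /cpow /= mulNr cosN sinN; apply: cplx_eqP => /=; ring.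
Qed.

Lemma cpow_real t (r : R) : cpow t r%:C = (expR (r * ln t))%:C.
Proof. by rewrite /cpow /= mul0r cos0 sin0; apply: cplx_eqP => /=; ring. Qed.

Lemma cpow_id t : 0 < t -> cpow t 1 = t%:C.
Proof. by move=> t0; rewrite (cpow_real _ 1) mul1r lnK. Qed.

Lemma cpow_nat t n : 0 < t -> cpow t n%:R = (t ^+ n)%:C.
Proof.
move=> t0; elim: n => [|n ih]; first by rewrite cpow0 expr0.
by rewrite -natr1 cpowD ih cpow_id// exprSr rmorphM.
Qed.

Lemma cmeasurable_cpow d (T : measurableType d) (D : set T) (f : T -> R) (g : T -> R[i]) :
  measurable_fun D f -> cmeasurable D g -> cmeasurable D (fun x => cpow (f x) (g x)).
Proof.
move=> mf [rg jg].
have mlf : measurable_fun D (fun x => ln (f x)) by apply: measurableT_comp mf; exact: measurable_ln.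
have mb : measurable_fun D (fun x => complex.Im (g x) * ln (f x)) by exact: measurable_funM.
rewrite /cpow; apply: cmeasurableM.
  apply: cmeasurable_real; apply: measurableT_comp; first exact: measurable_expR.
  exact: measurable_funM.
split => /=; apply: (measurableT_comp _ mb); apply: continuous_measurable_fun.
  exact: continuous_cos.
exact: continuous_sin.
Qed.

Lemma measurable_inv : measurable_fun setT (fun x : R => x^-1).
Proof.
have -> : [set: R] = [set~ 0] `|` [set 0] by rewrite setUC setUv.
apply/measurable_funU => //; first by apply: measurableC.
split; last exact: measurable_fun_set1.
apply: open_continuous_measurable_fun; first by apply/closed_openC; exact: closed_eq.
by move=> x; rewrite inE /= => /eqP x0; exact: inv_continuous.
Qed.

End Cpow.

Opaque cpow.

(** * Dilations and Fubini's theorem *)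

Section Scaling.
Variable R : realType.
Local Notation leb := (@lebesgue_measure R).

(** Lebesgue measure is [a] times its own image under multiplication by [a]: both agree on
    intervals, hence everywhere by uniqueness. *)
Lemma ge0_integral_scale (a : R) (g : R -> \bar R) : 0 < a ->
  measurable_fun setT g -> (forall x, 0 <= g x)%E ->
  (\int[leb]_x g (a * x)%R = (a^-1)%:E * \int[leb]_x g x)%E.
Proof.
move=> a0 mg g0.
pose phi := fun x : measurableTypeR R => a * x : measurableTypeR R.
have mphi : measurable_fun setT phi by exact: measurable_funM.
pose push : {measure set (measurableTypeR R) -> \bar R} :=
  pushforward leb phi.
pose nu : {measure set (measurableTypeR R) -> \bar R} :=
  mscale (NngNum (ltW a0)) (push mphi).
have leb_nu A : measurable A -> leb A = nu A.
  apply: lebesgue_measure_unique => X [[x y] _ <-] /=.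
  rewrite /nu /mscale /= /pushforward.
  have -> : phi @^-1` `]x, y]%classic = `]x / a, y / a]%classic.
    apply/seteqP; split => z; rewrite /phi /= !in_itv /=;
      by rewrite ltr_pdivrMr// ler_pdivlMr// mulrC.
  rewrite !lebesgue_measure_itv /= !lte_fin ltr_pM2r ?invr_gt0//.
  case: ifPn => _; last by rewrite mule0.
  rewrite -!EFinB -EFinM; congr (_%:E).
  by field; rewrite gt_eqF.
have -> : (\int[leb]_x g x = a%:E * \int[leb]_x g (a * x)%R)%E.
  rewrite (@eq_measure_integral _ _ _ setT nu); last by move=> A mA _; exact: leb_nu.
  rewrite ge0_integral_mscale//.
  by rewrite ge0_integral_pushforward.
by rewrite muleA -EFinM mulVf ?gt_eqF// mul1e.
Qed.

End Scaling.

Section ComplexFubini.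
Context d1 d2 (T1 : measurableType d1) (T2 : measurableType d2) (R : realType).
Variables (m1 : {sigma_finite_measure set T1 -> \bar R}).
Variables (m2 : {sigma_finite_measure set T2 -> \bar R}).

Lemma measurable_Rintegral_section (f : T1 * T2 -> R) : measurable_fun setT f ->
  measurable_fun setT (fun x => Rintegral m2 setT (fun y => f (x, y))).
Proof.
move=> mf; apply: (measurableT_comp (fine_measurable measurableT)).
under eq_fun do rewrite integralE; apply: emeasurable_funB.
  have mp : measurable_fun setT ((EFin \o f)^\+)%E by apply: measurable_funepos; exact/measurable_EFinP.
  apply: eq_measurable_fun (measurable_fun_fubini_tonelli_F (m2 := m2) _ mp (fun=> funepos_ge0 _ _)).
  by move=> x _; apply: eq_integral => y _; rewrite ?funeposE ?funenegE.
have mp : measurable_fun setT ((EFin \o f)^\-)%E by apply: measurable_funeneg; exact/measurable_EFinP.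
apply: eq_measurable_fun (measurable_fun_fubini_tonelli_F (m2 := m2) _ mp (fun=> funeneg_ge0 _ _)).
  by move=> x _; apply: eq_integral => y _; rewrite ?funeposE ?funenegE.
Qed.

Lemma cmeasurable_cint_section (f : T1 * T2 -> R[i]) : cmeasurable setT f ->
  cmeasurable setT (fun x => cint m2 setT (fun y => f (x, y))).
Proof.
by case=> rf jf; split;
  [exact: (measurable_Rintegral_section rf)|exact: (measurable_Rintegral_section jf)].
Qed.

(** [Rintegral] turns an infinite inner integral into 0. The sections concerned form a null set, so
    the iterated real integrals agree with the extended ones, to which Fubini applies. *)
Lemma Rintegral_Fubini (f : T1 * T2 -> R) :
  (m1 \x m2)%E.-integrable setT (EFin \o f) ->
  Rintegral m1 setT (fun x => Rintegral m2 setT (fun y => f (x, y))) =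
  Rintegral m2 setT (fun y => Rintegral m1 setT (fun x => f (x, y))).
Proof.
move=> intf; have mf := measurable_int _ intf.
rewrite /Rintegral; congr fine.
transitivity (\int[m1]_x \int[m2]_y (f (x, y))%:E)%E.
  apply: ae_eq_integral => //.
  - apply/measurable_EFinP; apply: (@measurable_Rintegral_section f).
    exact/measurable_EFinP.
  - exact: (measurable_fubini_F intf).
  - apply: filterS (ae_integrable1 intf) => x ix _.
    by rewrite fineK//; exact: integrable_fin_num.
rewrite (Fubini intf); apply/esym.
apply: ae_eq_integral => //.
- apply/measurable_EFinP; apply: (measurableT_comp (fine_measurable measurableT)).
  exact: (measurable_fubini_G intf).
- exact: (measurable_fubini_G intf).
- apply: filterS (ae_integrable2 intf) => x ix _.
  by rewrite fineK//; exact: integrable_fin_num.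
Qed.

Lemma integrable_Rintegral_section (f : T1 * T2 -> R) :
  (m1 \x m2)%E.-integrable setT (EFin \o f) ->
  m1.-integrable setT (fun x => (Rintegral m2 setT (fun y => f (x, y)))%:E).
Proof.
move=> intf; have mf := measurable_int _ intf.
apply: (le_integrable measurableT) (integrable_fubini_F intf).
  apply/measurable_EFinP; apply: (@measurable_Rintegral_section f).
  exact/measurable_EFinP.
move=> x _; rewrite /Rintegral /fubini_F /=.
by case: (integral _ _ _) => [r| |] //=; rewrite ?normr0 ?leey ?lexx.
Qed.

Lemma cintegrable_cint_section (f : T1 * T2 -> R[i]) : cintegrable (m1 \x m2)%E setT f ->
  cintegrable m1 setT (fun x => cint m2 setT (fun y => f (x, y))).
Proof.
by move=> [rf jf]; split;
  [exact: (integrable_Rintegral_section rf)|exact: (integrable_Rintegral_section jf)].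
Qed.

Lemma cintegrable_prod (f : T1 * T2 -> R[i]) : cmeasurable setT f ->
  (\int[m2]_y \int[m1]_x (cabs (f (x, y)))%:E < +oo)%E ->
  cintegrable (m1 \x m2)%E setT f.
Proof.
move=> mf h; apply: cintegrable_abs => //.
apply/integrable21ltyP; first by apply/measurable_EFinP; exact: measurable_cabs.
by under eq_integral do under eq_integral do rewrite abse_EFin ger0_norm ?cabs_ge0//.
Qed.

Lemma cint_Fubini (f : T1 * T2 -> R[i]) : cintegrable (m1 \x m2)%E setT f ->
  cint m1 setT (fun x => cint m2 setT (fun y => f (x, y))) =
  cint m2 setT (fun y => cint m1 setT (fun x => f (x, y))).
Proof.
move=> [rf jf]; rewrite /cint; congr (_ +i* _) => /=.
  exact: (Rintegral_Fubini (f := fun z => complex.Re (f z))).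
exact: (Rintegral_Fubini (f := fun z => complex.Im (f z))).
Qed.

Lemma ae_cintegrable1 (f : T1 * T2 -> R[i]) : cintegrable (m1 \x m2)%E setT f ->
  {ae m1, forall x, cintegrable m2 setT (fun y => f (x, y))}.
Proof.
move=> [/ae_integrable1 h1 /ae_integrable1 h2].
by apply: filterS2 h1 h2 => x; split.
Qed.

End ComplexFubini.

(** * The Mellin transform and multiplicative convolution *)

Section Mellin.
Variable R : realType.
Local Notation leb := (@lebesgue_measure R).
Implicit Types (f g q : R -> R[i]) (c : R) (s z : R[i]).

Lemma ae_imp (P Q : R -> Prop) : (forall x, P x -> Q x) ->
  {ae leb, forall x, P x} -> {ae leb, forall x, Q x}.
Proof. exact: (@filterS _ _ (ae_filter_ringOfSetsType leb)). Qed.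

Lemma ae_imp2 (P Q S : R -> Prop) : (forall x, P x -> Q x -> S x) ->
  {ae leb, forall x, P x} -> {ae leb, forall x, Q x} -> {ae leb, forall x, S x}.
Proof. exact: (@filterS2 _ _ (ae_filter_ringOfSetsType leb)). Qed.

Definition mellin f s : R[i] := cint leb setT (fun t => f t * cpow t (s - 1)).

(** The weight is t^(c-1): the transform converges absolutely on the line of abscissa [c]. Vanishing
    on ]-oo, 0] lets all integrals run over the whole line and makes the values of [ln] and [cpow]
    there irrelevant. *)
Definition mellin_class c f :=
  [/\ cmeasurable setT f, forall t, t <= 0 -> f t = 0 &
  (\int[leb]_t (cabs (f t) * expR ((c - 1) * ln t))%:E < +oo)%E].

(** Convolution on the multiplicative group of positive reals, whose Haar measure is du / u. *)
Definition mconv f q t : R[i] := cint leb setT (fun u => f (t / u) * q u * (u^-1)%:C).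

Lemma cabs_mellin f t s : cabs (f t * cpow t (s - 1)) =
  cabs (f t) * expR ((complex.Re s - 1) * ln t).
Proof. by rewrite Normc.normcM cabs_cpow ReD ReN. Qed.

Lemma cmeasurable_cpow_id D z : cmeasurable D (fun t : R => cpow t z).
Proof.
by apply: cmeasurable_cpow; [exact: measurable_id|exact: cmeasurable_cst].
Qed.

Lemma cintegrable_mellin c f s : mellin_class c f -> complex.Re s = c ->
  cintegrable leb setT (fun t => f t * cpow t (s - 1)).
Proof.
move=> [mf _ h] sc; apply/cintegrable_ltyP => //; split.
  by apply: cmeasurableM => //; exact: cmeasurable_cpow_id.
by under eq_integral do rewrite cabs_mellin sc.
Qed.

Lemma measurable_mellin_weight c : measurable_fun setT (fun t : R => expR ((c - 1) * ln t)).
Proof.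
apply: measurableT_comp; first exact: measurable_expR.
by apply: measurable_funM => //; exact: measurable_ln.
Qed.

Lemma mellin_scale_abs c f u : mellin_class c f -> 0 < u ->
  (\int[leb]_t (cabs (f (t / u)) * expR ((c - 1) * ln t))%:E =
   (expR (c * ln u))%:E * \int[leb]_t (cabs (f t) * expR ((c - 1) * ln t))%:E)%E.
Proof.
move=> [mf f0 _] u0.
pose g (t : R) := (cabs (f t) * expR ((c - 1) * ln t))%:E.
have mg : measurable_fun setT g.
  apply/measurable_EFinP; apply: measurable_funM; first exact: measurable_cabs.
  exact: measurable_mellin_weight.
have g0 t : (0 <= g t)%E by rewrite lee_fin mulr_ge0 ?cabs_ge0 ?expR_ge0.
transitivity (\int[leb]_t ((expR ((c - 1) * ln u))%:E * g (u^-1 * t)%R))%E.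
  apply: eq_integral => t _; rewrite /g -EFinM (mulrC u^-1); congr (_%:E).
  have [t0|t0] := leP t 0.
    by rewrite f0 ?cabs0 ?mul0r ?mulr0// pmulr_lle0// invr_gt0.
  rewrite lnM ?posrE ?invr_gt0// lnV ?posrE// mulrCA; congr (_ * _).
  by rewrite -expRD; congr expR; ring.
rewrite ge0_integralZl//; last first.
  exact: (measurableT_comp mg (@mulrl_measurable R setT u^-1)).
rewrite ge0_integral_scale ?invr_gt0// invrK muleA -EFinM; congr (_%:E * _)%E.
rewrite -[X in _ * X](@lnK R u)// -expRD; congr expR; ring.
Qed.

Lemma cint_scale f u : 0 < u -> cintegrable leb setT f ->
  cint leb setT (fun t => f (t / u)) = u%:C * cint leb setT f.
Proof.
move=> u0 [rf jf].
have sc (h : R -> R) : leb.-integrable setT (fun x => (h x)%:E) ->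
    Rintegral leb setT (fun t => h (t / u)) = u * Rintegral leb setT h.
  move=> ih; have mh := measurable_int _ ih.
  have uV : 0 < u^-1 by rewrite invr_gt0.
  rewrite /Rintegral -[X in X * _]/(fine u%:E) -fineM//; last exact: integrable_fin_num.
  congr fine; rewrite integralE [in RHS]integralE.
  have k1 := ge0_integral_scale uV (measurable_funepos mh) (fun=> funepos_ge0 _ _).
  have k2 := ge0_integral_scale uV (measurable_funeneg mh) (fun=> funeneg_ge0 _ _).
  rewrite invrK in k1 k2.
  rewrite muleBr//; last first.
    by apply: fin_num_adde_defl; rewrite fin_numN; exact: integrable_neg_fin_num.
  rewrite -k1 -k2; congr (_ - _)%E; apply: eq_integral => x _.
    by rewrite !funeposE mulrC.
  by rewrite !funenegE mulrC.
by rewrite /cint (sc _ rf) (sc _ jf); apply: cplx_eqP => /=; ring.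
Qed.

Lemma mellin_scale c f s u : mellin_class c f -> complex.Re s = c -> 0 < u ->
  mellin (fun t => f (t / u)) s = cpow u s * mellin f s.
Proof.
move=> Lf sc u0; have [mf f0 _] := Lf.
rewrite /mellin.
transitivity (cint leb setT (fun t => cpow u (s - 1) * (f (t / u) * cpow (t / u) (s - 1)))).
  apply: eq_cint => t _; have [t0|t0] := leP t 0.
    by rewrite f0 ?mul0r ?mulr0// pmulr_lle0// invr_gt0.
  rewrite [RHS]mulrCA; congr (_ * _).
  by rewrite -cpowM ?divr_gt0// mulrC divfK// gt_eqF.
have If := cintegrable_mellin Lf sc.
rewrite cintZ//; last first.
  apply/cintegrable_ltyP => //; split.
    have md : measurable_fun setT (fun t : R => t / u) by exact: measurable_funM.
    apply: cmeasurableM; last by apply: cmeasurable_cpow => //; exact: cmeasurable_cst.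
    by case: mf => r j; split; [exact: (measurableT_comp r)|exact: (measurableT_comp j)].
  have uV : 0 < u^-1 by rewrite invr_gt0.
  have mg : measurable_fun setT (fun x => (cabs (f x * cpow x (s - 1)))%:E).
    by apply/measurable_EFinP; apply: measurable_cabs; exact: (cintegrable_meas If).
  have g0 x : (0 <= (cabs (f x * cpow x (s - 1)))%:E)%E by rewrite lee_fin cabs_ge0.
  have /cintegrable_ltyP[//|_ h] := If.
  have := ge0_integral_scale uV mg g0; rewrite invrK => hs.
  rewrite [X in (X < _)%E](_ : _ = u%:E * \int[leb]_x (cabs (f x * cpow x (s - 1)))%:E)%E.
    by apply: lte_mul_pinfty => //; rewrite lee_fin ltW.
  by rewrite -hs; apply: eq_integral => x _; rewrite (mulrC u^-1).
rewrite (@cint_scale (fun t => f t * cpow t (s - 1)) u)// mulrA; congr (_ * _).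
by rewrite -(cpow_id u0) -cpowD subrK.
Qed.

Lemma cmeasurable_mconv_kernel f q : cmeasurable setT f -> cmeasurable setT q ->
  cmeasurable setT (fun x : R * R => f (x.1 / x.2) * q x.2 * (x.2^-1)%:C).
Proof.
move=> [rf jf] [rq jq].
have mi : measurable_fun setT (fun x : R * R => x.2^-1).
  by apply: (measurableT_comp (@measurable_inv R)); exact: measurable_snd.
have md : measurable_fun setT (fun x : R * R => x.1 / x.2).
  by apply: measurable_funM => //; exact: measurable_fst.
apply: cmeasurableM; last exact: cmeasurable_real.
apply: cmeasurableM; split.
- exact: (measurableT_comp rf).
- exact: (measurableT_comp jf).
- by apply: (measurableT_comp rq); exact: measurable_snd.
- by apply: (measurableT_comp jq); exact: measurable_snd.
Qed.

Lemma cmeasurable_mconv f q : cmeasurable setT f -> cmeasurable setT q ->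
  cmeasurable setT (mconv f q).
Proof.
move=> mf mq.
exact: (cmeasurable_cint_section leb (cmeasurable_mconv_kernel mf mq)).
Qed.

(** Integrating first in [t] pulls out u^c by scaling, so the double integral of the moduli is the
    product of the two weighted norms. *)
Lemma cintegrable_mconv c f q s : mellin_class c f -> mellin_class c q -> complex.Re s = c ->
  cintegrable (leb \x leb)%E setT (fun x : R * R =>
    f (x.1 / x.2) * q x.2 * (x.2^-1)%:C * cpow x.1 (s - 1)).
Proof.
move=> Lf Lq sc; have [mf f0 If] := Lf; have [mq q0 Iq] := Lq.
have mk := cmeasurable_mconv_kernel mf mq.
apply: cintegrable_prod.
  apply: cmeasurableM => //; apply: cmeasurable_cpow; last exact: cmeasurable_cst.
  exact: measurable_fst.
set N := (\int[leb]_t (cabs (f t) * expR ((c - 1) * ln t))%:E)%E in If.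
have N0 : (0 <= N)%E by apply: integral_ge0 => t _; rewrite lee_fin mulr_ge0 ?cabs_ge0 ?expR_ge0.
have mw := measurable_mellin_weight c.
have E u : (\int[leb]_t (cabs (f (t / u) * q u * (u^-1)%:C * cpow t (s - 1)))%:E =
    N * (cabs (q u) * expR ((c - 1) * ln u))%:E)%E.
  have [u0|u0] := leP u 0.
    rewrite q0// cabs0 mul0r mule0 integral0_eq// => t _.
    by rewrite mulr0 !mul0r cabs0.
  transitivity (\int[leb]_t ((cabs (q u) * u^-1)%:E *
      (cabs (f (t / u)) * expR ((c - 1) * ln t))%:E))%E.
    apply: eq_integral => t _; rewrite -EFinM; congr (_%:E).
    rewrite (cabs_mellin (fun t => f (t / u) * q u * (u^-1)%:C)) sc !Normc.normcM cabs_real ger0_norm ?invr_ge0 ?(ltW u0)//.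
    by ring.
  rewrite ge0_integralZl//; last 3 first.
  - apply/measurable_EFinP; apply: measurable_funM => //.
    have md : measurable_fun setT (fun t : R => t / u) by exact: measurable_funM.
    by apply: measurable_cabs; case: mf => r j; split;
      [exact: (measurableT_comp r)|exact: (measurableT_comp j)].
  - by move=> t _; rewrite lee_fin mulr_ge0 ?cabs_ge0 ?expR_ge0.
  - by rewrite lee_fin mulr_ge0 ?cabs_ge0// invr_ge0 ltW.
  rewrite (mellin_scale_abs Lf u0) -/N muleA -EFinM muleC; congr (_ * _%:E)%E.
  rewrite -mulrA; congr (_ * _).
  by rewrite -[X in X^-1](@lnK R u)// -expRN -expRD; congr expR; ring.
under eq_integral do rewrite E.
rewrite ge0_integralZl//.
- apply: lte_mul_pinfty => //; rewrite ge0_fin_numE//.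
- apply/measurable_EFinP; apply: measurable_funM => //; exact: measurable_cabs.
- by move=> t _; rewrite lee_fin mulr_ge0 ?cabs_ge0 ?expR_ge0.
Qed.

(** The factor t^(s-1) may leave the inner integral only where the section is integrable, which
    Fubini grants for almost every [t]; there, division by the nonzero power gives integrability of
    the convolution integrand. *)
Lemma mconv_ae c f q s : mellin_class c f -> mellin_class c q -> complex.Re s = c ->
  {ae leb, forall t, cint leb setT (fun u => f (t / u) * q u * (u^-1)%:C * cpow t (s - 1)) =
     mconv f q t * cpow t (s - 1)}.
Proof.
move=> Lf Lq sc; have I := cintegrable_mconv Lf Lq sc.
apply: filterS (ae_cintegrable1 I) => t /= It.
rewrite /mconv -cintZr//.
rewrite [X in cintegrable _ _ X](_ : _ = fun u =>
  f (t / u) * q u * (u^-1)%:C * cpow t (s - 1) * cpow t (- (s - 1))).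
  exact: cintegrableZr.
by apply/funext => u; rewrite -[RHS]mulrA cpowNr mulr1.
Qed.

Lemma mellin_mconv c f q s : mellin_class c f -> mellin_class c q -> complex.Re s = c ->
  mellin (mconv f q) s = mellin f s * mellin q s.
Proof.
move=> Lf Lq sc; have [mf f0 _] := Lf; have [mq q0 _] := Lq.
have I := cintegrable_mconv Lf Lq sc.
rewrite {1}/mellin.
transitivity (cint leb setT (fun t => cint leb setT (fun u =>
    f (t / u) * q u * (u^-1)%:C * cpow t (s - 1)))).
  apply/esym/cint_ae_eq => //.
  - exact: (cmeasurable_cint_section leb (cintegrable_meas I)).
  - by apply: cmeasurableM; [exact: cmeasurable_mconv|exact: cmeasurable_cpow_id].
  - by apply: ae_imp (mconv_ae Lf Lq sc) => t ? _.
rewrite (cint_Fubini I) /= -[in RHS]cintZ//; last exact: (cintegrable_mellin Lq).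
apply: eq_cint => u _; have [u0|u0] := leP u 0.
  rewrite q0// mul0r mulr0 (@eq_cint _ _ _ _ _ _ (fun=> 0)).
    by rewrite /cint /= /Rintegral integral0.
  by move=> t _; rewrite mulr0 !mul0r.
have If := cintegrable_mellin Lf sc.
have := mellin_scale Lf sc u0; rewrite {1}/mellin => h.
transitivity (q u * (u^-1)%:C * cint leb setT (fun t => f (t / u) * cpow t (s - 1))).
  rewrite -cintZ//; first by apply: eq_cint => t _; ring.
  apply/cintegrable_ltyP => //; split.
    have md : measurable_fun setT (fun t : R => t / u) by exact: measurable_funM.
    apply: cmeasurableM; last exact: cmeasurable_cpow_id.
    by case: mf => r j; split; [exact: (measurableT_comp r)|exact: (measurableT_comp j)].
  rewrite [X in (X < _)%E](_ : _ =
      \int[leb]_t (cabs (f (t / u)) * expR ((c - 1) * ln t))%:E)%E.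
    rewrite (mellin_scale_abs Lf u0); apply: lte_mul_pinfty => //; last by have [] := Lf.
  by apply: eq_integral => t _; rewrite (cabs_mellin (fun t => f (t / u))) sc.
have E : cpow u s = cpow u (s - 1) * u%:C by rewrite -(cpow_id u0) -cpowD subrK.
have uu : (u^-1)%:C * u%:C = 1 :> R[i] by rewrite -rmorphM mulVf ?gt_eqF.
by rewrite h E -[RHS]mul1r -uu; ring.
Qed.

Lemma mellin_class_mconv c f q : mellin_class c f -> mellin_class c q ->
  mellin_class c (mconv f q).
Proof.
move=> Lf Lq; have [mf f0 _] := Lf; have [mq q0 _] := Lq.
have sc : complex.Re c%:C = c by [].
have I := cintegrable_mconv Lf Lq sc.
split; first exact: cmeasurable_mconv.
  move=> t t0; rewrite /mconv (@eq_cint _ _ _ _ _ _ (fun=> 0)).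
    by rewrite /cint /= /Rintegral integral0.
  move=> u _; have [u0|u0] := leP u 0; first by rewrite q0// mulr0 mul0r.
  by rewrite f0 ?mul0r// pmulr_lle0// invr_gt0.
have : cintegrable leb setT (fun t => mconv f q t * cpow t (c%:C - 1)).
  apply: cintegrable_ae_eq (cintegrable_cint_section I) => //.
    by apply: cmeasurableM; [exact: cmeasurable_mconv|exact: cmeasurable_cpow_id].
  by apply: ae_imp (mconv_ae Lf Lq sc) => t ? _.
by case/cintegrable_ltyP => // _; under eq_integral do rewrite cabs_mellin.
Qed.

End Mellin.

(** * Primitives and integrals of complex powers *)

Section FTC.
Variable R : realType.
Local Notation leb := (@lebesgue_measure R).

Lemma continuous_itv_integrable (f : R -> R) (a b : R) :
  (forall x, a <= x <= b -> {for x, continuous f}) ->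
  leb.-integrable `[a, b] (fun x => (f x)%:E).
Proof.
move=> cf; apply: continuous_compact_integrable; first exact: segment_compact.
apply: continuous_in_subspaceT => x; rewrite inE /= in_itv /=; exact: cf.
Qed.

Lemma integral_itv_derive (F f : R -> R) (a b : R) : a <= b ->
  (forall x, a <= x <= b -> is_derive x 1 F (f x)) ->
  (forall x, a <= x <= b -> {for x, continuous f}) ->
  (\int[leb]_(x in `[a, b]) (f x)%:E = (F b - F a)%:E)%E.
Proof.
rewrite le_eqVlt => /predU1P[->|ab] dF cf.
  by rewrite set_itv1 integral_set1 subrr.
rewrite EFinB; apply: continuous_FTC2 => //.
- apply: continuous_in_subspaceT => x; rewrite inE /= in_itv /=; exact: cf.
- have dd x : a <= x <= b -> derivable F x 1 by move=> /dF[].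
  have cF x : a <= x <= b -> {for x, continuous F}.
    by move=> /dd/derivable1_diffP/differentiable_continuous.
  split.
  + by move=> x; rewrite in_itv /= => /andP[ax xb]; apply: dd; rewrite !ltW.
  + by apply: cvg_at_right_filter; apply: cF; rewrite lexx ltW.
  + by apply: cvg_at_left_filter; apply: cF; rewrite lexx ltW.
- move=> x; rewrite in_itv /= => /andP[ax xb].
  rewrite derive1E; have h : a <= x <= b by rewrite !ltW.
  by have [_] := dF _ h.
Qed.

Lemma Rintegral_itv_derive (F f : R -> R) (a b : R) : a <= b ->
  (forall x, a <= x <= b -> is_derive x 1 F (f x)) ->
  (forall x, a <= x <= b -> {for x, continuous f}) ->
  Rintegral leb `[a, b] f = F b - F a.
Proof. by move=> *; rewrite /Rintegral (integral_itv_derive (F := F)). Qed.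

End FTC.

Section Powers.
Variable R : realType.
Local Notation leb := (@lebesgue_measure R).
Implicit Types (s z w : R[i]).

Lemma is_derive_mul_ln (t a : R) : 0 < t -> is_derive t 1 (fun x => a * ln x) (a / t).
Proof.
move=> t0; have dl : is_derive t 1 (@ln R) t^-1 by exact: is_derive1_ln.
have := @is_deriveZ R R^o R^o (@ln R) a t 1 t^-1 dl.
by rewrite /GRing.scale /=.
Qed.

Lemma is_derive_Re_cpow (t : R) z : 0 < t ->
  is_derive t 1 (fun x => complex.Re (cpow x z)) (complex.Re (z * cpow t (z - 1))).
Proof.
move=> t0; under [X in is_derive _ _ X]eq_fun do rewrite Re_cpow.
have d1 := is_derive_mul_ln (complex.Re z) t0.
have d2 := is_derive_mul_ln (complex.Im z) t0.
have d3 := @is_derive1_comp R expR _ t _ _ (is_derive_expR _) d1.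
have d4 := @is_derive1_comp R (@cos R) _ t _ _ (is_derive_cos _) d2.
apply: (is_derive_eq (is_deriveM d3 d4)).
rewrite cpowD cpowN cpow_id// -fmorphV ReM (ReM (cpow t z)) (ImM (cpow t z)) Re_cpow Im_cpow /=.
by rewrite /GRing.scale /=; ring.
Qed.

Lemma is_derive_Im_cpow (t : R) z : 0 < t ->
  is_derive t 1 (fun x => complex.Im (cpow x z)) (complex.Im (z * cpow t (z - 1))).
Proof.
move=> t0; under [X in is_derive _ _ X]eq_fun do rewrite Im_cpow.
have d1 := is_derive_mul_ln (complex.Re z) t0.
have d2 := is_derive_mul_ln (complex.Im z) t0.
have d3 := @is_derive1_comp R expR _ t _ _ (is_derive_expR _) d1.
have d4 := @is_derive1_comp R (@sin R) _ t _ _ (is_derive_sin _) d2.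
apply: (is_derive_eq (is_deriveM d3 d4)).
rewrite cpowD cpowN cpow_id// -fmorphV ImM (ImM (cpow t z)) (ReM (cpow t z)) Re_cpow Im_cpow /=.
by rewrite /GRing.scale /=; ring.
Qed.

Lemma continuous_Re_cpow (t : R) z : 0 < t -> {for t, continuous (fun x => complex.Re (cpow x z))}.
Proof. by move=> /(is_derive_Re_cpow z)[/derivable1_diffP/differentiable_continuous]. Qed.

Lemma continuous_Im_cpow (t : R) z : 0 < t -> {for t, continuous (fun x => complex.Im (cpow x z))}.
Proof. by move=> /(is_derive_Im_cpow z)[/derivable1_diffP/differentiable_continuous]. Qed.

Lemma continuous_Re_mul_cpow (t : R) w z : 0 < t ->
  {for t, continuous (fun x : R => complex.Re (w * cpow x z))}.
Proof.
move=> t0.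
have -> : (fun x : R => complex.Re (w * cpow x z)) = (fun x : R => complex.Re w *
  complex.Re (cpow x z) - complex.Im w * complex.Im (cpow x z)).
  by apply/funext => x; rewrite ReM.
by apply: cvgB; apply: cvgM; [exact: cvg_cst|exact: continuous_Re_cpow|
  exact: cvg_cst|exact: continuous_Im_cpow].
Qed.

Lemma continuous_Im_mul_cpow (t : R) w z : 0 < t ->
  {for t, continuous (fun x : R => complex.Im (w * cpow x z))}.
Proof.
move=> t0.
have -> : (fun x : R => complex.Im (w * cpow x z)) = (fun x : R => complex.Re w *
  complex.Im (cpow x z) + complex.Im w * complex.Re (cpow x z)).
  by apply/funext => x; rewrite ImM.
by apply: cvgD; apply: cvgM; [exact: cvg_cst|exact: continuous_Im_cpow|
  exact: cvg_cst|exact: continuous_Re_cpow].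
Qed.

Lemma cintegrable_cpow_itv (a b : R) z : 0 < a ->
  cintegrable leb `[a, b] (fun t => cpow t z).
Proof.
move=> a0; split; apply: continuous_itv_integrable => x /andP[ax _].
  by apply: continuous_Re_cpow; exact: lt_le_trans ax.
by apply: continuous_Im_cpow; exact: lt_le_trans ax.
Qed.

(** The factor [z] stands on the left so that the exponent 0 needs no separate treatment. *)
Lemma cint_cpow_itv (a b : R) z : 0 < a -> a <= b ->
  z * cint leb `[a, b] (fun t => cpow t (z - 1)) = cpow b z - cpow a z.
Proof.
move=> a0 ab; rewrite -cintZ//; last exact: cintegrable_cpow_itv.
have pos x : a <= x <= b -> 0 < x by move=> /andP[ax _]; exact: lt_le_trans ax.
apply: cplx_eqP => /=.
  rewrite ReD ReN; apply: (@Rintegral_itv_derive _ (fun x => complex.Re (cpow x z))) => //.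
    by move=> x /pos; exact: is_derive_Re_cpow.
  by move=> x /pos x0; exact: continuous_Re_mul_cpow.
rewrite ImD ImN; apply: (@Rintegral_itv_derive _ (fun x => complex.Im (cpow x z))) => //.
  by move=> x /pos; exact: is_derive_Im_cpow.
by move=> x /pos x0; exact: continuous_Im_mul_cpow.
Qed.

End Powers.

(** * Exhaustion by bounded intervals *)

Section Exhaustion.
Variable R : realType.
Local Notation leb := (@lebesgue_measure R).
Implicit Types (f g : R -> R[i]).

(** These are the truncation intervals of [is_mellin]. *)
Definition trunc_itv (n : nat) : set R := `[n.+1%:R^-1, n.+1%:R].

Lemma trunc_itv_nd : nondecreasing_seq trunc_itv.
Proof.
apply/nondecreasing_seqP => n; rewrite subsetEset => x.
rewrite /trunc_itv /= !in_itv /= => /andP[h1 h2]; apply/andP; split.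
  by rewrite (le_trans _ h1)// lef_pV2 ?posrE// ler_nat.
by rewrite (le_trans h2)// ler_nat.
Qed.

Lemma bigcup_trunc_itv : \bigcup_n trunc_itv n = [set t | 0 < t].
Proof.
apply/seteqP; split => [x [n _]|x /= x0].
  by rewrite /trunc_itv /= in_itv /= => /andP[h _]; rewrite (lt_le_trans _ h)// invr_gt0.
pose n := Num.truncn (x + x^-1).
have h : x + x^-1 < n.+1%:R by apply: truncnS_gt.
have xV : 0 < x^-1 by rewrite invr_gt0.
exists n => //; rewrite /trunc_itv /= in_itv /=; apply/andP; split.
  by rewrite -[leRHS]invrK lef_pV2 ?posrE// ltW// (lt_trans _ h)// ltrDr.
by rewrite ltW// (lt_trans _ h)// ltrDl.
Qed.

Lemma trunc_itv_pos n t : trunc_itv n t -> 0 < t.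
Proof. by move=> h; have : [set t | 0 < t] t by rewrite -bigcup_trunc_itv; exists n. Qed.

Lemma near_trunc_itv t : 0 < t -> \forall n \near \oo, trunc_itv n t.
Proof.
move=> t0; have : [set t | 0 < t] t by [].
rewrite -bigcup_trunc_itv => -[N _ hN].
by exists N => // n /= Nn; move: hN; have := trunc_itv_nd Nn; rewrite subsetEset; apply.
Qed.

Lemma le_integral_exhaust (D : nat -> set R) (f : R -> R) (M : \bar R) :
  nondecreasing_seq D -> (forall n, measurable (D n)) -> measurable_fun setT f ->
  (forall t, 0 <= f t) -> (forall t, ~ (\bigcup_n D n) t -> f t = 0) ->
  (forall n, (\int[leb]_(t in D n) (f t)%:E <= M)%E) ->
  (\int[leb]_t (f t)%:E <= M)%E.
Proof.
move=> ndD mD mf f0 fz hM.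
have -> : (\int[leb]_t (f t)%:E = \int[leb]_(t in \bigcup_n D n) (f t)%:E)%E.
  rewrite [RHS]integral_mkcond; apply: eq_integral => t _.
  by rewrite patchE; case: ifPn => //; rewrite notin_setE => /fz ->.
have mfE n : measurable_fun (D n) (fun t => (f t)%:E).
  by apply/measurable_EFinP; exact: measurable_funTS.
have f0' n t : D n t -> (0 <= (f t)%:E)%E by rewrite lee_fin.
have nd := @ge0_nondecreasing_set_nondecreasing_integral _ (measurableTypeR R) R D
  (fun t => (f t)%:E) leb ndD mD mfE f0'.
have := @ge0_nondecreasing_set_cvg_integral _ (measurableTypeR R) R D
  (fun t => (f t)%:E) leb ndD mD mfE f0'.
move=> /cvg_lim <- //; apply: lime_le; first exact: ereal_nondecreasing_is_cvgn nd.
exact: nearW.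
Qed.

Lemma le_integral_trunc (f : R -> R) (M : \bar R) : measurable_fun setT f ->
  (forall t, 0 <= f t) -> (forall t, t <= 0 -> f t = 0) ->
  (forall n, (\int[leb]_(t in trunc_itv n) (f t)%:E <= M)%E) ->
  (\int[leb]_t (f t)%:E <= M)%E.
Proof.
move=> mf f0 fz hM; apply: (le_integral_exhaust trunc_itv_nd) => //.
  by move=> n; exact: measurable_itv.
by move=> t; rewrite bigcup_trunc_itv /= => /negP; rewrite -leNgt => /fz.
Qed.

Lemma cint_indic (D : set R) f : measurable D ->
  cint leb D f = cint leb setT (fun t => f t * (\1_D t)%:C).
Proof.
move=> mD; rewrite /cint; congr (_ +i* _); rewrite Rintegral_mkcond;
  apply: eq_Rintegral => t _; rewrite patchE indicE; case: ifPn => _ /=.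
- by rewrite mulr1.
- by rewrite mulr0.
- by rewrite mulr1.
- by rewrite mulr0.
Qed.

Lemma cmeasurable_indic (E D : set R) : measurable D ->
  cmeasurable E (fun t => (\1_D t)%:C : R[i]).
Proof. by move=> mD; apply: cmeasurable_real; exact: measurable_indic. Qed.

Lemma cvg_cint_exhaust (D : nat -> set R) f : (forall n, measurable (D n)) ->
  (forall t, f t = 0 \/ \forall n \near \oo, D n t) -> cintegrable leb setT f ->
  cint leb (D n) f @[n --> \oo] --> (cint leb setT f : R[i]^o).
Proof.
move=> mD fz If.
have E n : cint leb (D n) f = cint leb setT (fun t => f t * (\1_(D n) t)%:C).
  exact: cint_indic.
under eq_fun do rewrite E.
have mf := cintegrable_meas If.
have dom := @cint_dominated _ (measurableTypeR R) R leb setT measurableT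
  (fun n t => f t * (\1_(D n) t)%:C) f (fun t => cabs (f t)).
apply: (dom _ _ _ _ _).2 => //.
- by move=> n; apply: cmeasurableM => //; exact: cmeasurable_indic.
- apply: aeW => t _; have [->|h] := fz t.
    by under eq_fun do rewrite mul0r; exact: (@cvg_cst R[i]^o).
  apply/cvgC_cabs; apply: cvg_near_cst.
  apply: filterS h => n h.
  by rewrite indicE mem_set// mulr1 subrr cabs0.
- exact: (cintegrable_cabs measurableT If).
- move=> n t _; rewrite Normc.normcM cabs_real ger0_norm ?indic_ge0//.
  by rewrite ler_piMr ?cabs_ge0// indicE lern1 leq_b1.
Qed.

Lemma cvg_cint_trunc f : cintegrable leb setT f -> (forall t, t <= 0 -> f t = 0) ->
  cint leb (trunc_itv n) f @[n --> \oo] --> (cint leb setT f : R[i]^o).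
Proof.
move=> If fz; apply: cvg_cint_exhaust => //; first by move=> n; exact: measurable_itv.
move=> t; have [t0|t0] := leP t 0; first by left; exact: fz.
by right; exact: near_trunc_itv.
Qed.

Definition sym_itv (n : nat) : set R := `[- n%:R, n%:R].

Lemma sym_itv_nd : nondecreasing_seq sym_itv.
Proof.
apply/nondecreasing_seqP => n; rewrite subsetEset => x.
rewrite /sym_itv /= !in_itv /= => /andP[h1 h2]; apply/andP; split.
  by rewrite (le_trans _ h1)// lerN2 ler_nat.
by rewrite (le_trans h2)// ler_nat.
Qed.

Lemma near_sym_itv t : \forall n \near \oo, sym_itv n t.
Proof.
exists (Num.truncn `|t|).+1 => // n /= hn; rewrite /sym_itv /= in_itv /= -ler_norml.
by rewrite ltW// (lt_le_trans (truncnS_gt _))// ler_nat.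
Qed.

Lemma bigcup_sym_itv : \bigcup_n sym_itv n = setT.
Proof.
by apply/seteqP; split => // t _; have [N _ h] := near_sym_itv t; exists N => //; exact: (h N (leqnn N)).
Qed.

End Exhaustion.

(** * Transforms of powers restricted to ]0, 1] or [1, oo[ *)

Section MellinClass.
Variable R : realType.
Local Notation leb := (@lebesgue_measure R).
Implicit Types (f g : R -> R[i]) (c : R) (s z w : R[i]).

Lemma mellin_classZ c f z : mellin_class c f -> mellin_class c (fun t => z * f t).
Proof.
move=> [mf f0 h]; split.
- by apply: cmeasurableM => //; exact: cmeasurable_cst.
- by move=> t /f0 ->; rewrite mulr0.
- under eq_integral do rewrite Normc.normcM -mulrA EFinM.
  rewrite ge0_integralZl//.
  + by apply: lte_mul_pinfty => //; rewrite lee_fin cabs_ge0.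
  + apply/measurable_EFinP; apply: measurable_funM; first exact: measurable_cabs.
    exact: measurable_mellin_weight.
  + by move=> t _; rewrite lee_fin mulr_ge0 ?cabs_ge0 ?expR_ge0.
  + by rewrite lee_fin cabs_ge0.
Qed.

Lemma mellin_class_le c f g1 g2 : cmeasurable setT f -> (forall t, t <= 0 -> f t = 0) ->
  mellin_class c g1 -> mellin_class c g2 ->
  (forall t, 0 < t -> cabs (f t) <= cabs (g1 t) + cabs (g2 t)) -> mellin_class c f.
Proof.
move=> mf f0 [m1 _ h1] [m2 _ h2] fg; split => //.
have mw := measurable_mellin_weight c.
have mE g : cmeasurable setT g ->
    measurable_fun setT (fun t => (cabs (g t) * expR ((c - 1) * ln t))%:E).
  by move=> mg; apply/measurable_EFinP; apply: measurable_funM => //; exact: measurable_cabs.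
apply: (@le_lt_trans _ _ (\int[leb]_t ((cabs (g1 t) * expR ((c - 1) * ln t))%:E +
   (cabs (g2 t) * expR ((c - 1) * ln t))%:E))%E).
  apply: ge0_le_integral => //.
  - by move=> t _; rewrite lee_fin mulr_ge0 ?cabs_ge0 ?expR_ge0.
  - exact: mE.
  - by apply: emeasurable_funD; exact: mE.
  - move=> t _; rewrite -EFinD lee_fin -mulrDl ler_pM2r ?expR_gt0//.
    have [t0|t0] := leP t 0; last exact: fg.
    by rewrite f0// cabs0 addr_ge0 ?cabs_ge0.
rewrite ge0_integralD//.
- exact: lte_add_pinfty.
- by move=> t _; rewrite lee_fin mulr_ge0 ?cabs_ge0 ?expR_ge0.
- exact: mE.
- by move=> t _; rewrite lee_fin mulr_ge0 ?cabs_ge0 ?expR_ge0.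
- exact: mE.
Qed.

Lemma mellin_classD c f g : mellin_class c f -> mellin_class c g ->
  mellin_class c (fun t => f t + g t).
Proof.
move=> Lf Lg; have [mf f0 _] := Lf; have [mg g0 _] := Lg.
apply: (mellin_class_le _ _ Lf Lg); first exact: cmeasurableD.
  by move=> t t0; rewrite f0// g0// addr0.
by move=> t _; exact: cabsD.
Qed.

Lemma mellin_classB c f g : mellin_class c f -> mellin_class c g ->
  mellin_class c (fun t => f t - g t).
Proof.
move=> Lf Lg; under [X in mellin_class _ X]eq_fun do rewrite -mulN1r.
by apply: mellin_classD => //; exact: mellin_classZ.
Qed.

Lemma mellinD c f g s : mellin_class c f -> mellin_class c g -> complex.Re s = c ->
  mellin (fun t => f t + g t) s = mellin f s + mellin g s.
Proof.
move=> Lf Lg sc; rewrite /mellin -cintD//; last 2 first.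
- exact: (cintegrable_mellin Lf).
- exact: (cintegrable_mellin Lg).
by apply: eq_cint => t _; rewrite mulrDl.
Qed.

Lemma mellinZ c f s z : mellin_class c f -> complex.Re s = c ->
  mellin (fun t => z * f t) s = z * mellin f s.
Proof.
move=> Lf sc; rewrite /mellin -cintZ//; last exact: (cintegrable_mellin Lf).
by apply: eq_cint => t _; rewrite mulrA.
Qed.

Lemma mellinB c f g s : mellin_class c f -> mellin_class c g -> complex.Re s = c ->
  mellin (fun t => f t - g t) s = mellin f s - mellin g s.
Proof.
move=> Lf Lg sc; rewrite /mellin -cintB//; last 2 first.
- exact: (cintegrable_mellin Lf).
- exact: (cintegrable_mellin Lg).
by apply: eq_cint => t _; rewrite mulrBl.
Qed.

Lemma mellin_class_mul_indic c f D : measurable D -> mellin_class c f ->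
  mellin_class c (fun t => f t * (\1_D t)%:C).
Proof.
move=> mD Lf; have [mf f0 _] := Lf.
apply: (mellin_class_le _ _ Lf (mellin_classZ 0 Lf)).
- by apply: cmeasurableM => //; exact: cmeasurable_indic.
- by move=> t t0; rewrite f0// mul0r.
- move=> t t0; rewrite mul0r cabs0 addr0 Normc.normcM cabs_real.
  by rewrite ger0_norm ?indic_ge0// ler_piMr ?cabs_ge0// indicE lern1 leq_b1.
Qed.

(** Its transform is 1 / (w - s) to the left of [w], and that of [head_pow w] is 1 / (s - w) to the
    right. [tail_pow 1] is the kernel of the operator K of the overview. *)
Definition tail_pow w (t : R) : R[i] := if 1 <= t then cpow t (- w) else 0.

Definition head_pow w (t : R) : R[i] := if 0 < t <= 1 then cpow t (- w) else 0.

Lemma cmeasurable_tail_pow w : cmeasurable setT (tail_pow w).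
Proof.
rewrite (_ : tail_pow w = fun t => cpow t (- w) * (\1_(`[1, +oo[%classic : set R) t)%:C).
  apply: cmeasurableM; first exact: cmeasurable_cpow_id.
  by apply: cmeasurable_indic; exact: measurable_itv.
apply/funext => t; rewrite /tail_pow indicE mem_setE in_itv /= andbT.
by case: ifPn; rewrite ?mulr1 ?mulr0.
Qed.

Lemma cmeasurable_head_pow w : cmeasurable setT (head_pow w).
Proof.
rewrite (_ : head_pow w = fun t => cpow t (- w) * (\1_(`]0, 1]%classic : set R) t)%:C).
  apply: cmeasurableM; first exact: cmeasurable_cpow_id.
  by apply: cmeasurable_indic; exact: measurable_itv.
apply/funext => t; rewrite /head_pow indicE mem_setE in_itv /=.
by case: ifPn; rewrite ?mulr1 ?mulr0.
Qed.

Lemma cint_tail_pow_trunc w s n :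
  cint leb (trunc_itv n) (fun t => tail_pow w t * cpow t (s - 1)) =
  cint leb `[1, n.+1%:R] (fun t => cpow t (s - w - 1)).
Proof.
rewrite [LHS]cint_indic; last exact: measurable_itv.
rewrite [RHS]cint_indic; last exact: measurable_itv.
apply: eq_cint => t _; rewrite /trunc_itv !indicE !mem_setE !in_itv /= /tail_pow.
case: ifPn => t1 /=; last by rewrite !mul0r mulr0.
rewrite (le_trans _ t1) ?invf_le1 ?ler1n//= -cpowD; congr (cpow t _ * _); ring.
Qed.

Lemma cint_head_pow_trunc w s n :
  cint leb (trunc_itv n) (fun t => head_pow w t * cpow t (s - 1)) =
  cint leb `[n.+1%:R^-1, 1] (fun t => cpow t (s - w - 1)).
Proof.
rewrite [LHS]cint_indic; last exact: measurable_itv.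
rewrite [RHS]cint_indic; last exact: measurable_itv.
apply: eq_cint => t _; rewrite /trunc_itv !indicE !mem_setE !in_itv /= /head_pow.
have [t0|t0] /= := ltP 0 t; last first.
  have /negbTE -> : ~~ (n.+1%:R^-1 <= t) by rewrite -ltNge (le_lt_trans t0)// invr_gt0.
  by rewrite !mul0r mulr0.
case: (leP t 1) => t1 /=; last by rewrite andbF !mul0r mulr0.
rewrite (le_trans t1) ?ler1n//= -cpowD; congr (cpow t _ * _); ring.
Qed.

Lemma integral_expR_ln (a b z : R) : 0 < a -> a <= b -> z != 0 ->
  (\int[leb]_(t in `[a, b]) (expR ((z - 1) * ln t))%:E =
   ((expR (z * ln b) - expR (z * ln a)) / z)%:E)%E.
Proof.
move=> a0 ab z0; have pos x : a <= x <= b -> 0 < x by move=> /andP[ax _]; exact: lt_le_trans ax.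
rewrite mulrBl; apply: (@integral_itv_derive _ (fun x => expR (z * ln x) / z)) => //.
- move=> x /pos x0.
  have d1 := is_derive_mul_ln z x0.
  have d3 := @is_derive1_comp R expR _ x _ _ (is_derive_expR _) d1.
  have := @is_deriveM R R^o (expR \o (fun x => z * ln x)) (cst z^-1) x 1 _ _ d3 (is_derive_cst _ _ _).
  move=> h; apply: (is_derive_eq h); rewrite /GRing.scale /= mulr0 add0r.
  rewrite mulrBl mul1r expRB lnK//.
  by field; rewrite z0 gt_eqF.
- move=> x /pos x0.
  have d1 := is_derive_mul_ln (z - 1) x0.
  have [d3 _] := @is_derive1_comp R expR _ x _ _ (is_derive_expR _) d1.
  by move: d3 => /derivable1_diffP/differentiable_continuous.
Qed.

Lemma mellin_class_trunc c f (M : R) : cmeasurable setT f -> (forall t, t <= 0 -> f t = 0) ->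
  (forall n, (\int[leb]_(t in trunc_itv n) (cabs (f t) * expR ((c - 1) * ln t))%:E <= M%:E)%E) ->
  mellin_class c f.
Proof.
move=> mf f0 h; split => //; apply: (@le_lt_trans _ _ M%:E); last exact: ltry.
apply: le_integral_trunc => //.
- by apply: measurable_funM; [exact: measurable_cabs|exact: measurable_mellin_weight].
- by move=> t; rewrite mulr_ge0 ?cabs_ge0 ?expR_ge0.
- by move=> t /f0 ->; rewrite cabs0 mul0r.
Qed.

Lemma mellin_class_tail_pow c w : c < complex.Re w -> mellin_class c (tail_pow w).
Proof.
move=> cw; have z0 : c - complex.Re w < 0 by lra.
apply: (@mellin_class_trunc _ _ ((complex.Re w - c)^-1)).
- exact: cmeasurable_tail_pow.
- by move=> t t0; rewrite /tail_pow leNgt (le_lt_trans t0).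
- move=> n; rewrite [leLHS](_ : _ = \int[leb]_(t in `[1%R, n.+1%:R])
      (expR ((c - complex.Re w - 1) * ln t))%:E)%E.
    rewrite integral_expR_ln ?ler1n ?lt_eqF// lee_fin ln1 mulr0 expR0.
    rewrite -[c - complex.Re w]opprB invrN mulrN -mulNr opprB.
    by rewrite ler_piMl ?invr_ge0 ?subr_ge0 ?(ltW cw)// gerBl expR_ge0.
  rewrite integral_mkcond [RHS]integral_mkcond; apply: eq_integral => t _.
  rewrite !patchE /trunc_itv !mem_setE !in_itv /= /tail_pow; case: (leP 1 t) => t1 /=.
    rewrite (le_trans _ t1) ?invf_le1 ?ler1n//=; case: ifP => // _.
    by rewrite cabs_cpow ReN -expRD; congr (expR _)%:E; ring.
  by rewrite cabs0 mul0r; case: ifP.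
Qed.

Lemma mellin_class_head_pow c w : complex.Re w < c -> mellin_class c (head_pow w).
Proof.
move=> cw; have z0 : 0 < c - complex.Re w by lra.
apply: (@mellin_class_trunc _ _ ((c - complex.Re w)^-1)).
- exact: cmeasurable_head_pow.
- by move=> t t0; rewrite /head_pow ltNge t0.
- move=> n; have n1 : n.+1%:R^-1 <= 1 :> R by rewrite invf_le1 ?ler1n.
  rewrite [leLHS](_ : _ = \int[leb]_(t in `[(n.+1%:R^-1)%R, 1%R])
      (expR ((c - complex.Re w - 1) * ln t))%:E)%E.
    rewrite integral_expR_ln ?invr_gt0 ?gt_eqF// lee_fin ln1 mulr0 expR0.
    by rewrite ler_piMl ?invr_ge0 ?(ltW z0)// gerBl expR_ge0.
  rewrite integral_mkcond [RHS]integral_mkcond; apply: eq_integral => t _.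
  rewrite !patchE /trunc_itv !mem_setE !in_itv /= /head_pow.
  have [h|h] /= := leP (n.+1%:R^-1 : R) t => //.
  have t0 : 0 < t by rewrite (lt_le_trans _ h)// invr_gt0.
  rewrite t0 /=; case: (leP t 1) => t1 /=.
    rewrite (le_trans t1) ?ler1n// cabs_cpow ReN -expRD; congr (expR _)%:E; ring.
  by rewrite cabs0 mul0r; case: ifP.
Qed.

Lemma cvg_cpow_nat z : complex.Re z < 0 ->
  cpow n.+1%:R z @[n --> \oo] --> (0 : R[i]^o).
Proof.
move=> z0; apply/cvgC_cabs; under eq_fun do rewrite subr0 cabs_cpow.
apply/(@cvgrPdist_lt _ R^o) => e e0; near=> n.
rewrite sub0r normrN ger0_norm ?expR_ge0// -[ltRHS]lnK// ltr_expR.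
rewrite mulrC -ltr_ndivrMr// -ltr_expR lnK ?posrE//.
near: n; exists (Num.truncn (expR (ln e / complex.Re z))) => // n /= hn.
by rewrite (lt_le_trans (truncnS_gt _))// ler_nat ltnS.
Unshelve. all: by end_near. Qed.

Lemma mellin_tail_pow w s : complex.Re s < complex.Re w -> mellin (tail_pow w) s = (w - s)^-1.
Proof.
move=> sw; have L := mellin_class_tail_pow sw.
have z0 : complex.Re (s - w) < 0 by rewrite ReD ReN; lra.
have zn : s - w != 0 by apply: contraTneq z0 => ->; rewrite /= ltxx.
have I := cintegrable_mellin L erefl.
have fz t : t <= 0 -> tail_pow w t * cpow t (s - 1) = 0 by move=> t0; have [_ h _] := L; rewrite (h _ t0) mul0r.
have h := cvg_cint_trunc I fz; apply: (cvgC_unique h).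
under eq_fun do rewrite cint_tail_pow_trunc.
rewrite (_ : (fun n => _) = fun n => (cpow n.+1%:R (s - w) - 1) / (s - w)); last first.
  apply/funext => n; have := @cint_cpow_itv R 1 n.+1%:R (s - w) ltr01.
  by rewrite ler1n cpow1 => /(_ isT) <-; rewrite mulrC mulKf.
rewrite (_ : (w - s)^-1 = (0 - 1) / (s - w)); last first.
  by rewrite sub0r mulN1r -invrN opprB.
by apply: cvgCM; [apply: cvgCB; [exact: cvg_cpow_nat|exact: cvgC_cst]|exact: cvgC_cst].
Qed.

Lemma mellin_head_pow w s : complex.Re w < complex.Re s -> mellin (head_pow w) s = (s - w)^-1.
Proof.
move=> sw; have L := mellin_class_head_pow sw.
have z0 : 0 < complex.Re (s - w) by rewrite ReD ReN; lra.
have zn : s - w != 0 by apply: contraTneq z0 => ->; rewrite /= ltxx.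
have I := cintegrable_mellin L erefl.
have fz t : t <= 0 -> head_pow w t * cpow t (s - 1) = 0 by move=> t0; have [_ h _] := L; rewrite (h _ t0) mul0r.
have h := cvg_cint_trunc I fz; apply: (cvgC_unique h).
under eq_fun do rewrite cint_head_pow_trunc.
rewrite (_ : (fun n => _) = fun n => (1 - cpow n.+1%:R (- (s - w))) / (s - w)); last first.
  apply/funext => n; have := @cint_cpow_itv R n.+1%:R^-1 1 (s - w).
  rewrite invr_gt0 ltr0Sn invf_le1 ?ler1n// cpow1 cpowV// => /(_ isT isT) <-.
  by rewrite mulrC mulKf.
suff : (fun n => (1 - cpow n.+1%:R (- (s - w))) / (s - w)) @ \oo -->
    ((1 - 0) / (s - w) : R[i]^o) by rewrite subr0 mul1r.
apply: cvgCM; last exact: cvgC_cst.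
apply: cvgCB; first exact: cvgC_cst.
by apply: cvg_cpow_nat; rewrite ReN oppr_lt0.
Qed.

End MellinClass.

(** * The functions psi_{w,k} and their transforms *)

Section PsiMellin.
Variable R : realType.
Local Notation leb := (@lebesgue_measure R).
Implicit Types (f g : R -> R[i]) (c : R) (s z w : R[i]).

Lemma cint_real (D : set R) (h : R -> R) :
  cint leb D (fun t => (h t)%:C) = (Rintegral leb D h)%:C.
Proof. by rewrite /cint /=; congr (_ +i* _); rewrite /Rintegral integral0. Qed.

Lemma cint0 (D : set R) : cint leb D (fun=> 0) = 0.
Proof. by rewrite /cint /Rintegral integral0. Qed.

Lemma psi0 w : psi w 0 = head_pow w.
Proof.
apply/funext => t; rewrite /psi /head_pow /chi expr0 mul1r.
by case: ifP; rewrite ?mulr1 ?mulr0.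
Qed.

Lemma Rintegral_ln_pow (t : R) k : 0 < t -> t <= 1 ->
  Rintegral leb `[t, 1] (fun u => ln u^-1 ^+ k / u) = ln t^-1 ^+ k.+1 / k.+1%:R.
Proof.
move=> t0 t1; have k0 : k.+1%:R != 0 :> R by rewrite pnatr_eq0.
have pos x : t <= x <= 1 -> 0 < x by move=> /andP[ax _]; exact: lt_le_trans ax.
have lnN (x : R) : 0 < x -> ln x^-1 = - ln x by move=> x0; rewrite lnV.
have dk (j : nat) (x : R) : 0 < x -> is_derive x 1 (fun u => (-1 * ln u) ^+ j.+1)
    (j.+1%:R * (- ln x) ^+ j * (- x^-1)).
  move=> x0; have d1 := is_derive_mul_ln (-1) x0.
  have := @is_deriveX R R^o (fun u => -1 * ln u) j.+1 x 1 _ d1.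
  move=> h; rewrite (_ : (fun u => _) = (fun u : R => -1 * ln u) ^+ j.+1).
    by apply: (is_derive_eq h); rewrite /GRing.scale /= !mulN1r.
  by apply/funext => u; rewrite exprfctE.
transitivity (Rintegral leb `[t, 1] (fun u => (- ln u) ^+ k / u)).
  apply: eq_Rintegral => x; rewrite inE /= in_itv /= => /pos x0; rewrite lnN//.
rewrite (_ : ln t^-1 ^+ k.+1 / k.+1%:R = - ((-1 * ln 1) ^+ k.+1 / k.+1%:R) -
    - ((-1 * ln t) ^+ k.+1 / k.+1%:R)); last first.
  by rewrite ln1 mulr0 expr0n mul0r oppr0 opprK add0r mulN1r lnN.
apply: (@Rintegral_itv_derive _ (fun u => - ((-1 * ln u) ^+ k.+1 / k.+1%:R))) => //.
- move=> x /pos x0; have d := dk k x x0.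
  have := @is_deriveM R R^o (fun u => (-1 * ln u) ^+ k.+1) (cst (- k.+1%:R^-1)) x 1 _ _ d (is_derive_cst _ _ _).
  move=> h; rewrite (_ : (fun u => _) = (fun u => (-1 * ln u) ^+ k.+1) * cst (- k.+1%:R^-1)).
    apply: (is_derive_eq h); rewrite /GRing.scale /= mulr0 add0r.
    by field; rewrite gt_eqF//= nat1r.
  by apply/funext => u; rewrite /GRing.mul /= mulrN.
- move=> x /pos x0; apply: cvgM; last by apply: inv_continuous; rewrite gt_eqF.
  have dl : {for x, continuous (@ln R)}.
    by have [/derivable1_diffP/differentiable_continuous] := is_derive1_ln x0.
  by apply: (continuous_comp (f := fun u => - ln u) (g := fun y => y ^+ k));
    [exact: cvgN|exact: exprn_continuous].
Qed.

(** In the convolution the powers of [u] cancel, leaving t^(-w) times the integral of (log (1/u))^k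
    du / u over [t, 1]. Thus the transforms of all psi_{w,k} are obtained as products, without
    differentiating in [w]. *)
Lemma psiS w k : psi w k.+1 = fun t => k.+1%:R * mconv (psi w 0) (psi w k) t.
Proof.
apply/funext => t; have [t01|] := boolP (0 < t <= 1); last first.
  move=> h; rewrite {1}/psi /chi (negbTE h) mulr0.
  rewrite /mconv (@eq_cint _ _ _ _ _ _ (fun=> 0)).
    by rewrite cint0 mulr0.
  move=> u _; rewrite /psi /chi.
  case: (boolP (0 < u <= 1)) => [/andP[u0 u1]|_]; last by rewrite !mulr0 mul0r.
  case: ifPn => [/andP[tu0 tu1]|_]; last by rewrite mulr0 !mul0r.
  move: h; rewrite (_ : 0 < t <= 1)//; apply/andP; split.
    by move: tu0; rewrite pmulr_lgt0// invr_gt0.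
  by move: tu1; rewrite ler_pdivrMr// mul1r => /le_trans; apply.
have /andP[t0 t1] := t01.
rewrite {1}/psi /chi t01 mulr1.
have -> : mconv (psi w 0) (psi w k) t =
    cint leb `[t, 1] (fun u => cpow t (- w) * (ln u^-1 ^+ k / u)%:C).
  rewrite cint_indic; last exact: measurable_itv.
  apply: eq_cint => u _; rewrite /psi /chi indicE mem_setE in_itv /= expr0 mul1r.
  have [u0|u0] := leP u 0.
    have -> : (t <= u) = false by rewrite leNgt (le_lt_trans u0 t0).
    by rewrite /= !mulr0 !mul0r.
  rewrite divr_gt0//= ler_pdivrMr// mul1r.
  case: (leP t u) => tu /=; last by rewrite !mulr0 !mul0r.
  case: (leP u 1) => u1 /=; last by rewrite !mulr0 !mul0r.
  rewrite cpowM ?invr_gt0// cpowV// rmorphM !mulr1 opprK.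
  have := cpowNr u w; set a := cpow u w; set b := cpow u (- w) => ab.
  transitivity (cpow t (- w) * ((ln u^-1 ^+ k)%:C * (u^-1)%:C) * (a * b)); first by ring.
  by rewrite ab mulr1.
rewrite cintZ//; last first.
  apply: (@le_cintegrable _ _ _ _ _ _ _ (fun u => ln t^-1 ^+ k / t)) => //.
  - apply: cmeasurable_real; apply: measurable_funM.
      apply: measurable_funX; apply: measurableT_comp; first exact: measurable_ln.
      by apply: measurable_funTS; exact: measurable_inv.
    by apply: measurable_funTS; exact: measurable_inv.
  - by apply: continuous_itv_integrable => x _; exact: cvg_cst.
  - move=> u; rewrite /= in_itv /= => /andP[tu u1]; have u0 := lt_le_trans t0 tu.
    have l0 : 0 <= ln u^-1 by rewrite ln_ge0// invf_ge1.
    rewrite cabs_real ger0_norm; last first.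
      by rewrite mulr_ge0 ?invr_ge0 ?(ltW u0)//; apply: exprn_ge0.
    have lut : ln u^-1 <= ln t^-1 by rewrite ler_ln ?posrE ?invr_gt0// lef_pV2 ?posrE.
    rewrite ler_pM ?exprn_ge0 ?invr_ge0 ?(ltW u0)//.
      by rewrite lerXn2r ?nnegrE// (le_trans l0).
    by rewrite lef_pV2 ?posrE.
rewrite cint_real Rintegral_ln_pow//; move: (cpow t (- w)) => c.
rewrite [RHS]mulrCA [LHS]mulrC; congr (_ * _).
have -> : k.+1%:R = (k.+1%:R : R)%:C by rewrite rmorph_nat.
rewrite -rmorphM; congr (_%:C).
by rewrite mulrC divfK// pnatr_eq0.
Qed.

Lemma mellin_psi c w k : complex.Re w < c -> mellin_class c (psi w k) /\
  forall s, complex.Re s = c -> mellin (psi w k) s = k`!%:R / (s - w) ^+ k.+1.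
Proof.
move=> wc; elim: k => [|k [Lk ih]].
  rewrite psi0; split; first exact: mellin_class_head_pow.
  by move=> s sc; rewrite mellin_head_pow ?sc// mul1r expr1.
have L0 : mellin_class c (psi w 0) by rewrite psi0; exact: mellin_class_head_pow.
split; first by rewrite psiS; apply: mellin_classZ; exact: mellin_class_mconv.
move=> s sc; rewrite psiS.
rewrite (mellinZ _ (mellin_class_mconv L0 Lk))// (mellin_mconv L0 Lk)// ih// psi0.
rewrite mellin_head_pow ?sc// factS natrM [in RHS]exprS invfM -[RHS]mulrA; congr (_ * _).
by rewrite mulrCA.
Qed.

End PsiMellin.

(** * Convolution with 1 / t on [1, oo[ *)

Section Kernels.
Variable R : realType.
Local Notation leb := (@lebesgue_measure R).
Implicit Types (f g q : R -> R[i]) (c t u : R) (s z w : R[i]).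

Lemma norm_sin_le (x : R) : `|sin x| <= `|x|.
Proof.
wlog x0 : x / 0 <= x => [h|].
  by case: (leP 0 x) => [/h //|/ltW x0]; rewrite -normrN -sinN -(normrN x) h// oppr_ge0.
rewrite (ger0_norm x0); move: x0; rewrite le_eqVlt => /predU1P[<-|x0].
  by rewrite sin0 normr0.
have [|y _] := @MVT R (@sin R) (@cos R) 0 x x0 (fun y _ => is_derive_sin y).
  by apply: continuous_subspaceT; exact: continuous_sin.
rewrite sin0 !subr0 => ->; rewrite normrM (gtr0_norm x0) ler_piMl ?(ltW x0)//.
by rewrite ler_norml cos_geN1 cos_le1.
Qed.

Lemma mconv_le f q t (h : R -> R) (M : R) : cmeasurable setT f -> cmeasurable setT q ->
  measurable_fun setT h -> (forall u, 0 <= h u) -> (\int[leb]_u (h u)%:E <= M%:E)%E ->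
  (forall u, cabs (f (t / u) * q u * (u^-1)%:C) <= h u) ->
  cabs (mconv f q t) <= M *+ 2.
Proof.
move=> mf mq mh h0 hM hle.
have ih : leb.-integrable setT (fun u => (h u)%:E).
  apply/integrableP; split; first exact/measurable_EFinP.
  under eq_integral do rewrite abse_EFin ger0_norm//.
  by apply: le_lt_trans hM _; exact: ltry.
have mk : cmeasurable setT (fun u => f (t / u) * q u * (u^-1)%:C).
  have mi : measurable_fun setT (fun u : R => u^-1) by exact: measurable_inv.
  have md : measurable_fun setT (fun u : R => t / u) by exact: measurable_funM.
  apply: cmeasurableM; last exact: cmeasurable_real.
  apply: cmeasurableM => //.
  by case: mf => r j; split; [exact: (measurableT_comp r)|exact: (measurableT_comp j)].
have I : cintegrable leb setT (fun u => f (t / u) * q u * (u^-1)%:C).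
  exact: (@le_cintegrable _ (measurableTypeR R) R leb setT measurableT _ h mk ih).
apply: le_cabs_cint => //; apply: le_trans hM.
apply: ge0_le_integral => //.
- by move=> u _; rewrite lee_fin cabs_ge0.
- by apply/measurable_EFinP; exact: measurable_cabs.
- exact/measurable_EFinP.
- by move=> u _; rewrite lee_fin.
Qed.

(** Convolution with [tail_pow 1] is the Hardy averaging operator. In this form it visibly preserves
    boundedness and turns bounded functions into continuous ones on ]0, oo[. *)
Lemma mconv_tail1 q t : (forall u, u <= 0 -> q u = 0) -> 0 < t -> cmeasurable setT q ->
  cintegrable leb `[0, t] q ->
  mconv (tail_pow 1) q t = (t^-1)%:C * cint leb `[0, t] q.
Proof.
move=> q0 t0 mq iq; rewrite -cintZ// [RHS]cint_indic; last exact: measurable_itv.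
apply: eq_cint => u _; rewrite indicE mem_setE in_itv /= /tail_pow.
have [u0|u0] := leP u 0; first by rewrite q0// !mulr0 !mul0r.
rewrite (ltW u0) /= ler_pdivlMr// mul1r.
case: (leP u t) => ut; last by rewrite mul0r mul0r mulr0.
rewrite mulr1 cpowN cpow_id ?divr_gt0// -fmorphV invf_div.
rewrite [in RHS]mulrC -mulrA mulrCA -rmorphM; congr (_ * _%:C).
by rewrite mulrAC mulfV ?gt_eqF// mul1r.
Qed.

Lemma cintegrable_bounded_itv q (a b B : R) : cmeasurable setT q ->
  (forall u, cabs (q u) <= B) -> cintegrable leb `[a, b] q.
Proof.
move=> [mr mi] qB; apply: (@le_cintegrable _ _ _ _ _ _ _ (fun=> B)) => //.
- by split; exact: measurable_funTS.
- by apply: continuous_itv_integrable => x _; exact: cvg_cst.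
Qed.

Lemma mconv_tail1_bounded q B t : (forall u, u <= 0 -> q u = 0) -> cmeasurable setT q ->
  (forall u, cabs (q u) <= B) -> cabs (mconv (tail_pow 1) q t) <= B *+ 2.
Proof.
move=> q0 mq qB; have B0 : 0 <= B by apply: le_trans (qB 0); exact: cabs_ge0.
have [t0|t0] := leP t 0.
  rewrite /mconv (@eq_cint _ _ _ _ _ _ (fun=> 0)); last first.
    move=> u _; have [u0|u0] := leP u 0; first by rewrite q0// mulr0 mul0r.
    rewrite /tail_pow ler_pdivlMr// mul1r leNgt (le_lt_trans t0 u0)//.
    by rewrite !mul0r.
  by rewrite cint0 cabs0 mulrn_wge0.
have mi : measurable (`[0, t]%classic : set R) by exact: measurable_itv.
apply: (@mconv_le _ _ _ (fun u => B / t * \1_(`[0, t]%classic) u)) => //.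
- exact: cmeasurable_tail_pow.
- by apply: measurable_funM => //; exact: measurable_indic.
- by move=> u; rewrite mulr_ge0 ?indic_ge0// divr_ge0// ltW.
- under eq_integral do rewrite EFinM.
  rewrite ge0_integralZl//; last 2 first.
  + by apply/measurable_EFinP; exact: measurable_indic.
  + by rewrite lee_fin divr_ge0// ltW.
  rewrite integral_indic// setIT /= lebesgue_measure_itv /= lte_fin t0 sube0 -EFinM.
  by rewrite divfK// gt_eqF.
- move=> u; rewrite indicE mem_setE in_itv /= /tail_pow.
  have [u0|u0] := leP u 0.
    by rewrite q0// mulr0 mul0r cabs0 mulr_ge0// divr_ge0// ltW.
  rewrite (ltW u0) /= ler_pdivlMr// mul1r.
  case: (leP u t) => ut; last by rewrite !mul0r cabs0 mulr0.
  rewrite mulr1 2!Normc.normcM cpowN cpow_id ?divr_gt0// -fmorphV invf_div !cabs_real.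
  rewrite !ger0_norm ?divr_ge0 ?invr_ge0 ?(ltW u0) ?(ltW t0)//.
  rewrite mulrAC mulrC (mulrC u) -[X in _ * X <= _]mulrA mulfV ?gt_eqF// mulr1.
  by rewrite ler_pM2r ?invr_gt0.
Qed.

(** The bound is B t^(-1/2), the critical size for [mellin_class 2^-1]: together the two conditions
    give square integrability, as |f|^2 <= B t^(-1/2) |f|. It also makes f t^(1/2) bounded, as the
    approximate identity below requires. *)
Definition half_bounded f := exists B : R, forall t, 0 < t -> cabs (f t) <= B * expR (- (2^-1 * ln t)).

(** The average only involves u <= t, where 1 / t <= t^(-1/2) u^(-1/2); what remains is the weighted
    norm of [q] at abscissa 1/2. *)
Lemma mconv_tail1_half q : mellin_class 2^-1 q -> half_bounded (mconv (tail_pow 1) q).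
Proof.
move=> [mq q0 Iq].
set N := (\int[leb]_t (cabs (q t) * expR ((2^-1 - 1) * ln t))%:E)%E in Iq.
have N0 : (0 <= N)%E by apply: integral_ge0 => t _; rewrite lee_fin mulr_ge0 ?cabs_ge0 ?expR_ge0.
have NE : N = (fine N)%:E by rewrite fineK// ge0_fin_numE.
exists (fine N *+ 2) => t t0.
have mw : measurable_fun setT (fun t => cabs (q t) * expR ((2^-1 - 1) * ln t)).
  by apply: measurable_funM; [exact: measurable_cabs|exact: measurable_mellin_weight].
rewrite mulrnAl; apply: (@mconv_le _ _ _
    (fun u => expR (- (2^-1 * ln t)) * (cabs (q u) * expR ((2^-1 - 1) * ln u)))) => //.
- exact: cmeasurable_tail_pow.
- exact: measurable_funM.
- by move=> u; rewrite !mulr_ge0 ?cabs_ge0 ?expR_ge0.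
- under eq_integral do rewrite EFinM.
  rewrite ge0_integralZl//; last 2 first.
  + by apply/measurable_EFinP; exact: mw.
  + by move=> u _; rewrite lee_fin mulr_ge0 ?cabs_ge0 ?expR_ge0.
  by rewrite -/N NE -EFinM mulrC.
- move=> u; rewrite /tail_pow; have [u0|u0] := leP u 0.
    by rewrite q0// mulr0 mul0r cabs0 !mulr_ge0 ?expR_ge0 ?cabs_ge0.
  rewrite ler_pdivlMr// mul1r.
  case: (leP u t) => ut; last by rewrite !mul0r cabs0 !mulr_ge0 ?expR_ge0 ?cabs_ge0.
  rewrite 2!Normc.normcM cpowN cpow_id ?divr_gt0// -fmorphV invf_div !cabs_real.
  rewrite !ger0_norm ?divr_ge0 ?invr_ge0 ?(ltW u0) ?(ltW t0)//.
  rewrite -[leLHS](_ : t^-1 * cabs (q u) = _); last by field; rewrite !gt_eqF.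
  rewrite mulrCA mulrC ler_wpM2l ?cabs_ge0// -expRD -[X in X^-1]lnK// -expRN ler_expR.
  have : ln u <= ln t by rewrite ler_ln ?posrE.
  lra.
Qed.

Lemma cvg_mconv_tail1 q B t : (forall u, u <= 0 -> q u = 0) -> cmeasurable setT q ->
  (forall u, cabs (q u) <= B) -> 0 < t ->
  mconv (tail_pow 1) q x @[x --> t] --> (mconv (tail_pow 1) q t : R[i]^o).
Proof.
move=> q0 mq qB t0; have B0 : 0 <= B by apply: le_trans (qB 0); exact: cabs_ge0.
have iq x : cintegrable leb `[0, x] q by exact: cintegrable_bounded_itv qB.
rewrite mconv_tail1//.
suff h : (fun x : R => (x^-1)%:C * cint leb `[0, x] q) @ t --> ((t^-1)%:C * cint leb `[0, t] q : R[i]^o).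
  apply: (cvg_trans _ h); apply: near_eq_cvg; near=> x; rewrite mconv_tail1//.
  by near: x; exact: lt_nbhsr.
apply: cvgCM.
  apply/cvgC_ReIm; split => /=; last exact: cvg_cst.
  by apply: inv_continuous; rewrite gt_eqF.
(* Continuity of the average reduces to that of the primitive of [q], which is Lipschitz because [q]
   is bounded. *)
have lip a b : a <= b -> cabs (cint leb `[0, b] q - cint leb `[0, a] q) <= B * (b - a) *+ 2.
  move=> ab.
  rewrite (cint_indic q (measurable_itv `[0, b])) (cint_indic q (measurable_itv `[0, a])).
  have ii x : cintegrable leb setT (fun u => q u * (\1_(`[0, x]%classic) u)%:C).
    have /cintegrable_ltyP[//|_ h] := iq x; apply/cintegrable_ltyP => //; split.
      by apply: cmeasurableM => //; apply: cmeasurable_indic; exact: measurable_itv.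
    move: h; rewrite integral_mkcond; congr (_ < _)%E; apply: eq_integral => u _.
    rewrite patchE indicE; case: ifP => _; first by rewrite mulr1.
    by rewrite mulr0 cabs0.
  rewrite -cintB//.
  have mba : measurable (`[a, b]%classic : set R) by exact: measurable_itv.
  apply: le_cabs_cint => //; first exact: cintegrableB.
  apply: (@le_trans _ _ (\int[leb]_u (B%:E * (\1_(`[a, b]%classic) u)%:E))%E).
    apply: ge0_le_integral => //.
    - by move=> u _; rewrite lee_fin cabs_ge0.
    - by apply/measurable_EFinP; apply: measurable_cabs; apply: cintegrable_meas;
        exact: (cintegrableB measurableT (ii b) (ii a)).
    - apply: emeasurable_funM; first exact: measurable_cst.
      by apply/measurable_EFinP; exact: measurable_indic.
    - move=> u _; rewrite -EFinM lee_fin !indicE !mem_setE !in_itv /=.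
      case: (leP 0 u) => u0 /=; last first.
        by rewrite !mulr0 subrr cabs0 mulr_ge0.
      case: (leP u a) => ua.
        by rewrite (le_trans ua ab) mulr1 subrr cabs0 mulr_ge0.
      by rewrite (ltW ua); case: (u <= b); rewrite !mulr0 subr0 ?mulr1 ?qB// cabs0.
  rewrite ge0_integralZl//; last by apply/measurable_EFinP; exact: measurable_indic.
  rewrite integral_indic// setIT /= lebesgue_measure_itv /= lte_fin.
  case: ltP => _; first by rewrite -EFinB -EFinM.
  by rewrite mule0 lee_fin mulr_ge0// subr_ge0.
have lip' a b : cabs (cint leb `[0, b] q - cint leb `[0, a] q) <= B * `|b - a| *+ 2.
  case: (leP a b) => [ab|/ltW ba]; first by rewrite ger0_norm ?subr_ge0// lip.
  by rewrite cabs_dist distrC ger0_norm ?subr_ge0// lip.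
apply/cvgC_cabs; apply: (@squeeze_cvgr _ _ _ _ (cst 0) (fun x => B * `|x - t| *+ 2)).
- by apply: nearW => x /=; rewrite cabs_ge0 lip'.
- exact: cvg_cst.
- under eq_fun do rewrite -mulr_natr -mulrA mulrCA.
  suff : (fun x => `|x - t| * (B * 2)) @ t --> 0 * (B * 2) by rewrite mul0r.
  apply: cvgM; last exact: cvg_cst.
  apply/norm_cvg0P; apply/subr_cvg0; exact: cvg_id.
Unshelve. all: by end_near. Qed.

End Kernels.

(** * The kernel S and the explicit form of V psi_{w,k} *)

Section SincKernel.
Variable R : realType.
Local Notation leb := (@lebesgue_measure R).
Implicit Types (f g q : R -> R[i]) (c t u : R) (s z w : R[i]).

Definition sinc t : R[i] := if 0 < t then (sin (2 * pi * t) / (pi * t))%:C else 0.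

Lemma sinc_le0 t : t <= 0 -> sinc t = 0.
Proof. by rewrite /sinc ltNge => ->. Qed.

Lemma cmeasurable_sinc : cmeasurable setT sinc.
Proof.
rewrite (_ : sinc = fun t => (sin (2 * pi * t) * (pi * t)^-1)%:C * (\1_(`]0, +oo[%classic : set R) t)%:C).
  apply: cmeasurableM; last by apply: cmeasurable_indic; exact: measurable_itv.
  apply: cmeasurable_real; apply: measurable_funM.
    apply: measurableT_comp; last exact: measurable_funM.
    by apply: continuous_measurable_fun; exact: continuous_sin.
  by apply: (measurableT_comp (@measurable_inv R)); exact: measurable_funM.
apply/funext => t; rewrite /sinc indicE mem_setE in_itv /= andbT.
by case: ifPn => _; rewrite ?mulr1 ?mulr0.
Qed.

Lemma sinc_le2 t : cabs (sinc t) <= 2.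
Proof.
rewrite /sinc; case: ifPn => [t0|_]; last by rewrite cabs0.
rewrite cabs_real normrM normfV ler_pdivrMr ?normr_gt0 ?mulf_neq0 ?gt_eqF ?pi_gt0//.
by rewrite (le_trans (norm_sin_le _))// -mulrA normrM ger0_norm.
Qed.

Lemma sinc_le_inv t : 0 < t -> cabs (sinc t) <= t^-1.
Proof.
move=> t0; rewrite /sinc t0 cabs_real normrM normfV (gtr0_norm (mulr_gt0 (pi_gt0 R) t0)).
rewrite invfM mulrA ler_piMl ?invr_ge0 ?(ltW t0)//.
rewrite ler_pdivrMr ?pi_gt0// mul1r (le_trans (sin_max _))//.
by rewrite (le_trans _ (pi_ge2 R))// ler1n.
Qed.

Lemma mellin_class_sinc c : 0 < c < 1 -> mellin_class c sinc.
Proof.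
move=> /andP[c0 c1]; have L0 : mellin_class c (head_pow (0 : R[i])) by exact: mellin_class_head_pow.
have L1 : mellin_class c (tail_pow (1 : R[i])) by exact: mellin_class_tail_pow.
apply: (mellin_class_le cmeasurable_sinc sinc_le0 (mellin_classZ 2 L0) L1) => t t0.
rewrite /head_pow /tail_pow t0 /=; have [t1|t1] := leP t 1.
  rewrite oppr0 cpow0 mulr1 (le_trans (sinc_le2 t))//.
  have -> : (2 : R[i]) = (2 : R)%:C by rewrite rmorph_nat.
  by rewrite cabs_real ger0_norm// lerDl cabs_ge0.
rewrite (ltW t1) mulr0 cabs0 add0r cpowN cpow_id// -fmorphV cabs_real.
by rewrite ger0_norm ?invr_ge0 ?(ltW t0)// sinc_le_inv.
Qed.

Lemma half_bounded_sinc : half_bounded sinc.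
Proof.
exists 2 => t t0; have [t1|t1] := leP t 1.
  have l0 : ln t <= 0 by rewrite ln_le0.
  have : expR 0 <= expR (- (2^-1 * ln t)) by rewrite ler_expR; lra.
  by rewrite expR0 => h; rewrite (le_trans (sinc_le2 t))// ler_peMr.
have lt0 : 0 < ln t by rewrite ln_gt0.
apply: (le_trans (sinc_le_inv t0)); rewrite -[X in X^-1](@lnK _ t)// -expRN.
apply: (@le_trans _ _ (expR (- (2^-1 * ln t)))); first by rewrite ler_expR; lra.
by rewrite ler_peMl ?expR_ge0// ler1n.
Qed.

Lemma cvg_sinc t : 0 < t -> sinc x @[x --> t] --> (sinc t : R[i]^o).
Proof.
move=> t0.
suff h : (fun x => (sin (2 * pi * x) / (pi * x))%:C) @ t --> (sinc t : R[i]^o).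
  apply: (cvg_trans _ h); apply: near_eq_cvg; near=> x; rewrite /sinc ifT//.
  by near: x; exact: lt_nbhsr.
rewrite /sinc t0; apply/cvgC_ReIm; split => /=; last exact: cvg_cst.
apply: cvgM.
  apply: (continuous_comp (f := fun x => 2 * pi * x) (g := @sin R)).
    by apply: cvgM; [exact: cvg_cst|exact: cvg_id].
  exact: continuous_sin.
apply: cvgV; first by rewrite mulf_neq0 ?gt_eqF ?pi_gt0.
by apply: cvgM; [exact: cvg_cst|exact: cvg_id].
Unshelve. all: by end_near. Qed.

(* The function [G = V chi_1] of the header. *)
Definition kG t : R[i] := sinc t - mconv (tail_pow 1) sinc t.

(** The operator 1 - K has multiplier 1 - 1 / (1 - s) = - s / (1 - s). Applied twice to [sinc] it
    produces the factor s^2 / (1 - s)^2 of V(s) = s^3 S^(s) / (1 - s)^2; the last factor s is left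
    to [kgs]. *)
Definition kq t : R[i] := kG t - mconv (tail_pow 1) kG t.

Lemma mellin_class_kG c : 0 < c < 1 -> mellin_class c kG.
Proof.
move=> c01; have /andP[c0 c1] := c01; have L := mellin_class_sinc c01.
by apply: mellin_classB => //; apply: mellin_class_mconv => //; exact: mellin_class_tail_pow.
Qed.

Lemma mellin_kG s : 0 < complex.Re s < 1 -> mellin kG s = mellin sinc s * (1 - (1 - s)^-1).
Proof.
move=> c01; have /andP[c0 c1] := c01; have L := mellin_class_sinc c01.
have T : mellin_class (complex.Re s) (tail_pow 1) by exact: mellin_class_tail_pow.
rewrite (mellinB L (mellin_class_mconv T L))// (mellin_mconv T L)// mellin_tail_pow//.
by ring.
Qed.

Lemma mellin_class_kq c : 0 < c < 1 -> mellin_class c kq.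
Proof.
move=> c01; have /andP[c0 c1] := c01; have L := mellin_class_kG c01.
by apply: mellin_classB => //; apply: mellin_class_mconv => //; exact: mellin_class_tail_pow.
Qed.

Lemma mellin_kq s : 0 < complex.Re s < 1 ->
  mellin kq s = mellin sinc s * (1 - (1 - s)^-1) ^+ 2.
Proof.
move=> c01; have /andP[c0 c1] := c01; have L := mellin_class_kG c01.
have T : mellin_class (complex.Re s) (tail_pow 1) by exact: mellin_class_tail_pow.
rewrite (mellinB L (mellin_class_mconv T L))// (mellin_mconv T L)// mellin_tail_pow//.
by rewrite mellin_kG//; ring.
Qed.

Lemma half01 : 0 < (2^-1 : R) < 1.
Proof. by apply/andP; split; lra. Qed.

Lemma cmeasurable_kG : cmeasurable setT kG.
Proof. by have [] := mellin_class_kG half01. Qed.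

Lemma kG_le0 t : t <= 0 -> kG t = 0.
Proof. by have [_ h _] := mellin_class_kG half01; exact: h. Qed.

(** Here 6 = 2 + 2 * 2, the bound of [sinc] plus twice that bound for its average. In the same way
    18 = 6 + 2 * 6 bounds [kq]. *)
Lemma kG_bounded t : cabs (kG t) <= 6.
Proof.
have h := mconv_tail1_bounded t sinc_le0 cmeasurable_sinc sinc_le2.
by rewrite (le_trans (cabsB _ _))// (le_trans (lerD (sinc_le2 t) h))//; lra.
Qed.

Lemma kq_bounded t : cabs (kq t) <= 18.
Proof.
have h := mconv_tail1_bounded t kG_le0 cmeasurable_kG kG_bounded.
by rewrite (le_trans (cabsB _ _))// (le_trans (lerD (kG_bounded t) h))//; lra.
Qed.

Lemma half_bounded_kG : half_bounded kG.
Proof.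
have [B1 h1] := half_bounded_sinc.
have [B2 h2] := mconv_tail1_half (mellin_class_sinc half01).
exists (B1 + B2) => t t0; rewrite (le_trans (cabsB _ _))// mulrDl lerD ?h1 ?h2//.
Qed.

Lemma cvg_kG t : 0 < t -> kG x @[x --> t] --> (kG t : R[i]^o).
Proof.
move=> t0; apply: cvgCB; first exact: cvg_sinc.
exact: (cvg_mconv_tail1 sinc_le0 cmeasurable_sinc sinc_le2).
Qed.

(* The explicit representative of [V psi_{w,k}]. *)
Definition kgs w k t : R[i] :=
  (k == 0%N)%:R * kq t + (k%:R * mconv (psi w k.-1) kq t + w * mconv (psi w k) kq t).

Lemma mellin_class_kgs c w k : 0 < c < 1 -> complex.Re w < c -> mellin_class c (kgs w k).
Proof.
move=> c01 wc; have L := mellin_class_kq c01.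
have [L1 _] := mellin_psi k wc; have [L2 _] := mellin_psi k.-1 wc.
apply: mellin_classD; first exact: mellin_classZ.
by apply: mellin_classD; apply: mellin_classZ; exact: mellin_class_mconv.
Qed.

(** Writing s = (s - w) + w turns s k! / (s - w)^(k+1) into k! / (s - w)^k + w k! / (s - w)^(k+1).
    The first summand is k times the transform of psi_{w,k-1} if k >= 1, and the constant 1, hence
    [kq] itself, if k = 0. This explains the three terms of [kgs]. *)
Lemma mellin_kgs w k s : 0 < complex.Re s < 1 -> complex.Re w < complex.Re s ->
  mellin (kgs w k) s = s * (k`!%:R / (s - w) ^+ k.+1) * mellin kq s.
Proof.
move=> c01 wc; have L := mellin_class_kq c01.
have [L1 E1] := mellin_psi k wc; have [L2 E2] := mellin_psi k.-1 wc.
have C1 := mellin_class_mconv L1 L; have C2 := mellin_class_mconv L2 L.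
have sw : s - w != 0.
  by apply/eqP => /(congr1 (@complex.Re R)); rewrite ReD ReN /=; lra.
rewrite (mellinD (mellin_classZ _ L) (mellin_classD (mellin_classZ _ C2) (mellin_classZ _ C1)))//.
rewrite (mellinD (mellin_classZ _ C2) (mellin_classZ _ C1))//.
rewrite (mellinZ _ L)// (mellinZ _ C1)// (mellinZ _ C2)// (mellin_mconv L1 L)// (mellin_mconv L2 L)//.
rewrite E1// E2//; case: k {L1 L2 E1 E2 C1 C2} => [|k] /=.
  by rewrite fact0 !expr1; field.
rewrite factS natrM mul0r add0r (exprS (s - w) k.+1).
have := expf_neq0 k.+1 sw; set P := (s - w) ^+ k.+1 => P0.
by field; rewrite sw P0.
Qed.

(** From y^j / j! <= exp y at y = x / 4. The rate 1/4 is the gap between the abscissas 1/2 and 3/4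
    in the next bound. *)
Lemma ln_pow_le (x : R) j : 0 <= x -> x ^+ j <= (4 ^+ j * j`!%:R) * expR (4^-1 * x).
Proof.
move=> x0; have -> : x = 4 * (4^-1 * x) by field.
have y0 : 0 <= 4^-1 * x by rewrite mulr_ge0.
move: y0; set y := 4^-1 * x => y0; rewrite (_ : 4^-1 * (4 * y) = y); last by field.
rewrite exprMn -mulrA ler_pM2l ?exprn_gt0//.
case: j => [|j]; first by rewrite expr0 fact0 mul1r -expR0 ler_expR.
rewrite mulrC -ler_pdivrMr ?ltr0n ?fact_gt0//.
by rewrite (le_trans _ (expR_ge1Dxn j y0))// lerDr.
Qed.

(** The support of psi forces u >= t; there the power of the logarithm costs (u / t)^(1/4) and the
    power at most (u / t)^(1/2), which leaves t^(-3/4) times the norm of [kq] at abscissa 3/4. Any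
    abscissa strictly between 1/2 and 1 could replace 3/4. *)
Lemma mconv_psi_bound j : exists C : R, forall w t, 0 < t -> complex.Re w <= 2^-1 ->
  cabs (mconv (psi w j) kq t) <= C * expR (- (3 / 4 * ln t)).
Proof.
have c01 : 0 < (4^-1 : R) < 1 by apply/andP; split; lra.
have [mq q0 Iq] : mellin_class (3 / 4) kq by apply: mellin_class_kq; apply/andP; split; lra.
set N := (\int[leb]_t (cabs (kq t) * expR ((3 / 4 - 1) * ln t))%:E)%E in Iq.
have N0 : (0 <= N)%E by apply: integral_ge0 => t _; rewrite lee_fin mulr_ge0 ?cabs_ge0 ?expR_ge0.
have NE : N = (fine N)%:E by rewrite fineK// ge0_fin_numE.
pose A : R := 4 ^+ j * j`!%:R; have A0 : 0 <= A by rewrite mulr_ge0// exprn_ge0.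
exists (A * fine N *+ 2) => w t t0 w2.
have mw : measurable_fun setT (fun t => cabs (kq t) * expR ((3 / 4 - 1) * ln t)).
  by apply: measurable_funM; [exact: measurable_cabs|exact: measurable_mellin_weight].
(* Only measurability of psi is extracted; the abscissa Re w + 1 is admissible for every [w]. *)
have [mpsi _ _] := (mellin_psi j (ltr_pwDr ltr01 (lexx (complex.Re w)))).1.
rewrite mulrnAl; apply: (@mconv_le _ _ _ _
    (fun u => A * expR (- (3 / 4 * ln t)) * (cabs (kq u) * expR ((3 / 4 - 1) * ln u)))) => //.
- exact: measurable_funM.
- by move=> u; rewrite !mulr_ge0 ?cabs_ge0 ?expR_ge0.
- under eq_integral do rewrite EFinM.
  rewrite ge0_integralZl//; last 3 first.
  + by apply/measurable_EFinP; exact: mw.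
  + by move=> u _; rewrite lee_fin mulr_ge0 ?cabs_ge0 ?expR_ge0.
  + by rewrite lee_fin mulr_ge0 ?expR_ge0.
  by rewrite -/N NE -EFinM lee_fin; rewrite le_eqVlt; apply/orP; left; apply/eqP; ring.
- move=> u; rewrite /psi /chi; have [u0|u0] := leP u 0.
    by rewrite q0// mulr0 mul0r cabs0 !mulr_ge0 ?expR_ge0 ?cabs_ge0.
  rewrite divr_gt0//= ler_pdivrMr// mul1r.
  case: (leP t u) => ut; last by rewrite mulr0 !mul0r cabs0 !mulr_ge0 ?expR_ge0 ?cabs_ge0.
  have l0 : ln t <= ln u by rewrite ler_ln ?posrE.
  rewrite mulr1 3!Normc.normcM cabs_cpow !cabs_real invf_div.
  rewrite lnM ?posrE ?invr_gt0// lnV ?posrE// lnM ?posrE ?invr_gt0// lnV ?posrE// ReN.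
  rewrite ger0_norm ?exprn_ge0 ?subr_ge0// ger0_norm ?invr_ge0 ?(ltW u0)//.
  rewrite -[X in X^-1]lnK// -expRN.
  have h := ln_pow_le j (_ : 0 <= ln u - ln t); rewrite subr_ge0 in h.
  have {}h := h l0.
  have k0 := cabs_ge0 (kq u).
  apply: (@le_trans _ _ (A * expR (4^-1 * (ln u - ln t)) * expR (- complex.Re w * (ln t - ln u)) *
     cabs (kq u) * expR (- ln u))).
    by rewrite !ler_wpM2r ?expR_ge0.
  rewrite (_ : _ * expR (- ln u) = A * (cabs (kq u) * expR (4^-1 * (ln u - ln t) +
    - complex.Re w * (ln t - ln u) - ln u))); last by rewrite 2!expRD; ring.
  rewrite (_ : A * expR (- (3 / 4 * ln t)) * (cabs (kq u) * expR ((3 / 4 - 1) * ln u)) = A * (cabs (kq u) * expR (- (3 / 4 * ln t) + (3 / 4 - 1) * ln u)));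
    last by rewrite expRD; ring.
  rewrite ler_wpM2l// ler_wpM2l// ler_expR.
  have : 0 <= (2^-1 - complex.Re w) * (ln u - ln t) by rewrite mulr_ge0 ?subr_ge0.
  lra.
Qed.

Lemma kgs_bound (W : R) k : exists C : R, forall w t, 0 < t <= 1 -> complex.Re w <= 2^-1 ->
  cabs w <= W -> cabs (kgs w k t) <= C * expR (- (3 / 4 * ln t)).
Proof.
have [C1 h1] := mconv_psi_bound k.-1; have [C2 h2] := mconv_psi_bound k.
exists (18 + (k%:R * C1 + W * C2)) => w t /andP[t0 t1] w2 wW.
have e1 : 1 <= expR (- (3 / 4 * ln t)).
  have : expR 0 <= expR (- (3 / 4 * ln t)) by rewrite ler_expR; have := ln_le0 t1; lra.
  by rewrite expR0.
have C20 : 0 <= C2 * expR (- (3 / 4 * ln t)).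
  by apply: le_trans (h2 w t t0 w2); exact: cabs_ge0.
set E := expR (- (3 / 4 * ln t)) in e1 C20 *.
rewrite (le_trans (cabsD _ _))// [leRHS]mulrDl lerD//.
  rewrite Normc.normcM; apply: (@le_trans _ _ (1 * 18)); last by rewrite mul1r ler_peMr.
  rewrite ler_pM ?cabs_ge0 ?kq_bounded//.
  have -> : (k == 0%N)%:R = ((k == 0%N)%:R : R)%:C :> R[i] by rewrite rmorph_nat.
  by rewrite cabs_real; case: eqP => _; rewrite ?normr1 ?normr0.
rewrite (le_trans (cabsD _ _))// [leRHS]mulrDl lerD//.
  rewrite Normc.normcM -mulrA ler_pM ?cabs_ge0 ?h1//.
  have -> : k%:R = (k%:R : R)%:C :> R[i] by rewrite rmorph_nat.
  by rewrite cabs_real ger0_norm.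
rewrite Normc.normcM -mulrA (le_trans (ler_wpM2l (cabs_ge0 _) (h2 w t t0 w2)))//.
by rewrite ler_wpM2r.
Qed.

End SincKernel.

(** * Parseval formula *)

Section AbelKernel.
Variable R : realType.
Local Notation leb := (@lebesgue_measure R).
Implicit Types (s z : R[i]).

Lemma is_derive_Re_cexp (x : R) z :
  is_derive x 1 (fun y => complex.Re (cpow (expR y) z)) (complex.Re (z * cpow (expR x) z)).
Proof.
have d := is_derive_Re_cpow z (expR_gt0 x).
have h := @is_derive1_comp R (fun t => complex.Re (cpow t z)) expR x _ _ d (is_derive_expR x).
apply: (is_derive_eq h).
have -> : cpow (expR x) z = cpow (expR x) (z - 1) * (expR x)%:C.
  by rewrite -cpow_id ?expR_gt0// -cpowD subrK.
by rewrite mulrA [RHS]ReM /= mulr0 subr0.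
Qed.

Lemma is_derive_Im_cexp (x : R) z :
  is_derive x 1 (fun y => complex.Im (cpow (expR y) z)) (complex.Im (z * cpow (expR x) z)).
Proof.
have d := is_derive_Im_cpow z (expR_gt0 x).
have h := @is_derive1_comp R (fun t => complex.Im (cpow t z)) expR x _ _ d (is_derive_expR x).
apply: (is_derive_eq h).
have -> : cpow (expR x) z = cpow (expR x) (z - 1) * (expR x)%:C.
  by rewrite -cpow_id ?expR_gt0// -cpowD subrK.
by rewrite mulrA [RHS]ImM /= mulr0 add0r.
Qed.

Lemma continuous_Re_mul_cexp (x : R) w z : {for x, continuous (fun y : R => complex.Re (w * cpow (expR y) z))}.
Proof.
apply: (continuous_comp (f := expR) (g := fun t => complex.Re (w * cpow t z))).
  exact: continuous_expR.
by apply: continuous_Re_mul_cpow; exact: expR_gt0.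
Qed.

Lemma continuous_Im_mul_cexp (x : R) w z : {for x, continuous (fun y : R => complex.Im (w * cpow (expR y) z))}.
Proof.
apply: (continuous_comp (f := expR) (g := fun t => complex.Im (w * cpow t z))).
  exact: continuous_expR.
by apply: continuous_Im_mul_cpow; exact: expR_gt0.
Qed.

Lemma cintegrable_cexp_itv (a b : R) z : cintegrable leb `[a, b] (fun t => cpow (expR t) z).
Proof.
under [X in cintegrable _ _ X]eq_fun do rewrite -[cpow _ _]mul1r.
split; apply: continuous_itv_integrable => x _.
  exact: continuous_Re_mul_cexp.
exact: continuous_Im_mul_cexp.
Qed.

Lemma cint_cexp_itv (a b : R) z : a <= b ->
  z * cint leb `[a, b] (fun t => cpow (expR t) z) = cpow (expR b) z - cpow (expR a) z.
Proof.
move=> ab; rewrite -cintZ//; last exact: cintegrable_cexp_itv.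
apply: cplx_eqP => /=.
  rewrite ReD ReN; apply: (@Rintegral_itv_derive _ (fun x => complex.Re (cpow (expR x) z))) => //.
    by move=> x _; exact: is_derive_Re_cexp.
  by move=> x _; exact: continuous_Re_mul_cexp.
rewrite ImD ImN; apply: (@Rintegral_itv_derive _ (fun x => complex.Im (cpow (expR x) z))) => //.
  by move=> x _; exact: is_derive_Im_cexp.
by move=> x _; exact: continuous_Im_mul_cexp.
Qed.

Definition abel (e x : R) : R := expR (- (e * `|x|)).

Lemma measurable_abel e : measurable_fun setT (abel e).
Proof.
apply: measurableT_comp; first exact: measurable_expR.
by apply: measurableT_comp => //; apply: measurable_funM => //; exact: measurableT_comp.
Qed.

Lemma abel_ge0 e x : 0 <= abel e x.
Proof. exact: expR_ge0. Qed.

(** On each half-line this is a single exponential in [x], of rate - e + i ln t or e + i ln t. Both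
    are rewritten below as powers of exp x, so that the primitives of [cpow] apply. *)
Definition abel_pow e (t x : R) : R[i] := (abel e x)%:C * cpow t (0 +i* x).

Lemma cmeasurable_abel_pow e t : cmeasurable setT (abel_pow e t).
Proof.
apply: cmeasurableM; first by apply: cmeasurable_real; exact: measurable_abel.
by apply: cmeasurable_cpow; [exact: measurable_cst|split => //=; exact: measurable_cst].
Qed.

Lemma cabs_abel_pow e t x : cabs (abel_pow e t x) = abel e x.
Proof.
rewrite /abel_pow Normc.normcM cabs_cpow cabs_real ger0_norm ?abel_ge0//=.
by rewrite mul0r expR0 mulr1.
Qed.

Lemma abel_pow_pos e t x : 0 <= x -> abel_pow e t x = cpow (expR x) (- e +i* ln t).
Proof.
move=> x0; rewrite /abel_pow /abel ger0_norm//; apply: cplx_eqP.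
  by rewrite ReM Re_cpow Im_cpow [RHS]Re_cpow /= !expRK mul0r expR0 !mul1r mul0r subr0
    mulNr (mulrC x).
by rewrite ImM Re_cpow Im_cpow [RHS]Im_cpow /= !expRK mul0r expR0 !mul1r mul0r addr0
    mulNr (mulrC x).
Qed.

Lemma abel_pow_neg e t x : x <= 0 -> abel_pow e t x = cpow (expR x) (e +i* ln t).
Proof.
move=> x0; rewrite /abel_pow /abel ler0_norm// mulrN opprK; apply: cplx_eqP.
  by rewrite ReM Re_cpow Im_cpow [RHS]Re_cpow /= !expRK mul0r expR0 !mul1r mul0r subr0
    (mulrC x).
by rewrite ImM Re_cpow Im_cpow [RHS]Im_cpow /= !expRK mul0r expR0 !mul1r mul0r addr0
    (mulrC x).
Qed.

Lemma cint_abel_pow_sym e t n : 0 < e ->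
  cint leb (sym_itv n) (abel_pow e t) =
  (cpow (expR n%:R) (- e +i* ln t) - 1) / (- e +i* ln t) +
  (1 - cpow (expR (- n%:R)) (e +i* ln t)) / (e +i* ln t).
Proof.
move=> e0; have zp : - e +i* ln t != 0 by rewrite eq_complex /= oppr_eq0 gt_eqF.
have zn : e +i* ln t != 0 by rewrite eq_complex /= gt_eqF.
have h1 := cint_cexp_itv (- e +i* ln t) (ler0n R n).
have h2 : - n%:R <= 0 :> R by rewrite oppr_le0 ler0n.
have {}h2 := cint_cexp_itv (e +i* ln t) h2.
rewrite expR0 cpow1 in h1; rewrite expR0 cpow1 in h2.
rewrite -h1 -h2 !(mulrC _ (cint _ _ _)) !mulfK//.
have ip : cintegrable leb `[0, n%:R] (abel_pow e t).
  apply: (eq_cintegrable _ _ (cintegrable_cexp_itv _ _ (- e +i* ln t))) => //.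
  by move=> x; rewrite inE /= in_itv /= => /andP[x0 _]; rewrite abel_pow_pos.
have im : cintegrable leb `[- n%:R, 0] (abel_pow e t).
  apply: (eq_cintegrable _ _ (cintegrable_cexp_itv _ _ (e +i* ln t))) => //.
  by move=> x; rewrite inE /= in_itv /= => /andP[_ x0]; rewrite abel_pow_neg.
transitivity (cint leb `[0, n%:R] (abel_pow e t) + cint leb `[- n%:R, 0] (abel_pow e t)).
  have split (f : R -> R) : leb.-integrable `[0, n%:R] (fun x => (f x)%:E) ->
      leb.-integrable `[- n%:R, 0] (fun x => (f x)%:E) ->
      Rintegral leb (sym_itv n) f = Rintegral leb `[0, n%:R] f + Rintegral leb `[- n%:R, 0] f.
    move=> i1 i2.
    have nn : (`[- n%:R, n%:R]%classic : set R) = `[- n%:R, 0]%classic `|` `]0, n%:R]%classic.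
      rewrite -(@itv_bndbnd_setU _ _ _ (BRight 0))//; rewrite bnd_simp ?ler0n ?oppr_le0 ?ler0n//.
    have s01 : (`]0, n%:R]%classic : set R) `<=` `[0, n%:R]%classic by apply: subset_itvr; rewrite bnd_simp.
    have i1' : leb.-integrable `]0, n%:R] (fun x => (f x)%:E) by apply: integrableS i1.
    rewrite /sym_itv nn Rintegral_setU//; last 2 first.
    - rewrite -nn; apply/integrableP; split.
        rewrite nn; apply/measurable_funU => //; split; first exact: (measurable_int _ i2).
        exact: (measurable_int _ i1').
      rewrite nn ge0_integral_setU//.
      + by rewrite lte_add_pinfty//; [have /integrableP[] := i2|have /integrableP[] := i1'].
      + apply/measurable_funU => //; split; apply: measurableT_comp => //.
          exact: (measurable_int _ i2).
        exact: (measurable_int _ i1').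
      + rewrite disj_set2E; apply/eqP/seteqP; split => // x [] /=.
        by rewrite !in_itv /= => /andP[_ ?] /andP[]; rewrite ltNge => /negP.
    - rewrite disj_set2E; apply/eqP/seteqP; split => // x [] /=.
      by rewrite !in_itv /= => /andP[_ ?] /andP[]; rewrite ltNge => /negP.
    by rewrite addrC; congr (_ + _); rewrite Rintegral_itv_obnd_cbnd.
  have [i1 i2] := ip; have [i3 i4] := im.
  by rewrite /cint (split _ i1 i3) (split _ i2 i4).
congr (_ + _); apply: eq_cint => x; rewrite inE /= in_itv /= => /andP[x0 x1].
  by rewrite abel_pow_pos.
by rewrite abel_pow_neg.
Qed.

Lemma integrable_abel e : 0 < e -> leb.-integrable setT (fun x => (abel e x)%:E).
Proof.
move=> e0; apply/integrableP; split; first by apply/measurable_EFinP; exact: measurable_abel.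
under eq_integral do rewrite abse_EFin (ger0_norm (abel_ge0 _ _)).
apply: (@le_lt_trans _ _ (2 / e)%:E); last exact: ltry.
apply: (@le_integral_exhaust R (@sym_itv R) (abel e) (2 / e)%:E (@sym_itv_nd R)).
- by move=> n; exact: measurable_itv.
- exact: measurable_abel.
- by move=> t; exact: abel_ge0.
- by move=> t []; rewrite bigcup_sym_itv.
(* At t = 1 the oscillating factor is 1, so the closed form is the integral of the real kernel, at
   most 2 / e on every symmetric interval. *)
- move=> n; have := cint_abel_pow_sym 1 n e0.
  rewrite ln1 => h.
  have ii : cintegrable leb (sym_itv n) (abel_pow e 1).
    have s : measurable (sym_itv n : set R) by exact: measurable_itv.
    apply: (@le_cintegrable _ _ _ _ _ _ _ (fun=> 1)) => //.
    + have [m1 m2] := cmeasurable_abel_pow e 1; split; exact: measurable_funTS.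
    + by apply: continuous_itv_integrable => x _; exact: cvg_cst.
    + by move=> x _; rewrite cabs_abel_pow /abel expR_le1 oppr_le0 mulr_ge0// ltW.
  have [ir _] := ii.
  have E : (fun x => (complex.Re (abel_pow e 1 x))%:E) = (fun x => (abel e x)%:E).
    by apply/funext => x; rewrite /abel_pow cpow1 mulr1.
  rewrite E in ir.
  have -> : (\int[leb]_(t in sym_itv n) (abel e t)%:E =
      (complex.Re (cint leb (sym_itv n) (abel_pow e 1)))%:E)%E.
    rewrite /cint /= /Rintegral fineK; last by rewrite E; apply: integrable_fin_num => //; exact: measurable_itv.
    by rewrite E.
  rewrite h lee_fin.
  have cx (r : R) y : cpow (expR y) (r +i* 0) = (expR (r * y))%:C.
    by have := cpow_real (expR y) r; rewrite expRK.
  have ri (r a : R) : r != 0 -> complex.Re ((a%:C) / (r +i* 0)) = a / r.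
    by move=> r0; rewrite -[r +i* 0]/(r%:C) -fmorphV -rmorphM.
  rewrite ReD !cx -[1 : R[i]]/((1 : R)%:C) -!rmorphB !ri ?oppr_eq0 ?gt_eqF//.
  have p1 : 0 < expR (- e * n%:R) by exact: expR_gt0.
  rewrite mulrN -mulNr.
  rewrite invrN mulrN -mulNr -mulrDl ler_pM2r ?invr_gt0//.
  lra.
Qed.

(** This is the Fourier transform of exp (- e |x|): the Poisson kernel, evaluated at ln t. *)
Lemma cint_abel_pow e t : 0 < e ->
  cint leb setT (abel_pow e t) = (2 * e / (e ^+ 2 + ln t ^+ 2))%:C.
Proof.
move=> e0; have zp : - e +i* ln t != 0 by rewrite eq_complex /= oppr_eq0 gt_eqF.
have zn : e +i* ln t != 0 by rewrite eq_complex /= gt_eqF.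
have I : cintegrable leb setT (abel_pow e t).
  apply: (@le_cintegrable _ (measurableTypeR R) R leb setT measurableT _ (abel e)) => //.
  - exact: cmeasurable_abel_pow.
  - exact: integrable_abel.
  - by move=> x _; rewrite cabs_abel_pow.
have mS n : measurable (sym_itv n : set R) by exact: measurable_itv.
have h := cvg_cint_exhaust mS (fun t => or_intror (near_sym_itv t)) I.
apply: (cvgC_unique h).
under eq_fun do rewrite (cint_abel_pow_sym _ _ e0).
have -> : (2 * e / (e ^+ 2 + ln t ^+ 2))%:C = (0 - 1) / (- e +i* ln t) + (1 - 0) / (e +i* ln t).
  rewrite sub0r subr0; apply: (@mulIf _ ((- e +i* ln t) * (e +i* ln t))).
    by rewrite mulf_neq0.
  rewrite [RHS](_ : _ = - (e +i* ln t) + (- e +i* ln t)); last by field; rewrite zp zn.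
  have D0 : e ^+ 2 + ln t ^+ 2 != 0 by rewrite gt_eqF// ltr_wpDr ?sqr_ge0// exprn_gt0.
  by apply: cplx_eqP => /=; field.
have ce : expR (- e * n%:R) @[n --> \oo] --> (0 : R).
  apply/(@cvgrPdist_lt _ R^o) => d d0; near=> n.
  rewrite sub0r normrN ger0_norm ?expR_ge0// -[ltRHS]lnK// ltr_expR.
  rewrite mulNr ltrNl mulrC -ltr_pdivrMr//.
  near: n; exists (Num.truncn (- ln d / e)).+1 => // n /= hn.
  by rewrite (lt_le_trans (truncnS_gt _))// ler_nat.
apply: cvgCD; apply: cvgCM; try exact: cvgC_cst.
  apply: cvgCB; last exact: cvgC_cst.
  by apply/cvgC_cabs; under eq_fun do rewrite subr0 cabs_cpow expRK.
apply: cvgCB; first exact: cvgC_cst.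
apply/cvgC_cabs; under eq_fun do rewrite subr0 cabs_cpow expRK /= mulrN -mulNr.
exact: ce.
Unshelve. all: by end_near. Qed.

End AbelKernel.

(** * The Poisson kernel in logarithmic coordinates *)

Section ApproximateIdentity.
Variable R : realType.
Local Notation leb := (@lebesgue_measure R).
Implicit Types (s z : R[i]).

Definition kap (e y : R) : R := 2 * e / (e ^+ 2 + y ^+ 2).

Lemma kap_ge0 e y : 0 < e -> 0 <= kap e y.
Proof. by move=> e0; rewrite divr_ge0 ?mulr_ge0 ?(ltW e0)// addr_ge0 ?sqr_ge0. Qed.

Lemma kap_den_neq0 (e y : R) : 0 < e -> e ^+ 2 + y ^+ 2 != 0.
Proof. by move=> e0; rewrite gt_eqF// ltr_wpDr ?sqr_ge0// exprn_gt0. Qed.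

(** The density with respect to dt of the Poisson kernel in the variable ln t, centred at [c]. Its
    primitive is 2 atan ((ln t - c) / e), so its total mass is 2 pi. *)
Definition kmeas (e c t : R) : R := if 0 < t then kap e (ln t - c) / t else 0.

Lemma kmeas_ge0 e c t : 0 < e -> 0 <= kmeas e c t.
Proof.
by move=> e0; rewrite /kmeas; case: ifP => // t0; rewrite divr_ge0 ?kap_ge0 ?(ltW t0).
Qed.

Lemma measurable_kap_ln e c : measurable_fun setT (fun t : R => kap e (ln t - c)).
Proof.
apply: measurable_funM => //; apply: (measurableT_comp (@measurable_inv R)).
apply: measurable_funD => //; apply: measurable_funX; exact: measurable_funB.
Qed.

Lemma measurable_kmeas e c : measurable_fun setT (kmeas e c).
Proof.
rewrite (_ : kmeas e c = fun t => kap e (ln t - c) / t * \1_(`]0, +oo[%classic) t).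
  apply: measurable_funM.
    by apply: measurable_funM; [exact: measurable_kap_ln|exact: measurable_inv].
  by apply: measurable_indic; exact: measurable_itv.
apply/funext => t; rewrite /kmeas indicE mem_setE in_itv /= andbT.
by case: ifPn => _; rewrite ?mulr1 ?mulr0.
Qed.

Lemma integral_kmeas_itv e c (a b : R) : 0 < e -> 0 < a -> a <= b ->
  (\int[leb]_(t in `[a, b]) (kmeas e c t)%:E =
   (2 * atan (e^-1 * (ln b - c)) - 2 * atan (e^-1 * (ln a - c)))%:E)%E.
Proof.
move=> e0 a0 ab; have pos x : a <= x <= b -> 0 < x by move=> /andP[ax _]; exact: lt_le_trans ax.
transitivity (\int[leb]_(t in `[a, b]) (kap e (ln t - c) / t)%:E)%E.
  apply: eq_integral => x; rewrite inE /= in_itv /= => /pos x0.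
  by rewrite /kmeas x0.
apply: (@integral_itv_derive _ (fun x => 2 * atan (e^-1 * (ln x - c)))) => //.
  move=> x /pos x0.
  have dl : is_derive x 1 (@ln R) x^-1 by exact: is_derive1_ln.
  have d1 : is_derive x 1 (fun y : R => ln y - c) (x^-1 - 0).
    exact: (@is_deriveB R R^o R^o (@ln R) (cst c) x 1 _ _ dl (is_derive_cst _ _ _)).
  have d2 : is_derive x 1 (fun y : R => e^-1 * (ln y - c)) (e^-1 * (x^-1 - 0)).
    exact: (@is_deriveZ R R^o R^o (fun y : R => ln y - c) e^-1 x 1 _ d1).
  have d3 := @is_derive1_comp R (@atan R) (fun y => e^-1 * (ln y - c)) x _ _ (is_derive1_atan _) d2.
  have d4 := @is_deriveZ R R^o R^o (@atan R \o (fun y => e^-1 * (ln y - c))) 2 x 1 _ d3.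
  apply: (is_derive_eq d4); rewrite /GRing.scale /= subr0 /kap.
  have D := kap_den_neq0 (ln x - c) e0.
  have D' : 1 + (e^-1 * (ln x - c)) ^+ 2 != 0 by rewrite gt_eqF// ltr_wpDr ?sqr_ge0.
  have en : e != 0 by rewrite gt_eqF.
  have xn : x != 0 by rewrite gt_eqF.
  have -> : 1 + (e^-1 * (ln x - c)) ^+ 2 = (e ^+ 2 + (ln x - c) ^+ 2) / e ^+ 2.
    by field.
  by field; rewrite en xn D.
move=> x /pos x0.
have cl : {for x, continuous (@ln R)}.
  by have [/derivable1_diffP/differentiable_continuous] := is_derive1_ln x0.
apply: cvgM; last by apply: inv_continuous; rewrite gt_eqF.
apply: cvgM; first exact: cvg_cst.
apply: cvgV; first exact: kap_den_neq0.
apply: cvgD; first exact: cvg_cst.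
apply: (continuous_comp (f := fun y => ln y - c) (g := fun y => y ^+ 2)).
  by apply: cvgB => //; exact: cvg_cst.
exact: exprn_continuous.
Qed.

Lemma integral_kmeas_le e c : 0 < e -> (\int[leb]_t (kmeas e c t)%:E <= (2 * pi)%:E)%E.
Proof.
move=> e0; apply: le_integral_trunc.
- exact: measurable_kmeas.
- by move=> t; exact: kmeas_ge0.
- by move=> t t0; rewrite /kmeas ltNge t0.
- move=> n; rewrite integral_kmeas_itv//; last by rewrite (@le_trans _ _ 1) ?invf_le1 ?ler1n.
  rewrite lee_fin; set A := atan _; set B := atan _.
  have := atan_ltpi2 (e^-1 * (ln n.+1%:R - c)); have := atan_gtNpi2 (e^-1 * (ln n.+1%:R^-1 - c)).
  rewrite -/A -/B; lra.
Qed.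

Lemma integrable_kmeas e c : 0 < e -> leb.-integrable setT (fun t => (kmeas e c t)%:E).
Proof.
move=> e0; apply/integrableP; split; first by apply/measurable_EFinP; exact: measurable_kmeas.
under eq_integral do rewrite abse_EFin (ger0_norm (kmeas_ge0 _ _ e0)).
by apply: (le_lt_trans (integral_kmeas_le c e0)); exact: ltry.
Qed.

Lemma Rintegral_kmeas_le e c : 0 < e -> Rintegral leb setT (kmeas e c) <= 2 * pi.
Proof.
move=> e0; rewrite -lee_fin /Rintegral fineK; first exact: integral_kmeas_le.
by apply: integrable_fin_num => //; exact: integrable_kmeas.
Qed.

Lemma near_kmeas_ge e c d : 0 < e -> 0 < d ->
  (4 * atan (e^-1 * d))%:E = (\int[leb]_(t in `[expR (c - d), expR (c + d)]) (kmeas e c t)%:E)%E.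
Proof.
move=> e0 d0; rewrite integral_kmeas_itv ?expR_gt0// ?ler_expR; last by lra.
rewrite !expRK; congr (_%:E).
rewrite (_ : c + d - c = d); last by ring.
rewrite (_ : c - d - c = - d); last by ring.
by rewrite mulrN atanN; ring.
Qed.

Lemma Rintegral_kmeas_ge e c d : 0 < e -> 0 < d ->
  4 * atan (e^-1 * d) <= Rintegral leb setT (kmeas e c).
Proof.
move=> e0 d0; rewrite -lee_fin /Rintegral fineK; last first.
  by apply: integrable_fin_num => //; exact: integrable_kmeas.
rewrite (near_kmeas_ge c e0 d0); apply: ge0_subset_integral => //.
- by apply/measurable_EFinP; exact: measurable_kmeas.
- by move=> t _; rewrite lee_fin kmeas_ge0.
Qed.

Lemma cint_kmeas_bound (f : R -> R[i]) (B : R) e c : 0 < e -> cmeasurable setT f ->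
  (forall t, 0 < t -> cabs (f t) <= B) ->
  cintegrable leb setT (fun t => f t * (kmeas e c t)%:C) /\
  cabs (cint leb setT (fun t => f t * (kmeas e c t)%:C)) <= B * (2 * pi) *+ 2.
Proof.
move=> e0 mf fB; have B0 : 0 <= B by apply: le_trans (fB 1 ltr01); exact: cabs_ge0.
have mk := measurable_kmeas e c.
have ik := integrable_kmeas c e0.
have le t : cabs (f t * (kmeas e c t)%:C) <= B * kmeas e c t.
  rewrite Normc.normcM cabs_real ger0_norm ?kmeas_ge0//.
  have [t0|t0] := leP t 0; first by rewrite /kmeas ltNge t0 /= !mulr0.
  by rewrite ler_wpM2r ?kmeas_ge0// fB.
have mfk : cmeasurable setT (fun t => f t * (kmeas e c t)%:C).
  by apply: cmeasurableM => //; exact: cmeasurable_real.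
have iBk : leb.-integrable setT (fun t => (B * kmeas e c t)%:E).
  exact: (integrableZl measurableT B ik).
have I : cintegrable leb setT (fun t => f t * (kmeas e c t)%:C).
  exact: (@le_cintegrable _ (measurableTypeR R) R leb setT measurableT _ _ mfk iBk).
split => //; apply: le_cabs_cint => //.
apply: (@le_trans _ _ (\int[leb]_t (B%:E * (kmeas e c t)%:E))%E).
  apply: ge0_le_integral => //.
  - by move=> t _; rewrite lee_fin cabs_ge0.
  - by apply/measurable_EFinP; exact: measurable_cabs.
  - by apply: emeasurable_funM; [exact: measurable_cst|exact/measurable_EFinP].
  - by move=> t _; rewrite -EFinM lee_fin.
rewrite ge0_integralZl//; last 2 first.
- exact/measurable_EFinP.
- by move=> t _; rewrite lee_fin kmeas_ge0.
by rewrite EFinM lee_wpmul2l// integral_kmeas_le.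
Qed.

(** The difference 2 pi - 4 atan (d / e) bounds the mass outside the window of logarithmic radius
    [d]. The constant 5 is 2 * 2 + 1: an oscillation of at most 2 B outside the window, doubled by
    [le_cabs_cint], plus B for replacing the total mass by 2 pi. *)
Lemma approx_identity_le (f : R -> R[i]) (B eta e c d : R) : 0 < e -> 0 < d -> 0 <= eta ->
  cmeasurable setT f -> (forall t, 0 < t -> cabs (f t) <= B) ->
  (forall t, expR (c - d) <= t <= expR (c + d) -> cabs (f t - f (expR c)) <= eta) ->
  cabs (cint leb setT (fun t => f t * (kmeas e c t)%:C) - (2 * pi)%:C * f (expR c)) <=
    (eta * (2 * pi)) *+ 2 + 5 * B * (2 * pi - 4 * atan (e^-1 * d)).
Proof.
move=> e0 d0 eta0 mf fB fe.
have B0 : 0 <= B by apply: le_trans (fB 1 ltr01); exact: cabs_ge0.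
have mI : measurable (`[expR (c - d), expR (c + d)]%classic : set R) by exact: measurable_itv.
have mk := measurable_kmeas e c.
have ik := integrable_kmeas c e0.
have [I _] := cint_kmeas_bound c e0 mf fB.
set W := Rintegral leb setT (kmeas e c).
have W1 := Rintegral_kmeas_le c e0; have W2 := Rintegral_kmeas_ge c e0 d0.
rewrite -/W in W1 W2; set X := 4 * atan (e^-1 * d) in W2 *.
have Ik : cintegrable leb setT (fun t => f (expR c) * (kmeas e c t)%:C).
  apply: cintegrableZ => //; split => //=; exact: integrable0.
have -> : cint leb setT (fun t => f t * (kmeas e c t)%:C) - (2 * pi)%:C * f (expR c) =
  cint leb setT (fun t => (f t - f (expR c)) * (kmeas e c t)%:C) + (W - 2 * pi)%:C * f (expR c).
  rewrite [X in _ = X + _](_ : _ = cint leb setT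
    (fun t => f t * (kmeas e c t)%:C - f (expR c) * (kmeas e c t)%:C)); last first.
    by apply: eq_cint => t _; rewrite mulrBl.
  rewrite cintB// cintZ//; last by split => //=; exact: integrable0.
  by rewrite cint_real -/W rmorphB; ring.
rewrite (le_trans (cabsD _ _))//.
have h2 : cabs ((W - 2 * pi)%:C * f (expR c)) <= B * (2 * pi - X).
  rewrite Normc.normcM cabs_real mulrC ler_pM ?cabs_ge0 ?fB ?expR_gt0//.
  by rewrite ler_norml; apply/andP; split; lra.
have h1 : cabs (cint leb setT (fun t => (f t - f (expR c)) * (kmeas e c t)%:C)) <=
    (eta * (2 * pi) + 2 * B * (2 * pi - X)) *+ 2.
  apply: le_cabs_cint => //.
    apply: (eq_cintegrable _ _ (cintegrableB measurableT I Ik)) => //.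
    by move=> t _; rewrite mulrBl.
  pose O t := kmeas e c t * (1 - \1_(`[expR (c - d), expR (c + d)]%classic) t).
  have O0 t : 0 <= O t.
    by rewrite mulr_ge0 ?kmeas_ge0// subr_ge0 indicE lern1 leq_b1.
  have mO : measurable_fun setT O.
    apply: measurable_funM => //; apply: measurable_funB => //; exact: measurable_indic.
  have iO : (\int[leb]_t (O t)%:E <= (2 * pi - X)%:E)%E.
    pose Ii t := kmeas e c t * \1_(`[expR (c - d), expR (c + d)]%classic) t.
    have mIi : measurable_fun setT Ii by apply: measurable_funM => //; exact: measurable_indic.
    have Ii0 t : 0 <= Ii t by rewrite mulr_ge0 ?kmeas_ge0// indic_ge0.
    have EI : (\int[leb]_t (Ii t)%:E = X%:E)%E.
      rewrite (near_kmeas_ge c e0 d0) [RHS]integral_mkcond; apply: eq_integral => t _.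
      by rewrite patchE /Ii indicE; case: ifP => _; rewrite ?mulr1 ?mulr0.
    have : (\int[leb]_t ((O t)%:E + (Ii t)%:E) <= (2 * pi)%:E)%E.
      rewrite [leLHS](_ : _ = \int[leb]_t (kmeas e c t)%:E)%E; first exact: integral_kmeas_le.
      by apply: eq_integral => t _; rewrite -EFinD /O /Ii; congr (_%:E); ring.
    rewrite ge0_integralD//; last 4 first.
    - by move=> t _; rewrite lee_fin.
    - exact/measurable_EFinP.
    - by move=> t _; rewrite lee_fin.
    - exact/measurable_EFinP.
    by rewrite EI EFinB leeBrDr.
  apply: (@le_trans _ _ (\int[leb]_t (eta%:E * (kmeas e c t)%:E + (2 * B)%:E * (O t)%:E))%E).
    apply: ge0_le_integral => //.
    - by move=> t _; rewrite lee_fin cabs_ge0.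
    - apply/measurable_EFinP; apply: measurable_cabs; apply: cmeasurableM.
        by apply: cmeasurableB => //; exact: cmeasurable_cst.
      exact: cmeasurable_real.
    - by apply: emeasurable_funD; apply: emeasurable_funM;
        do ?[exact: measurable_cst|exact/measurable_EFinP].
    - move=> t _; rewrite -!EFinM -EFinD lee_fin Normc.normcM cabs_real.
      have [t0|t0] := leP t 0.
        by rewrite /O /kmeas ltNge t0 /= normr0 !(mulr0, mul0r) addr0.
      rewrite (ger0_norm (kmeas_ge0 _ _ e0)) /O indicE mem_setE in_itv /=.
      have [ht|ht] := boolP (expR (c - d) <= t <= expR (c + d)).
        by rewrite subrr !mulr0 addr0 ler_wpM2r ?kmeas_ge0// fe.
      rewrite subr0 mulr1 -mulrDl ler_wpM2r ?kmeas_ge0//.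
      apply: (@le_trans _ _ (B + B)); last by lra.
      by rewrite (le_trans (cabsB _ _))// lerD// fB// expR_gt0.
  rewrite ge0_integralD//; last 4 first.
  - by move=> t _; rewrite mule_ge0 ?lee_fin ?kmeas_ge0.
  - by apply: emeasurable_funM; [exact: measurable_cst|exact/measurable_EFinP].
  - by move=> t _; apply: mule_ge0; [rewrite lee_fin mulr_ge0|rewrite lee_fin].
  - by apply: emeasurable_funM; [exact: measurable_cst|exact/measurable_EFinP].
  rewrite !ge0_integralZl//; last 5 first.
  - exact/measurable_EFinP.
  - by move=> t _; rewrite lee_fin.
  - by rewrite lee_fin mulr_ge0.
  - exact/measurable_EFinP.
  - by move=> t _; rewrite lee_fin kmeas_ge0.
  rewrite EFinD !(EFinM _ (_ * _)) !(EFinM _ (_ - _)) leeD// lee_wpmul2l ?lee_fin ?mulr_ge0//.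
  exact: integral_kmeas_le.
by apply: (le_trans (lerD h1 h2)); rewrite le_eqVlt; apply/orP; left; apply/eqP; ring.
Qed.

Lemma cvg_approx_identity (f : R -> R[i]) (B u : R) : 0 < u ->
  cmeasurable setT f -> (forall t, 0 < t -> cabs (f t) <= B) ->
  f t @[t --> u] --> (f u : R[i]^o) ->
  cint leb setT (fun t => f t * (kmeas n.+1%:R^-1 (ln u) t)%:C) @[n --> \oo] -->
    ((2 * pi)%:C * f u : R[i]^o).
Proof.
move=> u0 mf fB cf; have B0 : 0 <= B by apply: le_trans (fB 1 ltr01); exact: cabs_ge0.
apply/cvgC_cabs; apply/(@cvgrPdist_lt _ R^o) => eps eps0.
have pi0 := pi_gt0 R.
pose eta := eps / (8 * pi); have eta0 : 0 < eta by rewrite divr_gt0// mulr_gt0.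
have /cvgC_cabs/(@cvgrPdist_lt _ R^o)/(_ _ eta0) := cf.
move=> hn.
have hn' : nbhs (expR (ln u)) (fun y => cabs (f y - f u) < eta).
  rewrite lnK//; move: hn; apply: filterS => y /=.
  by rewrite sub0r normrN ger0_norm ?cabs_ge0.
have : nbhs (ln u) (fun x => cabs (f (expR x) - f u) < eta) := @continuous_expR R (ln u) _ hn'.
move=> /nbhs_ballP[d /= d0 hd].
have d20 : 0 < d / 2 by rewrite divr_gt0.
have fe t : expR (ln u - d / 2) <= t <= expR (ln u + d / 2) -> cabs (f t - f (expR (ln u))) <= eta.
  move=> /andP[t1 t2]; have t0 : 0 < t by rewrite (lt_le_trans _ t1)// expR_gt0.
  rewrite lnK// ltW// -[t]lnK//; apply: hd; rewrite /ball /= ltr_norml.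
  rewrite -[t]lnK// ler_expR in t1; rewrite -[t]lnK// ler_expR in t2.
  by apply/andP; split; lra.
have ca : 5 * B * (2 * pi - 4 * atan (n.+1%:R^-1^-1 * (d / 2))) @[n --> \oo] --> (0 : R).
  have -> : 0 = 5 * B * (2 * pi - 4 * (pi / 2)) :> R by field.
  apply: cvgM; first exact: cvg_cst.
  apply: cvgB; first exact: cvg_cst.
  apply: cvgM; first exact: cvg_cst.
  apply: (cvg_comp (fun n : nat => n.+1%:R^-1^-1 * (d / 2) : R) (@atan R) _ (@cvgy_atan R)).
  apply/cvgryPge => A; exists (Num.truncn (A / (d / 2))) => // n /= hnn.
  rewrite invrK -ler_pdivrMr// ltW// (lt_le_trans (truncnS_gt _))// ler_nat.
  by rewrite ltnS.
have e2 : 0 < eps / 2 by rewrite divr_gt0.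
move/(@cvgrPdist_lt _ R^o)/(_ _ e2) : ca; apply: filterS => n hnn.
have en : 0 < n.+1%:R^-1 :> R by rewrite invr_gt0.
have := approx_identity_le en d20 (ltW eta0) mf fB fe; rewrite lnK// => hle.
rewrite sub0r normrN ger0_norm ?cabs_ge0//; apply: (le_lt_trans hle).
have -> : (eta * (2 * pi)) *+ 2 = eps / 2.
  have pin : pi != 0 :> R by rewrite gt_eqF.
  have ep : eta * pi = eps / 8 by rewrite /eta invfM mulrA divfK.
  by move: ep; move: (eta) => et; rewrite mulr2n; lra.
move: hnn; rewrite sub0r normrN => /(le_lt_trans (ler_norm _)) => h3.
by rewrite [ltRHS](_ : _ = eps / 2 + eps / 2) ?ltrD2l//; field.
Qed.

End ApproximateIdentity.

(** * The Parseval formula damped by Abel kernels *)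

Section Parseval.
Variable R : realType.
Local Notation leb := (@lebesgue_measure R).
Implicit Types (f phi h : R -> R[i]) (s z : R[i]) (u t tau : R).

Lemma ae_neq (p : R) (P : R -> Prop) : (forall x, x <> p -> P x) -> {ae leb, forall x, P x}.
Proof.
move=> h; exists [set p]; split; first exact: measurable_set1.
  exact: lebesgue_measure_set1.
by move=> x /=; apply: contra_notP => xp; apply: h.
Qed.

Definition mhalf : R[i] := - (2^-1)%:C.

Local Notation mh := mhalf.

Lemma line_sub1 tau : line tau - 1 = mh + (0 +i* tau).
Proof. by rewrite /mhalf /line; apply: cplx_eqP => /=; lra. Qed.

Lemma Re_line tau : complex.Re (line tau) = 2^-1.
Proof. by []. Qed.

Lemma cpow_mh t : cpow t mh = (expR (- (2^-1 * ln t)))%:C.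
Proof. by rewrite /mhalf -rmorphN cpow_real mulNr. Qed.

Lemma cpow_line t tau : cpow t (line tau - 1) = cpow t mh * cpow t (0 +i* tau).
Proof. by rewrite line_sub1 cpowD. Qed.

Lemma cabs_cpow_im t (a : R) : cabs (cpow t (0 +i* a)) = 1.
Proof. by rewrite cabs_cpow /= mul0r expR0. Qed.

Lemma cabs_cpow_line t tau : cabs (cpow t (line tau - 1)) = expR ((2^-1 - 1) * ln t).
Proof. by rewrite cabs_cpow ReD ReN. Qed.

Lemma mh_weight t : expR (- (2^-1 * ln t)) = expR ((2^-1 - 1) * ln t).
Proof. by congr expR; lra. Qed.

Lemma cmeasurable_mellin_line f : cmeasurable setT f -> cmeasurable setT (fun tau => mellin f (line tau)).
Proof.
move=> [rf jf].
apply: (cmeasurable_cint_section leb (f := fun x : R * R => f x.2 * cpow x.2 (line x.1 - 1))).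
apply: cmeasurableM.
  by split; [apply: (measurableT_comp rf)|apply: (measurableT_comp jf)]; exact: measurable_snd.
apply: cmeasurable_cpow; first exact: measurable_snd.
apply: cmeasurableB; last exact: cmeasurable_cst.
by split => /=; [exact: measurable_cst|exact: measurable_fst].
Qed.

Lemma mellin_norm_fin f : mellin_class 2^-1 f ->
  exists N : R, 0 <= N /\ (\int[leb]_t (cabs (f t) * expR ((2^-1 - 1) * ln t))%:E = N%:E)%E.
Proof.
move=> [mf f0 If].
have N0 : (0 <= \int[leb]_t (cabs (f t) * expR ((2^-1 - 1) * ln t))%:E)%E.
  by apply: integral_ge0 => t _; rewrite lee_fin mulr_ge0 ?cabs_ge0 ?expR_ge0.
exists (fine (\int[leb]_t (cabs (f t) * expR ((2^-1 - 1) * ln t))%:E)%E).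
by rewrite fine_ge0// fineK// ge0_fin_numE.
Qed.

Lemma mellin_line_bounded f : mellin_class 2^-1 f ->
  exists N : R, 0 <= N /\ forall tau, cabs (mellin f (line tau)) <= N.
Proof.
move=> Lf; have [N [N0 EN]] := mellin_norm_fin Lf; exists (N *+ 2); split; first exact: mulrn_wge0.
move=> tau; apply: le_cabs_cint => //; first exact: (cintegrable_mellin Lf).
by rewrite -EN le_eqVlt; apply/orP; left; apply/eqP; apply: eq_integral => t _;
  rewrite cabs_mellin.
Qed.

Section Abel.
Variables (phi h : R -> R[i]) (e : R).
Hypothesis e0 : 0 < e.
Hypothesis Lphi : mellin_class 2^-1 phi.
Hypothesis Lh : mellin_class 2^-1 h.

(** Since t^(-1/2) dt = t^(1/2) dt / t, this averages phi(t) t^(1/2) against the Poisson kernel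
    centred at ln u; it should tend to 2 pi u^(1/2) phi(u) as [e] tends to 0. *)
Definition smoothed u : R[i] :=
  cint leb setT (fun t => phi t * cpow t mh * (kap e (ln t - ln u))%:C).

Lemma cint_abel_mellin u : 0 < u ->
  cint leb setT (fun tau => (abel e tau)%:C * mellin phi (line tau) * cpow u (0 -i* tau)) = smoothed u.
Proof.
move=> u0; have [mp p0 Ip] := Lphi.
pose F (x : R * R) : R[i] := (abel e x.1)%:C * (phi x.2 * cpow x.2 (line x.1 - 1)) * cpow u (0 -i* x.1).
have mF : cmeasurable setT F.
  have m1 : measurable_fun setT (fun x : R * R => x.1) by exact: measurable_fst.
  have m2 : measurable_fun setT (fun x : R * R => x.2) by exact: measurable_snd.
  apply: cmeasurableM; last first.
    apply: cmeasurable_cpow; first exact: measurable_cst.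
    by split => /=; [exact: measurable_cst|exact: measurableT_comp].
  apply: cmeasurableM.
    by apply: cmeasurable_real; exact: (measurableT_comp (measurable_abel e)).
  apply: cmeasurableM.
    by case: mp => r j; split; [exact: (measurableT_comp r)|exact: (measurableT_comp j)].
  apply: cmeasurable_cpow => //; apply: cmeasurableB; last exact: cmeasurable_cst.
  by split => //=; exact: measurable_cst.
have ia := integrable_abel e0.
have cF t tau : cabs (F (tau, t)) = cabs (phi t) * expR ((2^-1 - 1) * ln t) * abel e tau.
  rewrite /F /= Normc.normcM (Normc.normcM _%:C) (Normc.normcM (phi t)) cabs_real.
  rewrite (ger0_norm (abel_ge0 _ _)) cabs_cpow_line.
  by rewrite (cabs_cpow_im u (- tau)) mulr1 mulrC.
have iF : cintegrable (leb \x leb)%E setT F.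
  apply: cintegrable_prod => //.
  have [N [N0 EN]] := mellin_norm_fin Lphi.
  pose A := (\int[leb]_x (abel e x)%:E)%E.
  have A0 : (0 <= A)%E by apply: integral_ge0 => t _; rewrite lee_fin abel_ge0.
  have Af : (A < +oo)%E.
    have /integrableP[_] := ia.
    by under eq_integral do rewrite abse_EFin (ger0_norm (abel_ge0 _ _)).
  rewrite [X in (X < _)%E](_ : _ = \int[leb]_t ((cabs (phi t) * expR ((2^-1 - 1) * ln t))%:E * A))%E.
    rewrite ge0_integralZr//; last 2 first.
    - apply/measurable_EFinP; apply: measurable_funM; first exact: measurable_cabs.
      exact: measurable_mellin_weight.
    - by move=> t _; rewrite lee_fin mulr_ge0 ?cabs_ge0 ?expR_ge0.
    by rewrite EN lte_mul_pinfty// lee_fin.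
  apply: eq_integral => t _; rewrite -ge0_integralZl//; last 3 first.
  - by apply/measurable_EFinP; exact: measurable_abel.
  - by move=> x _; rewrite lee_fin abel_ge0.
  - by rewrite lee_fin mulr_ge0 ?cabs_ge0 ?expR_ge0.
  by apply: eq_integral => tau _; rewrite cF EFinM.
transitivity (cint leb setT (fun tau => cint leb setT (fun t => F (tau, t)))).
  apply: eq_cint => tau _; rewrite /F /= /mellin -mulrA mulrCA mulrC -cintZ; last 2 first.
  - exact: measurableT.
  - exact: (cintegrable_mellin Lphi).
  by apply: eq_cint => t _; ring.
rewrite (cint_Fubini iF) /smoothed; apply: eq_cint => t _ /=.
have [t0|t0] := leP t 0.
  rewrite p0// !mul0r (@eq_cint _ _ _ _ _ _ (fun=> 0)) ?cint0//.
  by move=> tau _; rewrite /F /= p0// mul0r mulr0 mul0r.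
have e1 : kap e (ln t - ln u) = 2 * e / (e ^+ 2 + ln (t / u) ^+ 2).
  by rewrite lnM ?posrE ?invr_gt0// lnV.
rewrite e1 -(cint_abel_pow _ e0) -cintZ; last 2 first.
- exact: measurableT.
- apply: (@le_cintegrable _ (measurableTypeR R) R leb setT measurableT _ (abel e)) => //.
    exact: cmeasurable_abel_pow.
  by move=> x _; rewrite cabs_abel_pow.
apply: eq_cint => tau _; rewrite /F /= cpow_line /abel_pow cpowM ?invr_gt0// cpowV//.
have -> : (0 -i* tau) = - (0 +i* tau) :> R[i] by apply: cplx_eqP; rewrite /= ?oppr0.
by ring.
Qed.

(** Damping makes the double integral absolutely convergent although the transform of phi is merely
    bounded; Fubini then reduces the formula to [cint_abel_mellin]. The measurability of the
    right-hand integrand is recorded as well, because it is read off the same integrand on the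
    product. *)
Lemma parseval_abel :
  cint leb setT (fun tau => (abel e tau)%:C * (mellin phi (line tau) * conjc (mellin h (line tau)))) =
  cint leb setT (fun u => conjc (h u) * cpow u mh * smoothed u) /\
  cmeasurable setT (fun u => conjc (h u) * cpow u mh * smoothed u).
Proof.
have [mp p0 Ip] := Lphi; have [mhh h0 Ih] := Lh.
pose F (x : R * R) : R[i] := (abel e x.1)%:C * mellin phi (line x.1) *
  conjc (h x.2 * cpow x.2 (line x.1 - 1)).
have m1 : measurable_fun setT (fun x : R * R => x.1) by exact: measurable_fst.
have m2 : measurable_fun setT (fun x : R * R => x.2) by exact: measurable_snd.
have mF : cmeasurable setT F.
  apply: cmeasurableM.
    apply: cmeasurableM.
      by apply: cmeasurable_real; exact: (measurableT_comp (measurable_abel e)).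
    by case: (cmeasurable_mellin_line mp) => r j; split;
      [exact: (measurableT_comp r)|exact: (measurableT_comp j)].
  apply: cmeasurableJ; apply: cmeasurableM.
    by case: mhh => r j; split; [exact: (measurableT_comp r)|exact: (measurableT_comp j)].
  apply: cmeasurable_cpow => //; apply: cmeasurableB; last exact: cmeasurable_cst.
  by split => //=; exact: measurable_cst.
have ia := integrable_abel e0.
have [B [B0 hB]] := mellin_line_bounded Lphi.
have iF : cintegrable (leb \x leb)%E setT F.
  apply: cintegrable_prod => //.
  have [N [N0 EN]] := mellin_norm_fin Lh.
  pose A := (\int[leb]_x (abel e x)%:E)%E.
  have A0 : (0 <= A)%E by apply: integral_ge0 => t _; rewrite lee_fin abel_ge0.
  have Af : (A < +oo)%E.
    have /integrableP[_] := ia.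
    by under eq_integral do rewrite abse_EFin (ger0_norm (abel_ge0 _ _)).
  apply: (@le_lt_trans _ _ (\int[leb]_t ((cabs (h t) * expR ((2^-1 - 1) * ln t))%:E * (B%:E * A)))%E).
    apply: ge0_le_integral => //.
    - by move=> t _; apply: integral_ge0 => x _; rewrite lee_fin cabs_ge0.
    - have mcF : measurable_fun setT (fun z : R * R => (cabs (F z))%:E).
        by apply/measurable_EFinP; exact: measurable_cabs.
      have cF0 (z : R * R) : (0 <= (cabs (F z))%:E)%E by rewrite lee_fin cabs_ge0.
      exact: (@measurable_fun_fubini_tonelli_G _ _ _ _ R leb (fun z : R * R => (cabs (F z))%:E) mcF cF0).
    - apply: emeasurable_funM; last exact: measurable_cst.
      apply/measurable_EFinP; apply: measurable_funM; first exact: measurable_cabs.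
      exact: measurable_mellin_weight.
    - move=> t _; rewrite muleA -ge0_integralZl//; last 3 first.
      + by apply/measurable_EFinP; exact: measurable_abel.
      + by move=> x _; rewrite lee_fin abel_ge0.
      + by rewrite -EFinM lee_fin !mulr_ge0 ?cabs_ge0 ?expR_ge0.
      apply: ge0_le_integral => //.
      + by move=> x _; rewrite lee_fin cabs_ge0.
      + apply/measurable_EFinP; apply: measurable_cabs.
        case: mF => r j; split.
          by apply: (measurableT_comp r (g := fun x : R => (x, t))); exact: measurable_fun_pair.
        by apply: (measurableT_comp j (g := fun x : R => (x, t))); exact: measurable_fun_pair.
      + apply: emeasurable_funM; first exact: measurable_cst.
        by apply/measurable_EFinP; exact: measurable_abel.
      + move=> tau _; rewrite -!EFinM lee_fin /F /= Normc.normcM (Normc.normcM _%:C).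
        rewrite cabs_real (ger0_norm (abel_ge0 _ _)) cabsJ Normc.normcM cabs_cpow_line.
        rewrite mulrC mulrCA [leRHS]mulrC ler_wpM2l ?abel_ge0//.
        by rewrite ler_wpM2l ?mulr_ge0 ?cabs_ge0 ?expR_ge0.
  rewrite ge0_integralZr//; last 3 first.
  - apply/measurable_EFinP; apply: measurable_funM; first exact: measurable_cabs.
    exact: measurable_mellin_weight.
  - by move=> t _; rewrite lee_fin mulr_ge0 ?cabs_ge0 ?expR_ge0.
  - by rewrite mule_ge0.
  by rewrite EN lte_mul_pinfty// ?lee_fin// lte_mul_pinfty// lee_fin.
have E u : cint leb setT (fun tau => F (tau, u)) = conjc (h u) * cpow u mh * smoothed u.
  have [u0|u0] := leP u 0.
    rewrite h0// rmorph0 !mul0r (@eq_cint _ _ _ _ _ _ (fun=> 0)) ?cint0//.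
    by move=> tau _; rewrite /F /= h0// mul0r rmorph0 mulr0.
  rewrite -cint_abel_mellin// -cintZ; last 2 first.
  - exact: measurableT.
  - apply: (@le_cintegrable _ (measurableTypeR R) R leb setT measurableT _ (fun x => B * abel e x)).
    + apply: cmeasurableM.
        apply: cmeasurableM; last exact: cmeasurable_mellin_line.
        by apply: cmeasurable_real; exact: measurable_abel.
      apply: cmeasurable_cpow; first exact: measurable_cst.
      by split => /=; [exact: measurable_cst|exact: measurableT_comp].
    + exact: (integrableZl measurableT B ia).
    + move=> tau _; rewrite Normc.normcM (cabs_cpow_im u (- tau)) mulr1 Normc.normcM cabs_real.
      by rewrite (ger0_norm (abel_ge0 _ _)) mulrC ler_wpM2r ?abel_ge0.
  apply: eq_cint => tau _; rewrite /F /= rmorphM /= conj_cpow.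
  have -> : conjc (line tau - 1) = mh + (0 -i* tau).
    by rewrite /mhalf /line; apply: cplx_eqP => /=; lra.
  by rewrite cpowD; ring.
split.
  transitivity (cint leb setT (fun tau => cint leb setT (fun u => F (tau, u)))).
    apply: eq_cint => tau _; rewrite /F /= mulrA cintZ; last 2 first.
    - exact: measurableT.
    - by apply: cintegrableJ => //; exact: (cintegrable_mellin Lh).
    by rewrite cintJ//; exact: (cintegrable_mellin Lh).
  by rewrite (cint_Fubini iF); apply: eq_cint => u _; rewrite -E.
have -> : (fun u => conjc (h u) * cpow u mh * smoothed u) = (fun u => cint leb setT (fun tau => F (tau, u))).
  by apply/funext => u; rewrite E.
have mFs : cmeasurable setT (fun z : R * R => F (z.2, z.1)).
  case: mF => r j; split.
    by apply: (measurableT_comp r (g := fun z : R * R => (z.2, z.1))); exact: measurable_fun_pair.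
  by apply: (measurableT_comp j (g := fun z : R * R => (z.2, z.1))); exact: measurable_fun_pair.
exact: (cmeasurable_cint_section leb mFs).
Qed.

End Abel.

End Parseval.

(** * Removal of the damping *)

Section ParsevalLimit.
Variable R : realType.
Local Notation leb := (@lebesgue_measure R).
Implicit Types (f phi h : R -> R[i]) (s z : R[i]) (u t tau : R).
Local Notation mh := (@mhalf R).

(** Multiplication by t^(1/2) makes a half-bounded function bounded, the setting of
    [cvg_approx_identity]. *)
Definition tilt phi t : R[i] := phi t * cpow t (2^-1)%:C.

Lemma smoothedE phi e u : (forall t, t <= 0 -> phi t = 0) ->
  smoothed phi e u = cint leb setT (fun t => tilt phi t * (kmeas e (ln u) t)%:C).
Proof.
move=> p0; apply: eq_cint => t _; rewrite /tilt /kmeas.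
have [t0|t0] := leP t 0; first by rewrite p0// !mul0r.
have -> : cpow t mh = cpow t (2^-1)%:C * (t^-1)%:C.
  have -> : (t^-1)%:C = cpow t (- 1) :> R[i] by rewrite cpowN cpow_id// fmorphV.
  rewrite -cpowD; congr cpow.
  by rewrite /mhalf; apply: cplx_eqP => /=; lra.
by rewrite [in RHS]rmorphM; move: (cpow t _) => c; rewrite /=; ring.
Qed.

Lemma tilt_bounded phi B : (forall t, 0 < t -> cabs (phi t) <= B * expR (- (2^-1 * ln t))) ->
  forall t, 0 < t -> cabs (tilt phi t) <= B.
Proof.
move=> hB t t0; rewrite /tilt Normc.normcM cabs_cpow /=.
rewrite (le_trans (ler_wpM2r (expR_ge0 _) (hB t t0)))// -mulrA -expRD addNr expR0.
by rewrite mulr1.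
Qed.

Lemma cmeasurable_tilt phi : cmeasurable setT phi -> cmeasurable setT (tilt phi).
Proof. by move=> mp; apply: cmeasurableM => //; exact: cmeasurable_cpow_id. Qed.

Lemma cvg_tilt phi u : 0 < u -> phi t @[t --> u] --> (phi u : R[i]^o) ->
  tilt phi t @[t --> u] --> (tilt phi u : R[i]^o).
Proof.
move=> u0 cp.
have cc : (fun t => cpow t (2^-1)%:C) @ u --> (cpow u (2^-1)%:C : R[i]^o).
  by apply/cvgC_ReIm; split; [exact: continuous_Re_cpow|exact: continuous_Im_cpow].
exact: (cvgCM cp cc).
Qed.

Lemma smoothed_bounded phi B e u : 0 < e -> mellin_class 2^-1 phi ->
  (forall t, 0 < t -> cabs (phi t) <= B * expR (- (2^-1 * ln t))) ->
  cabs (smoothed phi e u) <= B * (2 * pi) *+ 2.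
Proof.
move=> e0 [mp p0 _] hB; rewrite smoothedE//.
by have [] := cint_kmeas_bound (ln u) e0 (cmeasurable_tilt mp) (tilt_bounded hB).
Qed.

(** Apply [parseval_abel] with h = phi: the smoothed function is bounded independently of the
    damping, so the damped square integrals are bounded uniformly, and the bound passes to the limit
    over growing intervals. *)
Lemma sqL2norm_mellin_half_bounded phi : mellin_class 2^-1 phi -> half_bounded phi ->
  (sqL2norm setT (fun tau => mellin phi (line tau)) < +oo)%E.
Proof.
move=> L [B hB]; have [mp p0 _] := L; have [N [N0 EN]] := mellin_norm_fin L.
have mM := cmeasurable_mellin_line mp.
pose K := N * (B * (2 * pi) *+ 2).
pose g tau := complex.Re (mellin phi (line tau)) ^+ 2 + complex.Im (mellin phi (line tau)) ^+ 2.
have g0 tau : 0 <= g tau by rewrite addr_ge0 ?sqr_ge0.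
have mg : measurable_fun setT g.
  by case: mM => r j; apply: measurable_funD; exact: measurable_funX.
have gE tau : mellin phi (line tau) * conjc (mellin phi (line tau)) = (g tau)%:C.
  by rewrite /g; case: (mellin phi (line tau)) => a b; apply: cplx_eqP => /=; ring.
have gb : exists C, forall tau, g tau <= C.
  have [C [C0 hC]] := mellin_line_bounded L; exists (C ^+ 2) => tau.
  by rewrite /g -sqr_cabs lerXn2r ?nnegrE ?cabs_ge0.
have [C hC] := gb.
have bound e : 0 < e -> (\int[leb]_tau (abel e tau * g tau)%:E <= (K *+ 2)%:E)%E.
  move=> e0; have [E _] := parseval_abel e0 L L.
  have ia : leb.-integrable setT (fun tau => (abel e tau * g tau)%:E).
    have := integrableZl measurableT C (integrable_abel e0); apply: le_integrable => //.
      by apply/measurable_EFinP; apply: measurable_funM => //; exact: measurable_abel.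
    move=> tau _ /=; rewrite lee_fin !normrM (ger0_norm (g0 _)) mulrC.
    by rewrite ler_wpM2r// (le_trans (hC tau))// ler_norm.
  have -> : (\int[leb]_tau (abel e tau * g tau)%:E =
     (Rintegral leb setT (fun tau => abel e tau * g tau))%:E)%E.
    by rewrite /Rintegral fineK//; exact: integrable_fin_num.
  have EE : cint leb setT (fun tau => (abel e tau)%:C *
      (mellin phi (line tau) * conjc (mellin phi (line tau)))) =
      (Rintegral leb setT (fun tau => abel e tau * g tau))%:C.
    by rewrite -cint_real; apply: eq_cint => tau _; rewrite gE rmorphM.
  have r0 : 0 <= Rintegral leb setT (fun tau => abel e tau * g tau).
    by apply: Rintegral_ge0 => tau _; rewrite mulr_ge0 ?abel_ge0.
  rewrite lee_fin -(ger0_norm r0).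
  rewrite -cabs_real -EE E.
  have [_ mS] := parseval_abel e0 L L.
  have sb u := smoothed_bounded u e0 L hB.
  have le u : cabs (conjc (phi u) * cpow u mh * smoothed phi e u) <=
      (B * (2 * pi) *+ 2) * (cabs (phi u) * expR ((2^-1 - 1) * ln u)).
    rewrite Normc.normcM (Normc.normcM (conjc _)) cabsJ cpow_mh cabs_real.
    rewrite (ger0_norm (expR_ge0 _)) mh_weight mulrC.
    by rewrite ler_wpM2r ?mulr_ge0 ?cabs_ge0 ?expR_ge0.
  have M0 : 0 <= B * (2 * pi) *+ 2 by apply: le_trans (sb 1); exact: cabs_ge0.
  have mw : measurable_fun setT (fun u => cabs (phi u) * expR ((2^-1 - 1) * ln u)).
    by apply: measurable_funM; [exact: measurable_cabs|exact: measurable_mellin_weight].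
  have Ib : (\int[leb]_u ((B * (2 * pi) *+ 2) * (cabs (phi u) * expR ((2^-1 - 1) * ln u)))%:E = K%:E)%E.
    under eq_integral do rewrite EFinM.
    rewrite ge0_integralZl//; last 2 first.
    - exact/measurable_EFinP.
    - by move=> u _; rewrite lee_fin mulr_ge0 ?cabs_ge0 ?expR_ge0.
    by rewrite EN -EFinM /K mulrC.
  apply: le_cabs_cint => //.
    apply: (@le_cintegrable _ (measurableTypeR R) R leb setT measurableT _
      (fun u => (B * (2 * pi) *+ 2) * (cabs (phi u) * expR ((2^-1 - 1) * ln u)))) => //.
    apply/integrableP; split; first by apply/measurable_EFinP; exact: measurable_funM.
    under eq_integral do rewrite abse_EFin ger0_norm ?mulr_ge0 ?cabs_ge0 ?expR_ge0//.
    by rewrite Ib ltry.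
  rewrite -Ib; apply: ge0_le_integral => //.
  - by move=> u _; rewrite lee_fin cabs_ge0.
  - by apply/measurable_EFinP; exact: measurable_cabs.
  - by apply/measurable_EFinP; exact: measurable_funM.
  - by move=> u _; rewrite lee_fin.
have K0 : 0 <= K *+ 2.
  rewrite -lee_fin; apply: le_trans (bound 1 ltr01).
  by apply: integral_ge0 => tau _; rewrite lee_fin mulr_ge0 ?abel_ge0.
(* On [- n, n] the damping with parameter 1 / (n + 1) is at least exp (- 1), whence the factor
   [expR 1]. *)
apply: (@le_lt_trans _ _ (expR 1 * (K *+ 2))%:E); last exact: ltry.
apply: (@le_integral_exhaust R (@sym_itv R) g _ (@sym_itv_nd R)) => //.
- by move=> n; exact: measurable_itv.
- by move=> t []; rewrite bigcup_sym_itv.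
- move=> n; have e0 : 0 < n.+1%:R^-1 :> R by rewrite invr_gt0.
  have mS : measurable (sym_itv n : set R) by exact: measurable_itv.
  have mag : measurable_fun setT (fun tau => (abel n.+1%:R^-1 tau * g tau)%:E).
    by apply/measurable_EFinP; apply: measurable_funM => //; exact: measurable_abel.
  apply: (@le_trans _ _ (\int[leb]_(tau in sym_itv n) ((expR 1)%:E * (abel n.+1%:R^-1 tau * g tau)%:E))%E).
    apply: ge0_le_integral => //.
    - by move=> tau _; rewrite lee_fin.
    - by apply/measurable_EFinP; exact: measurable_funTS.
    - by apply: emeasurable_funM; [exact: measurable_cst|exact: measurable_funTS].
    - move=> tau; rewrite /sym_itv /= in_itv /= => ht.
      rewrite -EFinM lee_fin mulrA ler_peMl// /abel -expRD -[leLHS]expR0 ler_expR subr_ge0.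
      rewrite mulrC ler_pdivrMr// mul1r ler_norml.
      move: ht => /andP[h1 h2]; rewrite (le_trans _ h1) ?(le_trans h2) ?ler_nat//.
      by rewrite lerN2 ler_nat.
  rewrite ge0_integralZl//; do ?[exact: measurable_funTS
    | by move=> tau _; rewrite lee_fin mulr_ge0 ?abel_ge0 | by rewrite lee_fin expR_ge0].
  rewrite EFinM lee_wpmul2l ?lee_fin ?expR_ge0//.
  apply: le_trans (bound _ e0); apply: ge0_subset_integral => //.
  by move=> tau _; rewrite lee_fin mulr_ge0 ?abel_ge0.
Qed.

Lemma cvgC_zero (v : nat -> R[i]) z : (forall n, v n = 0) -> z = 0 ->
  v n @[n --> \oo] --> (z : R[i]^o).
Proof. by move=> v0 ->; under eq_fun do rewrite v0; exact: cvgC_cst. Qed.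

Lemma cvgCZ (v : nat -> R[i]) z l : v n @[n --> \oo] --> (l : R[i]^o) ->
  z * v n @[n --> \oo] --> (z * l : R[i]^o).
Proof. by move=> vl; apply: cvgCM; [exact: cvgC_cst|exact: vl]. Qed.

Lemma cvg_abel tau : abel n.+1%:R^-1 tau @[n --> \oo] --> (1 : R).
Proof.
have c0 : - (n.+1%:R^-1 * `|tau|) @[n --> \oo] --> (0 : R).
  rewrite -[X in _ --> X]oppr0 -(mul0r `|tau|); apply: cvgN; apply: cvgM; last exact: cvg_cst.
  exact: cvg_harmonic.
have h : expR y @[y --> (0 : R)] --> (1 : R).
  by have := @continuous_expR R 0; rewrite /continuous_at expR0.
exact: (cvg_comp _ _ c0 h).
Qed.

(** The damping tends to 0 by dominated convergence on both sides: the integrable product of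
    transforms dominates on the line, a multiple of |h(u)| u^(-1/2) on ]0, oo[. Regularity is
    demanded of phi alone, so that [h] may be a truncation of an arbitrary element of K. The
    exceptional point [p] accommodates the jumps of the cut-off functions used later. *)
Theorem mellin_parseval phi h p : mellin_class 2^-1 phi -> half_bounded phi ->
  (forall u, 0 < u -> u <> p -> phi t @[t --> u] --> (phi u : R[i]^o)) ->
  mellin_class 2^-1 h ->
  cintegrable leb setT (fun tau => mellin phi (line tau) * conjc (mellin h (line tau))) ->
  cint leb setT (fun tau => mellin phi (line tau) * conjc (mellin h (line tau))) =
    (2 * pi)%:C * cint leb setT (fun u => phi u * conjc (h u)).
Proof.
move=> L [B hB] cphi Lh I; have [mp p0 _] := L; have [mhh h0 _] := Lh.
have e0 n : 0 < n.+1%:R^-1 :> R by rewrite invr_gt0.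
have PA n := parseval_abel (e0 n) L Lh.
have [N [N0 EN]] := mellin_norm_fin Lh.
have mw : measurable_fun setT (fun u => cabs (h u) * expR ((2^-1 - 1) * ln u)).
  by apply: measurable_funM; [exact: measurable_cabs|exact: measurable_mellin_weight].
have mI := cintegrable_meas I.
have lhs : cint leb setT (fun tau => (abel n.+1%:R^-1 tau)%:C *
    (mellin phi (line tau) * conjc (mellin h (line tau)))) @[n --> \oo] -->
    (cint leb setT (fun tau => mellin phi (line tau) * conjc (mellin h (line tau))) : R[i]^o).
  have dom := @cint_dominated _ (measurableTypeR R) R leb setT measurableT
    (fun n tau => (abel n.+1%:R^-1 tau)%:C * (mellin phi (line tau) * conjc (mellin h (line tau))))
    (fun tau => mellin phi (line tau) * conjc (mellin h (line tau)))
    (fun tau => cabs (mellin phi (line tau) * conjc (mellin h (line tau)))).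
  apply: (dom _ _ _ _ _).2 => //.
  - by move=> n; apply: cmeasurableM => //; apply: cmeasurable_real; exact: measurable_abel.
  - apply: aeW => tau _; rewrite -[X in _ --> (X : R[i]^o)]mul1r.
    apply: cvgCM; last exact: cvgC_cst.
    by apply/cvgC_ReIm; split => /=; [exact: cvg_abel|exact: cvg_cst].
  - exact: (cintegrable_cabs measurableT I).
  - move=> n tau _; rewrite Normc.normcM cabs_real (ger0_norm (abel_ge0 _ _)).
    by rewrite ler_piMl ?cabs_ge0// /abel expR_le1 oppr_le0 mulr_ge0.
have M0 : 0 <= B * (2 * pi) *+ 2.
  by apply: le_trans (smoothed_bounded 1 (e0 0%N) L hB); exact: cabs_ge0.
have rhs : cint leb setT (fun u => conjc (h u) * cpow u mh * smoothed phi n.+1%:R^-1 u) @[n --> \oo] -->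
    (cint leb setT (fun u => (2 * pi)%:C * (phi u * conjc (h u))) : R[i]^o).
  have dom := @cint_dominated _ (measurableTypeR R) R leb setT measurableT
    (fun n u => conjc (h u) * cpow u mh * smoothed phi n.+1%:R^-1 u)
    (fun u => (2 * pi)%:C * (phi u * conjc (h u)))
    (fun u => (B * (2 * pi) *+ 2) * (cabs (h u) * expR ((2^-1 - 1) * ln u))).
  apply: (dom _ _ _ _ _).2 => //.
  - by move=> n; have [] := PA n.
  - apply: cmeasurableM; first exact: cmeasurable_cst.
    by apply: cmeasurableM => //; exact: cmeasurableJ.
  - apply: (@ae_neq R p) => u up _; have [u0|u0] := leP u 0.
      have hz : conjc (h u) = 0 by rewrite h0// rmorph0.
      apply: cvgC_zero; last by rewrite hz [_ * 0]mulr0 mulr0.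
      by move=> n; rewrite hz mul0r mul0r.
    have -> : (2 * pi)%:C * (phi u * conjc (h u)) =
        conjc (h u) * cpow u mh * ((2 * pi)%:C * tilt phi u).
      rewrite /tilt; have : cpow u mh * cpow u (2^-1)%:C = 1.
        by rewrite -cpowD /mhalf addNr cpow0.
      set a := cpow u mh; set b := cpow u _ => ab.
      by rewrite -[LHS]mulr1 -ab; ring.
    have cs : (fun n : nat => smoothed phi n.+1%:R^-1 u) @ \oo --> ((2 * pi)%:C * tilt phi u : R[i]^o).
      under eq_fun do rewrite smoothedE//.
      apply: (cvg_approx_identity u0 (cmeasurable_tilt mp) (tilt_bounded hB)).
      exact: (cvg_tilt u0 (cphi u u0 up)).
    move: (conjc (h u) * cpow u mh) => z.
    apply: cvgCZ; exact: cs.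
  - apply/integrableP; split; first by apply/measurable_EFinP; exact: measurable_funM.
    under eq_integral do rewrite abse_EFin ger0_norm ?mulr_ge0 ?cabs_ge0 ?expR_ge0// EFinM.
    rewrite ge0_integralZl//; last 2 first.
    - exact/measurable_EFinP.
    - by move=> u _; rewrite lee_fin mulr_ge0 ?cabs_ge0 ?expR_ge0.
    by rewrite EN -EFinM ltry.
  - move=> n u _; rewrite Normc.normcM (Normc.normcM (conjc _)) cabsJ cpow_mh cabs_real.
    rewrite (ger0_norm (expR_ge0 _)) mh_weight mulrC.
    by rewrite ler_wpM2r ?mulr_ge0 ?cabs_ge0 ?expR_ge0// smoothed_bounded.
have iph : cintegrable leb setT (fun u => phi u * conjc (h u)).
  apply: (@le_cintegrable _ (measurableTypeR R) R leb setT measurableT _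
    (fun u => B * (cabs (h u) * expR ((2^-1 - 1) * ln u)))).
  - by apply: cmeasurableM => //; exact: cmeasurableJ.
  - have iw : leb.-integrable setT (fun u => (cabs (h u) * expR ((2^-1 - 1) * ln u))%:E).
      apply/integrableP; split; first exact/measurable_EFinP.
      under eq_integral do rewrite abse_EFin ger0_norm ?mulr_ge0 ?cabs_ge0 ?expR_ge0//.
      by rewrite EN ltry.
    exact: (integrableZl measurableT B iw).
  - move=> u _; rewrite Normc.normcM cabsJ; have [u0|u0] := leP u 0.
      by rewrite h0// cabs0 mul0r !mulr0.
    rewrite mulrCA mulrC ler_wpM2l ?cabs_ge0// -mh_weight; exact: hB.
rewrite -cintZ//; apply: (cvgC_unique lhs).
suff -> : (fun n => cint leb setT (fun tau => (abel n.+1%:R^-1 tau)%:C *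
    (mellin phi (line tau) * conjc (mellin h (line tau))))) =
  (fun n => cint leb setT (fun u => conjc (h u) * cpow u mh * smoothed phi n.+1%:R^-1 u)) by [].
by apply/funext => n; have [] := PA n.
Qed.

End ParsevalLimit.

(** * Pairings of square integrable functions *)

Section L2Pairing.
Variable R : realType.
Local Notation leb := (@lebesgue_measure R).
Implicit Types (a b f h F phi : R -> R[i]) (D : set R).

Lemma sqL2normE D f : sqL2norm D f = (\int[leb]_(t in D) (cabs (f t) ^+ 2)%:E)%E.
Proof. by apply: eq_integral => t _; rewrite sqr_cabs. Qed.

Lemma sqL2norm_ge0 D f : (0 <= sqL2norm D f)%E.
Proof. by rewrite sqL2normE; apply: integral_ge0 => t _; rewrite lee_fin sqr_ge0. Qed.

Lemma measurable_sqr_cabs D f : cmeasurable D f -> measurable_fun D (fun t => (cabs (f t) ^+ 2)%:E).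
Proof. by move=> mf; apply/measurable_EFinP; apply: measurable_funX; exact: measurable_cabs. Qed.

Lemma sqL2norm_fin D f : measurable D -> cmeasurable D f -> (sqL2norm D f < +oo)%E ->
  leb.-integrable D (fun t => (cabs (f t) ^+ 2)%:E).
Proof.
move=> mD mf; rewrite sqL2normE => h; apply/integrableP; split; first exact: measurable_sqr_cabs.
by under eq_integral do rewrite abse_EFin ger0_norm ?sqr_ge0//.
Qed.

(** This weighted inequality stands in for Cauchy-Schwarz: choosing [d] at the end gives the same
    limits without square roots of extended integrals. *)
Lemma AMGM (x y d : R) : 0 < d -> x * y <= d * x ^+ 2 + d^-1 * y ^+ 2.
Proof.
move=> d0; have dn : d != 0 by rewrite gt_eqF.
have h : 0 <= (d * x - 2^-1 * y) ^+ 2 by rewrite sqr_ge0.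
have h2 : 0 <= y ^+ 2 by rewrite sqr_ge0.
rewrite -subr_ge0 (_ : _ - _ = d^-1 * ((d * x - 2^-1 * y) ^+ 2 + 3 / 4 * y ^+ 2)); last by field.
by rewrite mulr_ge0 ?invr_ge0 ?(ltW d0)// addr_ge0// mulr_ge0.
Qed.

Lemma cintegrable_pairing D a b : measurable D -> cmeasurable D a -> cmeasurable D b ->
  (sqL2norm D a < +oo)%E -> (sqL2norm D b < +oo)%E ->
  cintegrable leb D (fun t => a t * conjc (b t)).
Proof.
move=> mD ma mb ha hb.
apply: (@le_cintegrable _ (measurableTypeR R) R leb D mD _ (fun t => cabs (a t) ^+ 2 + cabs (b t) ^+ 2)).
- by apply: cmeasurableM => //; exact: cmeasurableJ.
- have := @integrableD _ (measurableTypeR R) R leb D mD _ _ (sqL2norm_fin mD ma ha) (sqL2norm_fin mD mb hb).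
  by apply: eq_integrable => // t _; rewrite EFinD.
- move=> t _; rewrite Normc.normcM cabsJ; have := AMGM (cabs (a t)) (cabs (b t)) ltr01.
  by rewrite invr1 !mul1r.
Qed.

Lemma pairing_le D a b (A B d : R) : measurable D -> cmeasurable D a -> cmeasurable D b ->
  0 < d -> (sqL2norm D a <= A%:E)%E -> (sqL2norm D b <= B%:E)%E ->
  cabs (cint leb D (fun t => a t * conjc (b t))) <= (d * A + d^-1 * B) *+ 2.
Proof.
move=> mD ma mb d0 ha hb.
have ha' : (sqL2norm D a < +oo)%E by apply: le_lt_trans ha (ltry _).
have hb' : (sqL2norm D b < +oo)%E by apply: le_lt_trans hb (ltry _).
have I := cintegrable_pairing mD ma mb ha' hb'.
have [dl0 di0] : 0 <= d /\ 0 <= d^-1 by rewrite invr_ge0 ltW.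
apply: le_cabs_cint => //.
apply: (@le_trans _ _ (\int[leb]_(t in D) (d%:E * (cabs (a t) ^+ 2)%:E + d^-1%:E * (cabs (b t) ^+ 2)%:E))%E).
  apply: ge0_le_integral => //.
  - by move=> t _; rewrite lee_fin cabs_ge0.
  - by apply/measurable_EFinP; apply: measurable_cabs; exact: (cintegrable_meas I).
  - by apply: emeasurable_funD; apply: emeasurable_funM;
      do ?[exact: measurable_cst|exact: measurable_sqr_cabs].
  - by move=> t _; rewrite -!EFinM -EFinD lee_fin Normc.normcM cabsJ AMGM.
rewrite ge0_integralD//; do ?[by move=> t _; rewrite mule_ge0// lee_fin ?sqr_ge0
  | by apply: emeasurable_funM; do ?[exact: measurable_cst|exact: measurable_sqr_cabs]].
rewrite !ge0_integralZl//; do ?[exact: measurable_sqr_cabs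
  | by move=> t _; rewrite lee_fin sqr_ge0].
by rewrite -!sqL2normE EFinD !EFinM leeD// lee_wpmul2l// lee_fin.
Qed.

Lemma cvg0_ereal_lt (T : Type) (G : set_system T) {FG : Filter G} (u : T -> \bar R) (r : R) :
  u @ G --> 0%E -> 0 < r -> \forall x \near G, (u x < r%:E)%E.
Proof.
move=> /fine_cvgP[fu /(@cvgrPdist_lt _ R^o) h] r0.
have {}h := h _ r0; apply: filterS2 fu h => x /= fx.
rewrite sub0r normrN => /(le_lt_trans (ler_norm _)).
by rewrite -lte_fin fineK.
Qed.

(** The filter is arbitrary because two limits are taken: along truncations of Mellin integrals, and
    as [w] tends to rho inside a half-plane. *)
Lemma pairing_cvg0 (T : Type) (G : set_system T) {FG : Filter G} D a (b_ : T -> R -> R[i]) :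
  measurable D -> cmeasurable D a -> (sqL2norm D a < +oo)%E ->
  (\forall x \near G, cmeasurable D (b_ x)) ->
  sqL2norm D (b_ x) @[x --> G] --> 0%E ->
  cint leb D (fun t => a t * conjc (b_ x t)) @[x --> G] --> (0 : R[i]^o).
Proof.
move=> mD ma ha mb hb; apply/cvgC_cabs; apply/(@cvgrPdist_lt _ R^o) => e e0.
have af : sqL2norm D a = (fine (sqL2norm D a))%:E.
  by rewrite fineK// ge0_fin_numE// sqL2norm_ge0.
set A := fine (sqL2norm D a) in af.
have A0 : 0 <= A by rewrite -lee_fin -af sqL2norm_ge0.
(* Then d A <= e / 8, and a squared norm below d e / 8 makes the second term of [pairing_le] at most
   e / 8 too; doubled, the sum is at most e / 2. Using A + 1 avoids a division by 0. *)
pose d := e / (8 * (A + 1)).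
have A1 : 0 < A + 1 by rewrite ltr_wpDl.
have d0 : 0 < d by rewrite divr_gt0// mulr_gt0.
have r0 : 0 < d * e / 8 by rewrite divr_gt0// mulr_gt0.
apply: filterS2 mb (cvg0_ereal_lt hb r0) => x mx hx.
rewrite subr0 sub0r normrN ger0_norm ?cabs_ge0//.
have ha' : (sqL2norm D a <= A%:E)%E by rewrite af.
apply: (le_lt_trans (pairing_le mD ma mx d0 ha' (ltW hx))).
have dn : d != 0 by rewrite gt_eqF.
have -> : d^-1 * (d * e / 8) = e / 8 by field.
have hd : d * (A + 1) = e / 8 by rewrite /d invfM mulrA divfK// gt_eqF.
have : d * A <= e / 8 by rewrite -hd ler_wpM2l// ?(ltW d0)// lerDl.
rewrite mulr2n; lra.
Qed.

Lemma sqL2normD_fin D a b : measurable D -> cmeasurable D a -> cmeasurable D b ->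
  (sqL2norm D a < +oo)%E -> (sqL2norm D b < +oo)%E ->
  (sqL2norm D (fun t => a t + b t)%R < +oo)%E.
Proof.
move=> mD ma mb ha hb.
apply: (@le_lt_trans _ _ (\int[leb]_(t in D) (2%:E * (cabs (a t) ^+ 2)%:E + 2%:E * (cabs (b t) ^+ 2)%:E))%E).
  rewrite sqL2normE; apply: ge0_le_integral => //.
  - by move=> t _; rewrite lee_fin sqr_ge0.
  - by apply: measurable_sqr_cabs; exact: cmeasurableD.
  - by apply: emeasurable_funD; apply: emeasurable_funM;
      do ?[exact: measurable_cst|exact: measurable_sqr_cabs].
  - move=> t _; rewrite -!EFinM -EFinD lee_fin.
    apply: (@le_trans _ _ ((cabs (a t) + cabs (b t)) ^+ 2)).
      by rewrite lerXn2r ?nnegrE ?addr_ge0 ?cabs_ge0// cabsD.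
    by have := sqr_ge0 (cabs (a t) - cabs (b t)); nra.
rewrite ge0_integralD//; do ?[by move=> t _; rewrite mule_ge0// lee_fin ?sqr_ge0
  | by apply: emeasurable_funM; do ?[exact: measurable_cst|exact: measurable_sqr_cabs]].
rewrite !ge0_integralZl//; do ?[exact: measurable_sqr_cabs
  | by move=> t _; rewrite lee_fin sqr_ge0].
by rewrite -!sqL2normE lte_add_pinfty// lte_mul_pinfty.
Qed.

End L2Pairing.

(** * Mellin transforms defined as L^2-limits *)

Section IsMellin.
Variable R : realType.
Local Notation leb := (@lebesgue_measure R).
Implicit Types (f h F phi : R -> R[i]) (u t tau p : R).

Let Pos : set R := `]0, +oo[%classic.

Let mPos : measurable Pos. Proof. exact: measurable_itv. Qed.

(** Elements of K are specified, and measurable, on ]0, oo[ only. Extension by 0 brings them into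
    the setting of [mellin], where integrals run over the whole line. *)
Definition zext f t : R[i] := if 0 < t then f t else 0.

Lemma zext_indic f : zext f = fun t => f t * (\1_Pos t)%:C.
Proof.
apply/funext => t; rewrite /zext indicE mem_setE in_itv /= andbT.
by case: ifPn => _; rewrite ?mulr1 ?mulr0.
Qed.

Lemma cmeasurable_zext f : cmeasurable Pos f -> cmeasurable setT (zext f).
Proof.
have key (g : R -> R) : measurable_fun Pos g -> measurable_fun setT (fun t => if 0 < t then g t else 0).
  move=> /(@measurable_restrictT _ _ (measurableTypeR R) _ _ g mPos); apply: eq_measurable_fun => t _.
  by rewrite patchE mem_setE in_itv /= andbT.
case=> rf jf; split; rewrite /zext.
  by under eq_fun do rewrite (fun_if (@complex.Re R)); exact: key.
by under eq_fun do rewrite (fun_if (@complex.Im R)); exact: key.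
Qed.

Lemma zext_le0 f t : t <= 0 -> zext f t = 0.
Proof. by rewrite /zext ltNge => ->. Qed.

Lemma cint_zext f : cint leb Pos f = cint leb setT (zext f).
Proof. by rewrite cint_indic// zext_indic. Qed.

Lemma sqL2norm_zext f : sqL2norm Pos f = sqL2norm setT (zext f).
Proof.
rewrite !sqL2normE integral_mkcond; apply: eq_integral => t _.
rewrite patchE /zext mem_setE in_itv /= andbT.
by case: ifPn => // _; rewrite cabs0 expr0n.
Qed.

Lemma sqL2norm_half_bounded phi : mellin_class 2^-1 phi -> half_bounded phi ->
  (sqL2norm setT phi < +oo)%E.
Proof.
move=> [mp p0 Ip] [B hB].
have B0 : 0 <= B.
  have := le_trans (cabs_ge0 _) (hB 1 ltr01).
  by rewrite ln1 mulr0 oppr0 expR0 mulr1.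
apply: (@le_lt_trans _ _ (\int[leb]_t (B%:E * (cabs (phi t) * expR ((2^-1 - 1) * ln t))%:E))%E).
  rewrite sqL2normE; apply: ge0_le_integral => //.
  - by move=> t _; rewrite lee_fin sqr_ge0.
  - exact: measurable_sqr_cabs.
  - apply: emeasurable_funM; first exact: measurable_cst.
    apply/measurable_EFinP; apply: measurable_funM; first exact: measurable_cabs.
    exact: measurable_mellin_weight.
  - move=> t _; rewrite -EFinM lee_fin; have [t0|t0] := leP t 0.
      by rewrite p0// cabs0 expr0n mul0r mulr0.
    rewrite expr2 mulrCA ler_wpM2l ?cabs_ge0// -mh_weight; exact: hB.
rewrite ge0_integralZl//; do ?[by move=> t _; rewrite lee_fin mulr_ge0 ?cabs_ge0 ?expR_ge0].
  by apply: lte_mul_pinfty.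
apply/measurable_EFinP; apply: measurable_funM; first exact: measurable_cabs.
exact: measurable_mellin_weight.
Qed.

Definition truncf h n t : R[i] := zext h t * (\1_(trunc_itv n) t)%:C.

(** On the truncation interval |h| t^(-1/2) <= |h|^2 + 1 / t, and 1 / t <= n + 1 there. *)
Lemma mellin_class_truncf h n : L2 Pos h -> mellin_class 2^-1 (truncf h n).
Proof.
move=> [rh jh hh]; have mz := cmeasurable_zext (conj rh jh).
have mI : measurable (trunc_itv n : set R) by exact: measurable_itv.
have mt : cmeasurable setT (truncf h n).
  by apply: cmeasurableM => //; exact: cmeasurable_indic.
split => //; first by move=> t t0; rewrite /truncf zext_le0// mul0r.
rewrite sqL2norm_zext in hh.
apply: (@le_lt_trans _ _ (\int[leb]_t ((cabs (zext h t) ^+ 2)%:E + n.+1%:R%:E * (\1_(trunc_itv n) t)%:E))%E).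
  apply: ge0_le_integral => //.
  - by move=> t _; rewrite lee_fin mulr_ge0 ?cabs_ge0 ?expR_ge0.
  - apply/measurable_EFinP; apply: measurable_funM; first exact: measurable_cabs.
    exact: measurable_mellin_weight.
  - apply: emeasurable_funD; first exact: measurable_sqr_cabs.
    apply: emeasurable_funM; first exact: measurable_cst.
    by apply/measurable_EFinP; exact: measurable_indic.
  - move=> t _; rewrite -EFinM -EFinD lee_fin /truncf Normc.normcM cabs_real indicE.
    case: (boolP (t \in trunc_itv n)) => [|_]; last first.
      by rewrite normr0 mulr0 mul0r mulr0 addr0 sqr_ge0.
    rewrite mem_setE in_itv /= => /andP[t1 t2]; rewrite normr1 !mulr1.
    have t0 : 0 < t by apply: lt_le_trans t1; rewrite invr_gt0.
    have := AMGM (cabs (zext h t)) (expR ((2^-1 - 1) * ln t)) ltr01.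
    rewrite invr1 !mul1r => /le_trans; apply; rewrite lerD2l.
    rewrite -expRM_natl (_ : _ * _ = - ln t); last by rewrite -mulr_natl; field.
    by rewrite expRN lnK// -[leRHS]invrK lef_pV2 ?posrE ?invr_gt0.
rewrite ge0_integralD//; do ?[by move=> t _; rewrite ?mule_ge0// lee_fin ?sqr_ge0 ?indic_ge0].
- rewrite -sqL2normE ge0_integralZl//; last by apply/measurable_EFinP; exact: measurable_indic.
  rewrite integral_indic// setIT /= /trunc_itv lebesgue_measure_itv /= lte_fin.
  apply: lte_add_pinfty => //; case: ifP => _; last by rewrite mule0.
  by rewrite -EFinB -EFinM ltry.
- exact: measurable_sqr_cabs.
- apply: emeasurable_funM; first exact: measurable_cst.
  by apply/measurable_EFinP; exact: measurable_indic.
Qed.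

Lemma mellin_truncf h n tau : mellin (truncf h n) (line tau) =
  cintegral `[n.+1%:R^-1, n.+1%:R] (fun t => h t * cpow t (line tau - 1)).
Proof.
have mI : measurable (trunc_itv n : set R) by exact: measurable_itv.
rewrite -[RHS]/(cint leb (trunc_itv n) (fun t => h t * cpow t (line tau - 1))) cint_indic//.
apply: eq_cint => t _; rewrite /truncf indicE.
case: (boolP (t \in trunc_itv n)) => [|_]; last by rewrite !mulr0 mul0r.
by rewrite inE => /trunc_itv_pos t0; rewrite /zext t0 !mulr1.
Qed.

(** [mellin_parseval] holds for the truncations of [h], and both sides converge: on the line by L^2
    convergence of the truncated transforms to [F], on ]0, oo[ by exhaustion of an integrable
    function. *)
Theorem mellin_pairing phi h F p : mellin_class 2^-1 phi -> half_bounded phi ->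
  (forall u, 0 < u -> u <> p -> phi t @[t --> u] --> (phi u : R[i]^o)) ->
  is_mellin h F ->
  cint leb setT (fun tau => mellin phi (line tau) * conjc (F tau)) =
    (2 * pi)%:C * inner phi h.
Proof.
move=> L hb cphi [Lh [rF jF hF] hlim]; have [mp p0 _] := L.
have mF : cmeasurable setT F by split.
have mM := cmeasurable_mellin_line mp.
have hM := sqL2norm_mellin_half_bounded L hb.
have hp := sqL2norm_half_bounded L hb.
have Lt n := mellin_class_truncf n Lh.
have mt n : cmeasurable setT (fun tau => mellin (truncf h n) (line tau)).
  by apply: cmeasurable_mellin_line; have [] := Lt n.
have mz : cmeasurable setT (zext h) by case: Lh => rh jh _; exact: cmeasurable_zext.
have hz : (sqL2norm setT (zext h) < +oo)%E by rewrite -sqL2norm_zext; case: Lh.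
pose b_ n tau := mellin (truncf h n) (line tau) - F tau.
have hlim' : sqL2norm setT (b_ n) @[n --> \oo] --> 0%E.
  apply: cvg_trans hlim; apply: near_eq_cvg; apply: nearW => n; congr sqL2norm.
  by apply/funext => tau; rewrite /b_ mellin_truncf.
have mb n : cmeasurable setT (b_ n) by exact: cmeasurableB.
have c0 : cint leb setT (fun tau => mellin phi (line tau) * conjc (b_ n tau)) @[n --> \oo] --> (0 : R[i]^o).
  by apply: (pairing_cvg0 _ mM hM _ hlim') => //; exact: nearW.
have c1 : cint leb setT (fun tau => mellin phi (line tau) * conjc (mellin (truncf h n) (line tau)))
    @[n --> \oo] --> (cint leb setT (fun tau => mellin phi (line tau) * conjc (F tau)) : R[i]^o).
  suff : cint leb setT (fun tau => mellin phi (line tau) * conjc (mellin (truncf h n) (line tau))) -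
      cint leb setT (fun tau => mellin phi (line tau) * conjc (F tau)) @[n --> \oo] --> (0 : R[i]^o).
    by move=> /cvgC_cabs hh; apply/cvgC_cabs; move: hh; under eq_fun do rewrite subr0.
  apply: cvg_trans c0; apply: near_eq_cvg; near=> n.
  (* Square integrability of a truncated transform is drawn from its finite distance to [F], which
     the limit grants for large [n] only. *)
  have hn : (sqL2norm setT (b_ n) < 1%:E)%E by near: n; exact: (cvg0_ereal_lt hlim' ltr01).
  have hfn : (sqL2norm setT (fun tau => mellin (truncf h n) (line tau)) < +oo)%E.
    have := sqL2normD_fin measurableT (mb n) mF (lt_trans hn (ltry _)) hF.
    by rewrite (_ : (fun t => b_ n t + F t) = fun tau => mellin (truncf h n) (line tau))//;
      apply/funext => tau; rewrite /b_ subrK.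
  rewrite -cintB//; last 2 first.
  - exact: (cintegrable_pairing measurableT mM (mt n) hM hfn).
  - exact: (cintegrable_pairing measurableT mM mF hM hF).
  by apply: eq_cint => tau _; rewrite /b_ rmorphB mulrBr.
have iz : cintegrable leb setT (fun t => phi t * conjc (zext h t)).
  exact: (cintegrable_pairing measurableT mp mz hp hz).
have c2 : cint leb setT (fun t => phi t * conjc (truncf h n t)) @[n --> \oo] -->
    (cint leb setT (fun t => phi t * conjc (zext h t)) : R[i]^o).
  have := cvg_cint_trunc iz; rewrite (_ : (fun n => cint leb (trunc_itv n)
    (fun t => phi t * conjc (zext h t))) = (fun n => cint leb setT (fun t => phi t * conjc (truncf h n t)))).
    by apply => t t0; rewrite p0// mul0r.
  apply/funext => n; rewrite cint_indic; last exact: measurable_itv.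
  by apply: eq_cint => t _; rewrite /truncf rmorphM mulrA; congr (_ * _); rewrite /= oppr0.
have -> : inner phi h = cint leb setT (fun t => phi t * conjc (zext h t)).
  rewrite -[LHS]/(cint leb Pos (fun t => phi t * conjc (h t))) cint_zext.
  apply: eq_cint => t _; rewrite /zext; case: ifP => // _.
  by rewrite rmorph0 mulr0.
apply: (cvgC_unique c1).
suff h2 : (2 * pi)%:C * cint leb setT (fun t => phi t * conjc (truncf h n t)) @[n --> \oo] -->
    ((2 * pi)%:C * cint leb setT (fun t => phi t * conjc (zext h t)) : R[i]^o).
  apply: (cvg_trans _ h2); apply: near_eq_cvg; near=> n.
  have hn : (sqL2norm setT (b_ n) < 1%:E)%E by near: n; exact: (cvg0_ereal_lt hlim' ltr01).
  have hfn : (sqL2norm setT (fun tau => mellin (truncf h n) (line tau)) < +oo)%E.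
    have := sqL2normD_fin measurableT (mb n) mF (lt_trans hn (ltry _)) hF.
    by rewrite (_ : (fun t => b_ n t + F t) = fun tau => mellin (truncf h n) (line tau))//;
      apply/funext => tau; rewrite /b_ subrK.
  apply/esym; apply: (mellin_parseval L hb cphi (Lt n)).
  exact: (cintegrable_pairing measurableT mM (mt n) hM hfn).
by apply: cvgCZ; exact: c2.
Unshelve. all: by end_near.
Qed.

(** The truncated integrals converge to [mellin f] pointwise and to [F] in L^2; by Fatou's lemma the
    squared distance of the two limits has integral 0. *)
Lemma is_mellin_ae f F : mellin_class 2^-1 f -> is_mellin f F ->
  {ae leb, forall tau, F tau = mellin f (line tau)}.
Proof.
move=> L [Lf [rF jF hF] hlim]; have [mf f0 _] := L.
have mF : cmeasurable setT F by split.
have Lt n := mellin_class_truncf n Lf.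
have mt n : cmeasurable setT (fun tau => mellin (truncf f n) (line tau)).
  by apply: cmeasurable_mellin_line; have [] := Lt n.
pose b_ n tau := mellin (truncf f n) (line tau) - F tau.
have mb n : cmeasurable setT (b_ n) by exact: cmeasurableB.
have hlim' : sqL2norm setT (b_ n) @[n --> \oo] --> 0%E.
  apply: cvg_trans hlim; apply: near_eq_cvg; apply: nearW => n; congr sqL2norm.
  by apply/funext => tau; rewrite /b_ mellin_truncf.
have pt tau : (cabs (b_ n tau) ^+ 2)%:E @[n --> \oo] -->
    ((cabs (mellin f (line tau) - F tau)) ^+ 2)%:E%E.
  have c : mellin (truncf f n) (line tau) @[n --> \oo] --> (mellin f (line tau) : R[i]^o).
    have := cvg_cint_trunc (cintegrable_mellin L (Re_line tau)).
    rewrite (_ : (fun n => cint leb (trunc_itv n) (fun t => f t * cpow t (line tau - 1))) =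
      fun n => mellin (truncf f n) (line tau)).
      by apply => t t0; rewrite f0// mul0r.
    by apply/funext => n; rewrite mellin_truncf.
  apply: cvg_EFin; first exact: nearW.
  have cb : mellin (truncf f n) (line tau) - F tau @[n --> \oo] -->
      (mellin f (line tau) - F tau : R[i]^o).
    by apply: cvgCB; [exact: c|exact: cvgC_cst].
  move/cvgC_ReIm: cb => [cr ci].
  rewrite sqr_cabs; under eq_fun do rewrite /= sqr_cabs.
  apply: cvgD; rewrite expr2; under eq_fun do rewrite expr2.
    exact: cvgM.
  exact: cvgM.
have mfn n : measurable_fun setT (fun tau => (cabs (b_ n tau) ^+ 2)%:E).
  exact: measurable_sqr_cabs.
have := @fatou _ _ R leb setT measurableT (fun n tau => (cabs (b_ n tau) ^+ 2)%:E) mfn.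
have mfl : cmeasurable setT (fun tau => mellin f (line tau) - F tau).
  by apply: cmeasurableB => //; exact: cmeasurable_mellin_line.
have lim0 : limn_einf (fun n => \int[leb]_tau (cabs (b_ n tau) ^+ 2)%:E)%E = 0%E.
  apply: (cvg_limn_einf_sup _).1.
  by move: hlim'; under eq_fun do rewrite sqL2normE.
rewrite lim0 => fat.
have {}fat : (\int[leb]_tau (cabs (mellin f (line tau) - F tau) ^+ 2)%:E <= 0)%E.
  apply: le_trans (fat _); last by move=> n tau; rewrite lee_fin sqr_ge0.
  rewrite le_eqVlt; apply/orP; left; apply/eqP; apply: eq_integral => tau _.
  by apply/esym; apply: (cvg_limn_einf_sup _).1; exact: pt.
have z : (\int[leb]_tau `|(cabs (mellin f (line tau) - F tau) ^+ 2)%:E| = 0)%E.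
  apply/eqP; rewrite eq_le; apply/andP; split; last by apply: integral_ge0.
  by under eq_integral do rewrite abse_EFin ger0_norm ?sqr_ge0//.
have /(ae_eq_integral_abs _ measurableT) h := z.
have {}h := h (measurable_sqr_cabs mfl).
apply: ae_imp h => tau /(_ Logic.I) [] /eqP.
by rewrite sqrf_eq0 cabs_eq0 subr_eq0 => /eqP.
Qed.

End IsMellin.

(** * Analytic functions *)

Section Analytic.
Variable R : realType.
Implicit Types (f g : R[i] -> R[i]) (s h z w : R[i]) (a b : nat -> R[i]) (r A B : R).

Lemma nbhsC (P : set R[i]) s : (\forall z \near (s : R[i]^o), P z) <->
  exists2 r : R, 0 < r & forall z, cabs (z - s) < r -> P z.
Proof.
split=> [/nbhs_ballP[[e e'] /=]|[r r0 hr]].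
  rewrite ltcE /= => /andP[/eqP -> e0] he; exists e => // z zr; apply: he.
  by rewrite -ball_normE /= normC_cabs ltcE /= eqxx /= cabs_dist.
apply/nbhs_ballP; exists r%:C; first by rewrite /= ltcR.
by move=> z; rewrite -ball_normE /= normC_cabs ltcR cabs_dist; exact: hr.
Qed.

Lemma cvgC_eq (u v : nat -> R[i]) (l : R[i]) :
  (forall n, u n = v n) -> u @ \oo --> (l : R[i]^o) -> v @ \oo --> (l : R[i]^o).
Proof. by move=> /funext ->. Qed.

Lemma cvgC_stationary N (u : nat -> R[i]) (l : R[i]) :
  (forall n, (N <= n)%N -> u n = l) -> u @ \oo --> (l : R[i]^o).
Proof.
move=> ul; apply/cvgC_cabs; apply: (@cvg_trans _ ((fun=> 0 : R) @ \oo)); last exact: cvg_cst.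
by apply: near_eq_cvg; exists N => // n /= /ul ->; rewrite subrr cabs0.
Qed.

Lemma cvgC_seqD (u v : nat -> R[i]) (l m : R[i]) :
  u @ \oo --> (l : R[i]^o) -> v @ \oo --> (m : R[i]^o) ->
  (fun n => u n + v n) @ \oo --> (l + m : R[i]^o).
Proof. by move=> ul vm; apply: cvgCD; [exact: ul|exact: vm]. Qed.

Lemma cvgC_seqB (u v : nat -> R[i]) (l m : R[i]) :
  u @ \oo --> (l : R[i]^o) -> v @ \oo --> (m : R[i]^o) ->
  (fun n => u n - v n) @ \oo --> (l - m : R[i]^o).
Proof. by move=> ul vm; apply: cvgCB; [exact: ul|exact: vm]. Qed.

Lemma cvgC_seqM (u v : nat -> R[i]) (l m : R[i]) :
  u @ \oo --> (l : R[i]^o) -> v @ \oo --> (m : R[i]^o) ->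
  (fun n => u n * v n) @ \oo --> (l * m : R[i]^o).
Proof. by move=> ul vm; apply: cvgCM; [exact: ul|exact: vm]. Qed.

Lemma cabs_lim_le (u : nat -> R[i]) (l : R[i]) B : u @ \oo --> (l : R[i]^o) ->
  (\forall n \near \oo, cabs (u n) <= B) -> cabs l <= B.
Proof.
move=> /cvgC_cabs /(@cvgrPdist_lt _ R^o) h hB; apply/ler_addgt0Pr => e /h he.
have [n [/= hn Bn]] := filter_ex (filterI he hB).
rewrite -(subKr (u n) l) (le_trans (cabsB _ _))// lerD//.
by rewrite sub0r normrN ger0_norm ?cabs_ge0// in hn; exact: ltW.
Qed.

Definition psum a h N : R[i] := \sum_(k < N) a k * h ^+ k.

Lemma series_psum a h : series (fun n => a n * h ^+ n : R[i]^o) = psum a h.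
Proof. by apply/funext => N; rewrite /series /= big_mkord. Qed.

Lemma psumS a h N : psum a h N.+1 = psum a h N + a N * h ^+ N.
Proof. by rewrite /psum big_ord_recr. Qed.

Lemma cvg_psum_shift a h l : psum a h @ \oo --> (l : R[i]^o) ->
  (fun N => psum a h N.+1) @ \oo --> (l : R[i]^o).
Proof. by move=> ha; rewrite (@cvg_shiftS R[i]^o (psum a h)). Qed.

Lemma cvg_cabs0_bounded a : a @ \oo --> (0 : R[i]^o) -> exists A, forall n, cabs (a n) <= A.
Proof.
move=> /cvgC_cabs /(@cvgrPdist_lt _ R^o) /(_ _ ltr01)[N _ hN].
exists (1 + \sum_(k < N) cabs (a k)) => n; have [Nn|nN] := leqP N n.
  have /= := hN n Nn; rewrite subr0 sub0r normrN ger0_norm ?cabs_ge0// => h1.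
  by rewrite (le_trans (ltW h1))// lerDl sumr_ge0// => k _; rewrite cabs_ge0.
rewrite (bigD1 (Ordinal nN))//= addrCA lerDl addr_ge0// sumr_ge0// => k _.
exact: cabs_ge0.
Qed.

Definition power_rep f s a r A := [/\ 0 < r, forall n, cabs (a n) * r ^+ n <= A &
  forall h, cabs h < r -> psum a h @ \oo --> (f (s + h) : R[i]^o)].

(** At a real increment of half the radius the terms of the convergent series tend to 0, hence are
    bounded. This yields the coefficient bound on the halved radius, which is all that later
    estimates use. *)
Lemma analyticP f s : analytic_at f s <-> exists a r A, power_rep f s a r A.
Proof.
split=> [[a /nbhsC[r r0 hr]]|[a [r [A [r0 _ hr]]]]]; last first.
  exists a; apply/nbhsC; exists r => // z /hr; rewrite series_psum.
  by rewrite subrKC.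
have hr' h : cabs h < r -> psum a h @ \oo --> (f (s + h) : R[i]^o).
  by move=> hr1; have := hr (s + h); rewrite (addrC s) addrK series_psum; exact.
have q0 : 0 < r / 2 by rewrite divr_gt0.
have c : psum a (r / 2)%:C @ \oo --> (f (s + (r / 2)%:C) : R[i]^o).
  by apply: hr'; rewrite cabs_real gtr0_norm//; lra.
have c0 : (fun n => a n * (r / 2)%:C ^+ n) @ \oo --> (0 : R[i]^o).
  rewrite -(subrr (f (s + (r / 2)%:C))); apply: cvgC_eq (cvgC_seqB (cvg_psum_shift c) c) => n.
  by rewrite psumS addrAC subrr add0r.
have [A hA] := cvg_cabs0_bounded c0.
exists a, (r / 2), A; split; [exact: q0|move=> n|move=> h hr1; apply: hr'; lra].
by have := hA n; rewrite Normc.normcM cabsX cabs_real (gtr0_norm q0).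
Qed.

Lemma power_rep_le f s a r r' A : power_rep f s a r A -> 0 < r' <= r -> power_rep f s a r' A.
Proof.
move=> [r0 ha hr] /andP[r'0 rr]; split => // [n|h hh]; last exact: hr (lt_le_trans hh rr).
apply: le_trans (ha n); rewrite ler_wpM2l ?cabs_ge0//.
by apply: lerXn2r => //; rewrite nnegrE ltW.
Qed.

Lemma analytic_at_near f g s : (\forall z \near (s : R[i]^o), f z = g z) ->
  analytic_at f s -> analytic_at g s.
Proof. by move=> fg [a ha]; exists a; apply: filterS2 fg ha => z <-. Qed.

Lemma analyticD f g s : analytic_at f s -> analytic_at g s -> analytic_at (fun z => f z + g z) s.
Proof.
move=> [a ha] [b hb]; exists (fun n => a n + b n); apply: filterS2 ha hb => z.
rewrite !series_psum => ha hb; apply: cvgC_eq (cvgC_seqD ha hb) => N.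
by rewrite /psum -big_split; apply: eq_bigr => k _; rewrite mulrDl.
Qed.

Lemma analytic_cst (c : R[i]) s : analytic_at (fun=> c) s.
Proof.
exists (fun n => if n == 0%N then c else 0); apply/nbhsC; exists 1 => // z _; rewrite series_psum.
apply: (@cvgC_stationary 1) => -[//|N] _; rewrite /psum big_ord_recl big1 ?addr0 ?expr0 ?mulr1//.
by move=> k _; rewrite mul0r.
Qed.

Lemma analytic_id s : analytic_at id s.
Proof.
exists (fun n => if n == 0%N then s else if n == 1%N then 1 else 0); apply/nbhsC; exists 1 => // z _.
rewrite series_psum; apply: (@cvgC_stationary 2) => -[//|[//|N]] _; rewrite /psum 2!big_ord_recl big1 /=.
  by rewrite expr0 mulr1 mul1r expr1 addr0 addrC subrK.
by move=> k _; rewrite mul0r.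
Qed.

Lemma analytic_sub1 f s : analytic_at f (1 - s) -> analytic_at (fun z => f (1 - z)) s.
Proof.
move=> /analyticP[a [r [A [r0 _ hr]]]]; exists (fun n => a n * (-1) ^+ n).
apply/nbhsC; exists r => // z zr; rewrite series_psum.
have := hr (- (z - s)); rewrite cabsN => /(_ zr).
rewrite (_ : psum a (- (z - s)) = psum (fun n => a n * (-1) ^+ n) (z - s)); last first.
  by apply/funext => N; apply: eq_bigr => k _; rewrite -mulrA -exprMn mulN1r.
by rewrite (_ : 1 - s + _ = 1 - z)//; ring.
Qed.

(* The two truncated series are multiplied as polynomials; only the coefficients
   of degree between [N] and [2 N] contribute to the difference. *)
Lemma cauchy_product_tail a b h r A B N : 0 < r -> 0 <= A -> 0 <= B ->
  (forall n, cabs (a n) * r ^+ n <= A) -> (forall n, cabs (b n) * r ^+ n <= B) ->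
  8 * cabs h <= r ->
  cabs (psum a h N * psum b h N - psum (fun n => \sum_(j < n.+1) a j * b (n - j)%N) h N)
    <= 2 * A * B * 2^-1 ^+ N.
Proof.
move=> r0 A0 B0 ha hb hr.
pose P := \poly_(i < N) a i; pose Q := \poly_(i < N) b i.
have hQ i : cabs Q`_i * r ^+ i <= B.
  rewrite coef_poly; case: ifP => _; first exact: hb.
  by rewrite cabs0 mul0r.
have hP i : cabs P`_i * r ^+ i <= A.
  rewrite coef_poly; case: ifP => _; first exact: ha.
  by rewrite cabs0 mul0r.
have -> : psum a h N * psum b h N = (P * Q).[h] by rewrite hornerM !horner_poly.
have sz : (size (P * Q)%R <= N + N)%N.
  apply: (leq_trans (size_polyMleq P Q)); apply: (leq_trans (leq_pred _)).
  by apply: leq_add; exact: size_poly.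
rewrite (horner_coef_wide _ sz) big_split_ord /=.
have -> : \sum_(i < N) (P * Q)`_i * h ^+ i = psum (fun n => \sum_(j < n.+1) a j * b (n - j)%N) h N.
  apply: eq_bigr => i _; congr (_ * _); rewrite coefM; apply: eq_bigr => j _.
  rewrite !coef_poly (leq_ltn_trans (leq_subr _ _) (ltn_ord i)).
  by rewrite (leq_ltn_trans _ (ltn_ord i))// -ltnS.
rewrite addrAC subrr add0r.
have hc (i : nat) : cabs (P * Q)`_i * r ^+ i <= i.+1%:R * (A * B).
  rewrite coefM; apply: (@le_trans _ _ (\sum_(j < i.+1) (cabs P`_j * r ^+ j) * (cabs Q`_(i - j) * r ^+ (i - j)))).
    apply: (@le_trans _ _ ((\sum_(j < i.+1) cabs (P`_j * Q`_(i - j))) * r ^+ i)).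
      by rewrite ler_wpM2r ?exprn_ge0 ?(ltW r0)// cabs_sum.
    rewrite mulr_suml ler_sum// => j _; rewrite Normc.normcM mulrACA -exprD subnKC//.
    by rewrite -ltnS.
  apply: (@le_trans _ _ (\sum_(j < i.+1) A * B)).
    apply: ler_sum => j _; apply: ler_pM => //; by rewrite mulr_ge0 ?cabs_ge0 ?exprn_ge0 ?(ltW r0).
  by rewrite sumr_const card_ord mulr_natl.
apply: (le_trans (cabs_sum _ _ _)).
have N2 : N%:R <= (2 : R) ^+ N by rewrite -natrX ler_nat ltnW// ltn_expl.
(* The coefficient of degree N + i costs N + i + 1 <= 2 N <= 2 * 2^N and there are N <= 2^N of them,
   about 4^N in all; the ratio |h| / r <= 1/8 leaves 2^-N. This is why the radius is divided by
   8. *)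
apply: (@le_trans _ _ (\sum_(i < N) 2 * 2 ^+ N * (A * B) * 8^-1 ^+ N)).
  apply: ler_sum => i _; rewrite Normc.normcM cabsX.
  apply: (@le_trans _ _ (cabs (P * Q)`_(N + i) * (r ^+ (N + i) * 8^-1 ^+ (N + i)))).
    rewrite ler_wpM2l ?cabs_ge0// -exprMn; apply: lerXn2r; rewrite ?nnegrE ?cabs_ge0//.
      by rewrite divr_ge0// ltW.
    by rewrite ler_pdivlMr// mulrC.
  rewrite [leLHS]mulrA; apply: ler_pM.
  - by rewrite mulr_ge0 ?cabs_ge0// exprn_ge0// ltW.
  - by rewrite exprn_ge0.
  - apply: (le_trans (hc _)); rewrite ler_wpM2r ?mulr_ge0//.
    apply: (@le_trans _ _ (2 * N%:R)); last by rewrite ler_wpM2l.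
    by rewrite -natrM ler_nat mul2n -addnn -addnS leq_add2l.
  - by rewrite exprD ler_piMr ?exprn_ge0// exprn_ile1// invf_le1 ?ler1n.
rewrite sumr_const card_ord -[leLHS]mulr_natl.
apply: (@le_trans _ _ (2 ^+ N * (2 * 2 ^+ N * (A * B) * 8^-1 ^+ N))).
  by rewrite ler_wpM2r// !mulr_ge0// ?exprn_ge0.
rewrite le_eqVlt; apply/orP; left; apply/eqP.
rewrite (_ : 8^-1 = 2^-1 * 2^-1 * 2^-1 :> R); last by field.
rewrite !exprMn !exprVn; field; by rewrite expf_neq0.
Qed.

Lemma cauchy_product a b h r A B l m : 0 < r ->
  (forall n, cabs (a n) * r ^+ n <= A) -> (forall n, cabs (b n) * r ^+ n <= B) ->
  8 * cabs h <= r ->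
  psum a h @ \oo --> (l : R[i]^o) -> psum b h @ \oo --> (m : R[i]^o) ->
  psum (fun n => \sum_(j < n.+1) a j * b (n - j)%N) h @ \oo --> (l * m : R[i]^o).
Proof.
move=> r0 ha hb hr hl hm; set c := fun n => _.
have A0 : 0 <= A by rewrite (le_trans _ (ha 0%N))// mulr_ge0 ?cabs_ge0// exprn_ge0// ltW.
have B0 : 0 <= B by rewrite (le_trans _ (hb 0%N))// mulr_ge0 ?cabs_ge0// exprn_ge0// ltW.
have d0 : (fun N => psum a h N * psum b h N - psum c h N) @ \oo --> (0 : R[i]^o).
  apply/cvgC_cabs; apply: (@squeeze_cvgr _ _ _ _ (cst 0) (fun N => 2 * A * B * 2^-1 ^+ N)).
  - by apply: nearW => N /=; rewrite subr0 cabs_ge0 /=; exact: (cauchy_product_tail N r0 A0 B0 ha hb hr).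
  - exact: cvg_cst.
  - rewrite -[X in _ --> X](mulr0 (2 * A * B)); apply: cvgMr; apply: cvg_expr.
    by rewrite ger0_norm// invf_lt1// ltr1n.
rewrite -(subr0 (l * m)); apply: cvgC_eq (cvgC_seqB (cvgC_seqM hl hm) d0) => N.
by rewrite subKr.
Qed.

Lemma analyticM f g s : analytic_at f s -> analytic_at g s -> analytic_at (fun z => f z * g z) s.
Proof.
move=> /analyticP[a [r [A hf]]] /analyticP[b [r' [B hg]]].
have [r0 _ _] := hf; have [r'0 _ _] := hg.
have m0 : 0 < Num.min r r' by rewrite lt_min r0.
have [_ ha fa] : power_rep f s a (Num.min r r') A by apply: power_rep_le hf _; rewrite m0 ge_min lexx.
have [_ hb gb] : power_rep g s b (Num.min r r') B by apply: power_rep_le hg _; rewrite m0 ge_min lexx orbT.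
exists (fun n => \sum_(j < n.+1) a j * b (n - j)%N).
apply/nbhsC; exists (Num.min r r' / 8); first by rewrite divr_gt0.
move=> z zr; rewrite series_psum.
have zm : cabs (z - s) < Num.min r r' by apply: (lt_le_trans zr); rewrite ler_pdivrMr//; lra.
apply: (cauchy_product m0 ha hb); first by rewrite ltr_pdivlMr// in zr; lra.
  by have := fa _ zm; rewrite subrKC.
by have := gb _ zm; rewrite subrKC.
Qed.

Lemma sum_geo_half q m N : 0 <= q <= 2^-1 -> \sum_(m <= n < N) q ^+ n <= 2 * q ^+ m :> R.
Proof.
move=> /andP[q0 q1]; have [mN|Nm] := leqP m N; last first.
  by rewrite big_geq ?(ltnW Nm)// mulr_ge0// exprn_ge0.
rewrite -(subnK mN); elim: (N - m)%N => [|k ih]; first by rewrite add0n big_geq// mulr_ge0// exprn_ge0.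
suff h j : \sum_(m <= n < j + m) q ^+ n <= (2 - 2 * q ^+ j) * q ^+ m.
  apply: (le_trans (h _)); rewrite ler_wpM2r ?exprn_ge0//.
  by rewrite gerBl mulr_ge0// exprn_ge0.
elim: j => [|j ihj]; first by rewrite add0n big_geq// expr0 mulr1 subrr mul0r.
rewrite addSn big_nat_recr ?leq_addl//=.
apply: (le_trans (lerD ihj (lexx _))); rewrite exprD exprS -mulrDl ler_wpM2r ?exprn_ge0//.
have : 0 <= q ^+ j by rewrite exprn_ge0.
nra.
Qed.

(** If some coefficient is nonzero, the first such term dominates the tail of the series close to
    [s], so [f] cannot vanish there except possibly at [s]. *)
Lemma analytic_isolated f s : analytic_at f s ->
  (exists2 r, 0 < r & forall z, cabs (z - s) < r -> f z = 0) \/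
  (exists2 r, 0 < r & forall z, 0 < cabs (z - s) < r -> f z != 0).
Proof.
move=> /analyticP[a [r [A [r0 ha hr]]]].
have [az|/existsNP/cid[n0 /eqP an0]] := pselect (forall n, a n = 0).
  left; exists r => // z zr; have c := hr _ zr.
  have {c} : psum a (z - s) @ \oo --> (f z : R[i]^o) by move: c; rewrite subrKC.
  rewrite (_ : psum a (z - s) = fun=> 0); last first.
    by apply/funext => N; rewrite /psum big1// => k _; rewrite az mul0r.
  by move=> c; apply: (cvgC_unique c); exact: cvgC_cst.
right; have ex : exists n, a n != 0 by exists n0.
case: (ex_minnP ex) => m am mmin.
have A0 : 0 < A by rewrite (lt_le_trans _ (ha m))// mulr_gt0 ?cabs_gt0// exprn_gt0.
pose c := cabs (a m) * r ^+ m.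
have c0 : 0 < c by rewrite mulr_gt0 ?cabs_gt0// exprn_gt0.
(* With q = |h| / r the leading term is c q^m and the tail at most 2 A q^(m+1). The bound 1/2 serves
   the geometric sum, and c / (4 A) makes the tail less than half of the leading term. *)
pose d := Num.min 2^-1 (c / (4 * A)).
have d0 : 0 < d by rewrite lt_min invr_gt0 ltr0n/= divr_gt0// mulr_gt0.
exists (d * r); first by rewrite mulr_gt0.
move=> z /andP[z0 zr]; set h := z - s in z0 zr.
pose q := cabs h / r.
have hq : cabs h = q * r by rewrite /q divfK// gt_eqF.
have q0 : 0 < q by rewrite divr_gt0.
have qd : q < d by rewrite ltr_pdivrMr.
have q2 : q < 2^-1 by rewrite (lt_le_trans qd)// ge_min lexx.
have qc : 4 * A * q < c.
  rewrite -ltr_pdivlMl; last by rewrite mulr_gt0.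
  by rewrite mulrC (lt_le_trans qd)// ge_min lexx orbT.
have hlim : psum a h @ \oo --> (f z : R[i]^o).
  have := hr h; rewrite (_ : s + h = z); last by rewrite /h subrKC.
  apply; rewrite hq -[ltRHS]mul1r ltr_pM2r//; lra.
have bnd : \forall N \near \oo, cabs (psum a h N - a m * h ^+ m) <= 2 * A * q ^+ m.+1.
  exists m.+1 => // N /= mN.
  have -> : psum a h N - a m * h ^+ m = \sum_(m.+1 <= k < N) a k * h ^+ k.
    rewrite /psum -(big_mkord xpredT (fun k => a k * h ^+ k)) (big_cat_nat (leq0n m.+1) mN)/=.
    rewrite big_nat_recr//= big_nat big1 ?add0r 1?addrAC ?subrr ?add0r//.
    move=> k km; apply/eqP; rewrite mulf_eq0; apply/orP; left.
    by apply: contraTT km => /mmin; rewrite -ltnNge.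
  apply: (le_trans (cabs_sum _ _ _)).
  apply: (@le_trans _ _ (\sum_(m.+1 <= k < N) A * q ^+ k)).
    apply: ler_sum => k _; rewrite Normc.normcM cabsX hq exprMn mulrCA mulrC.
    by rewrite ler_wpM2r// exprn_ge0// ltW.
  rewrite -mulr_sumr mulrAC -mulrA (mulrC (q ^+ _)) mulrCA ler_wpM2l ?(ltW A0)//.
  by apply: sum_geo_half; rewrite (ltW q0) (ltW q2).
apply/negP => /eqP fz.
have cc : (fun N => psum a h N - a m * h ^+ m) @ \oo --> (f z - a m * h ^+ m : R[i]^o).
  by apply: (cvgC_seqB hlim); exact: cvgC_cst.
have : cabs (f z - a m * h ^+ m) <= 2 * A * q ^+ m.+1.
  exact: (cabs_lim_le cc bnd).
rewrite fz sub0r cabsN Normc.normcM cabsX hq exprMn exprS.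
have qm : 0 < q ^+ m by rewrite exprn_gt0.
rewrite (mulrC (q ^+ m)) mulrA -/c mulrA ler_pM2r//.
lra.
Qed.

(** Let t0 be the supremum of the parameters up to which [f] vanishes locally. Zeros accumulate at
    t0, so [analytic_isolated] makes [f] vanish around it; that neighbourhood would carry the
    property beyond t0 unless t0 = 1. *)
Lemma analytic_segment0 f s (v : R[i]) :
  (forall t : R, 0 <= t <= 1 -> analytic_at f (s + t%:C * v)) ->
  (\forall z \near (s : R[i]^o), f z = 0) ->
  \forall z \near (s + v : R[i]^o), f z = 0.
Proof.
move=> fa /nbhsC[e0 e00 fe]; have [->|v0] := eqVneq v 0.
  by rewrite addr0; apply/nbhsC; exists e0.
have cv : 0 < cabs v by rewrite cabs_gt0.
pose ev t := exists2 r, 0 < r & forall z, cabs (z - (s + t%:C * v)) < r -> f z = 0.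
have dist (t u : R) : cabs (s + t%:C * v - (s + u%:C * v)) = `|t - u| * cabs v.
  by rewrite opprD addrACA subrr add0r -mulrBl -rmorphB Normc.normcM cabs_real.
pose E := [set t : R | 0 <= t <= 1 /\ forall u, 0 <= u <= t -> ev u].
have E0 : E 0.
  split; first by rewrite lexx ler01.
  by move=> u /le_anti <-; exists e0 => // z; rewrite mul0r addr0; exact: fe.
have hE : has_sup E by split; [exists 0|exists 1 => t [/andP[]]].
set t0 := sup E.
have t00 : 0 <= t0 by apply: sup_upper_bound.
have t01 : t0 <= 1 by apply: ge_sup; [exists 0|move=> t [/andP[]]].
have below u : 0 <= u < t0 -> ev u.
  move=> /andP[u0 ut]; have [t Et] := sup_gt (ex_intro _ 0 E0) ut.
  by move=> ut'; apply: Et.2; rewrite u0 ltW.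
have evt0 : ev t0.
  have [//|[r r0 hr]] := analytic_isolated (fa t0 (introT andP (conj t00 t01))).
  have [t0z|t0p] := eqVneq t0 0; first by rewrite t0z; apply: E0.2; rewrite lexx.
  have t0gt : 0 < t0 by rewrite lt_def t0p.
  (* A parameter below t0, hence a zero of [f], whose point lies within r / 2 of the point of t0; it
     contradicts the alternative of isolated zeros. *)
  pose u := Num.max (t0 / 2) (t0 - r / (2 * cabs v)).
  have u1 : u < t0.
    rewrite gt_max; apply/andP; split; first lra.
    by rewrite ltrBlDr ltrDl divr_gt0// mulr_gt0.
  have u0 : 0 <= u by rewrite le_max divr_ge0.
  have [r' r'0 fz] := below u (introT andP (conj u0 u1)).
  have fz0 : f (s + u%:C * v) = 0 by apply: fz; rewrite subrr cabs0.
  suff /hr : 0 < cabs (s + u%:C * v - (s + t0%:C * v)) < r by rewrite fz0 eqxx.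
  rewrite dist mulr_gt0 ?normr_gt0 ?subr_eq0 ?lt_eqF//= ltr0_norm ?subr_lt0//.
  have : t0 - r / (2 * cabs v) <= u by rewrite le_max lexx orbT.
  rewrite lerBlDr addrC -lerBlDr opprB => hu.
  have hu' : t0 - u <= r / (2 * cabs v) by lra.
  rewrite (le_lt_trans (ler_wpM2r (ltW cv) hu'))// invfM mulrA divfK ?gt_eqF//.
  lra.
have [r r0 hr] := evt0.
have up u : t0 <= u < t0 + r / (2 * cabs v) -> ev u.
  move=> /andP[tu ur]; exists (r / 2); first lra.
  move=> z zu; apply: hr.
  rewrite -(subrK (s + u%:C * v) z) -addrA (le_lt_trans (cabsD _ _))//.
  rewrite dist ger0_norm ?subr_ge0//.
  have : (u - t0) * cabs v < r / 2.
    by rewrite -ltr_pdivlMr// -mulrA -invfM mulrC -(mulrC r) -[r * _]/(r / _); lra.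
  lra.
have [t0e1|t0n] := eqVneq t0 1.
  by apply/nbhsC; move: evt0; rewrite /ev t0e1 mul1r.
have t0l : t0 < 1 by rewrite lt_def eq_sym t0n.
pose t1 := Num.min 1 (t0 + r / (4 * cabs v)).
have rv : 0 < r / (4 * cabs v) by rewrite divr_gt0// mulr_gt0.
have t1t0 : t0 < t1 by rewrite lt_min t0l ltrDl rv.
suff E1 : E t1 by have := sup_upper_bound hE E1; rewrite -/t0 leNgt t1t0.
split; first by rewrite ge_min lexx (le_trans t00)// ltW.
move=> u /andP[u0 ut]; have [utt|tu] := ltP u t0; first by apply: below; rewrite u0.
apply: up; rewrite tu (le_lt_trans ut)// (@le_lt_trans _ _ (t0 + r / (4 * cabs v)))//.
  by rewrite ge_min lexx orbT.
rewrite ltrD2l ltr_pM2l// ltf_pV2 ?posrE ?mulr_gt0// ltr_pM2r//.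
by rewrite ltr_nat.
Qed.

Lemma analytic_segment f g s (v : R[i]) :
  (forall t : R, 0 <= t <= 1 -> analytic_at f (s + t%:C * v)) ->
  (forall t : R, 0 <= t <= 1 -> analytic_at g (s + t%:C * v)) ->
  (\forall z \near (s : R[i]^o), f z = g z) -> f (s + v) = g (s + v).
Proof.
move=> fa ga fg.
have fga t : 0 <= t <= 1 -> analytic_at (fun z => f z + (-1) * g z) (s + t%:C * v).
  by move=> t01; apply: analyticD (fa _ t01) _; apply: analyticM; [exact: analytic_cst|exact: ga].
have := analytic_segment0 fga; rewrite /= => /(_ _)[].
  by apply: filterS fg => z ->; rewrite mulN1r subrr.
move=> e e0 /(_ (s + v)); rewrite /ball /= => h; apply/eqP; rewrite -subr_eq0 -mulN1r h//.
by rewrite subrr normr0.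
Qed.

Lemma sum_exp_le (x : R) N : 0 <= x -> \sum_(k < N) x ^+ k / k`!%:R <= expR x.
Proof.
move=> x0; have -> : \sum_(k < N) x ^+ k / k`!%:R = series (exp_coeff x) N.
  by rewrite /series /= big_mkord.
rewrite /expR; apply: nondecreasing_cvgn_le; last exact: is_cvg_series_exp_coeff.
by apply: nondecreasing_series => n _ _; exact: exp_coeff_ge0.
Qed.

Lemma exp_coeff_le (x : R) k : 0 <= x -> x ^+ k / k`!%:R <= expR x.
Proof.
move=> x0; apply: (le_trans _ (sum_exp_le k.+1 x0)); rewrite big_ord_recr /= lerDr.
by apply: sumr_ge0 => j _; rewrite divr_ge0// exprn_ge0.
Qed.

Definition cexp z : R[i] :=
  (expR (complex.Re z))%:C * (cos (complex.Im z) +i* sin (complex.Im z)).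

(** The powers are brought into the form of [cos_coeff] and [sin_coeff], so that the exponential
    series at i y splits into the real cosine and sine series. *)
Lemma imaginary_pow (y : R) n : (0 +i* y) ^+ n =
  ((~~ odd n)%:R * (-1) ^+ n./2 * y ^+ n) +i* ((odd n)%:R * (-1) ^+ n.-1./2 * y ^+ n).
Proof.
elim: n => [|n ih].
  by rewrite expr0; apply: cplx_eqP => /=; rewrite ?expr0 ?mulr1 ?mul0r.
rewrite exprS ih; apply: cplx_eqP; rewrite ?ReM ?ImM /= mul0r ?sub0r ?addr0 ?add0r exprS.
  case on: (odd n) => /=; last by rewrite !mul0r mulr0 oppr0.
  have -> : uphalf n = n.-1./2.+1 by rewrite uphalf_half on; case: n on {ih} => // n /= on; rewrite uphalf_half (negbTE on) add0n.
  by rewrite exprS; ring.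
by case: (odd n) => /=; ring.
Qed.

Lemma cexp_imaginary (y : R) :
  (fun N => \sum_(k < N) (0 +i* y) ^+ k / k`!%:R) @ \oo --> (cos y +i* sin y : R[i]^o).
Proof.
have E N : \sum_(k < N) (0 +i* y) ^+ k / k`!%:R = series (cos_coeff y) N +i* series (sin_coeff y) N.
  rewrite /series /= !big_mkord; elim: N => [|N ih]; first by rewrite !big_ord0.
  rewrite !big_ord_recr /= ih imaginary_pow -(rmorph_nat (real_complex R)) -fmorphV /=.
  by apply: cplx_eqP; rewrite ?ReD ?ImD ?ReM ?ImM /cos_coeff /sin_coeff /= -?exprnP; ring.
under eq_fun do rewrite E; apply/cvgC_ReIm; split => /=.
  by rewrite unlock; exact: is_cvg_series_cos_coeff.
by rewrite unlock; exact: is_cvg_series_sin_coeff.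
Qed.

Lemma cexp_real (x : R) :
  (fun N => \sum_(k < N) x%:C ^+ k / k`!%:R) @ \oo --> ((expR x)%:C : R[i]^o).
Proof.
have E N : \sum_(k < N) x%:C ^+ k / k`!%:R = (series (exp_coeff x) N)%:C.
  rewrite /series /= big_mkord rmorph_sum; apply: eq_bigr => k _.
  by rewrite /exp_coeff /= rmorphM rmorphXn fmorphV rmorph_nat.
under eq_fun do rewrite E; apply/cvgC_ReIm; split => /=; last exact: cvg_cst.
exact: is_cvg_series_exp_coeff.
Qed.

(** By the binomial formula the series at x + i y is the Cauchy product of the series at x and at i
    y. The product is taken at h = 1 with radius 8, as [cauchy_product] requires 8 |h| <= r; the
    coefficients are then bounded by exp (8 |u|). *)
Lemma cvg_cexp z : (fun N => \sum_(k < N) z ^+ k / k`!%:R) @ \oo --> (cexp z : R[i]^o).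
Proof.
pose ec z n : R[i] := z ^+ n / n`!%:R.
have bnd (u : R[i]) n : cabs (ec u n) * 8 ^+ n <= expR (cabs u * 8).
  rewrite Normc.normcM cabsX -(rmorph_nat (real_complex R)) -fmorphV cabs_real ger0_norm ?invr_ge0//.
  by rewrite mulrAC -exprMn exp_coeff_le// mulr_ge0 ?cabs_ge0.
have p1 (u : R[i]) : psum (ec u) 1 = fun N => \sum_(k < N) u ^+ k / k`!%:R.
  by apply/funext => N; apply: eq_bigr => k _; rewrite expr1n mulr1.
have zE : z = (complex.Re z)%:C + (0 +i* complex.Im z) by apply: cplx_eqP; rewrite ?ReD ?ImD /= ?addr0 ?add0r.
have h8 : 8 * cabs (1 : R[i]) <= 8 by rewrite (cabs_real 1) normr1 mulr1.
have e8 : 0 < (8 : R) by rewrite ltr0n.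
have h1 : psum (ec (complex.Re z)%:C) 1 @ \oo --> ((expR (complex.Re z))%:C : R[i]^o).
  by rewrite p1; exact: cexp_real.
have h2 : psum (ec (0 +i* complex.Im z)) 1 @ \oo --> (cos (complex.Im z) +i* sin (complex.Im z) : R[i]^o).
  by rewrite p1; exact: cexp_imaginary.
have := cauchy_product e8 (bnd _) (bnd _) h8 h1 h2; rewrite -/(cexp z).
rewrite -p1 (_ : (fun n => _) = ec z)//.
apply/funext => n; rewrite /ec [in RHS]zE addrC exprDn mulr_suml; apply: eq_bigr => j _.
have jn : (j <= n)%N by rewrite -ltnS.
have f0 k : (k`!%:R : R[i]) != 0 by rewrite pnatr_eq0 -lt0n fact_gt0.
have := bin_fact jn => /(congr1 (fun k => k%:R : R[i])); rewrite !natrM => <-.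
rewrite -[_ *+ 'C(n, j)]mulr_natr; field.
by rewrite !f0 pnatr_eq0 -lt0n bin_gt0 jn.
Qed.

End Analytic.

(** * Analyticity of Mellin transforms *)

Section MellinAnalytic.
Variable R : realType.
Local Notation leb := (@lebesgue_measure R).
Implicit Types (f : R -> R[i]) (c d t : R) (s h z : R[i]).

Lemma cpow_cexp t s : cpow t s = cexp (s * (ln t)%:C).
Proof.
case: s => a b.
have -> : (a +i* b) * (ln t)%:C = (a * ln t) +i* (b * ln t) by apply: cplx_eqP => /=; ring.
by apply: cplx_eqP; rewrite ?Re_cpow ?Im_cpow /cexp /=; ring.
Qed.

(** Expand t^h as the exponential series in h ln t. For |h| <= d the moduli sum to at most |f(t)|
    t^(c-1) exp (d |ln t|), which is controlled by the weights of abscissas c - d and c + d, so the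
    series may be integrated term by term. *)
Theorem analytic_mellin c d f s : 0 < d -> mellin_class (c - d) f -> mellin_class (c + d) f ->
  complex.Re s = c -> analytic_at (mellin f) s.
Proof.
move=> d0 [mf f0 h1] [_ _ h2] sc.
pose u_ h n t := f t * cpow t (s - 1) * ((ln t ^+ n / n`!%:R)%:C * h ^+ n).
have mu h n : cmeasurable setT (u_ h n).
  apply: cmeasurableM; first by apply: cmeasurableM => //; exact: cmeasurable_cpow_id.
  apply: cmeasurableM; last exact: cmeasurable_cst.
  apply: cmeasurable_real; apply: measurable_funM; last exact: measurable_cst.
  by apply: measurable_funX; exact: measurable_ln.
pose w1 t := cabs (f t) * expR ((c - d - 1) * ln t).
pose w2 t := cabs (f t) * expR ((c + d - 1) * ln t).
have w10 t : 0 <= w1 t by rewrite mulr_ge0 ?cabs_ge0 ?expR_ge0.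
have w20 t : 0 <= w2 t by rewrite mulr_ge0 ?cabs_ge0 ?expR_ge0.
have mw1 : measurable_fun setT w1.
  by apply: measurable_funM; [exact: measurable_cabs|exact: measurable_mellin_weight].
have mw2 : measurable_fun setT w2.
  by apply: measurable_funM; [exact: measurable_cabs|exact: measurable_mellin_weight].
have cu h n t : cabs (u_ h n t) = cabs (f t) * expR ((c - 1) * ln t) * ((cabs h * `|ln t|) ^+ n / n`!%:R).
  rewrite /u_ (Normc.normcM (f t * _)) cabs_mellin sc; congr (_ * _).
  rewrite Normc.normcM cabsX cabs_real normrM normrX normfV normr_nat exprMn; ring.
have hsum h N t : cabs h <= d -> \sum_(n < N) cabs (u_ h n t) <= w1 t + w2 t.
  move=> hd; under eq_bigr do rewrite cu.
  rewrite -mulr_sumr.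
  apply: (@le_trans _ _ (cabs (f t) * expR ((c - 1) * ln t) * expR (d * `|ln t|))).
    rewrite ler_wpM2l ?mulr_ge0 ?cabs_ge0 ?expR_ge0//.
    rewrite (le_trans (sum_exp_le _ _)) ?mulr_ge0 ?cabs_ge0//.
    by rewrite ler_expR ler_wpM2r.
  rewrite -mulrA -expRD; have [l0|l0] := leP 0 (ln t).
    have -> : (c - 1) * ln t + d * `|ln t| = (c + d - 1) * ln t by rewrite ger0_norm//; ring.
    by rewrite -/(w2 t) lerDr.
  have -> : (c - 1) * ln t + d * `|ln t| = (c - d - 1) * ln t by rewrite ltr0_norm//; ring.
  by rewrite -/(w1 t) lerDl.
have hint h : cabs h <= d -> (\sum_(0 <= n <oo) \int[leb]_(t in setT) (cabs (u_ h n t))%:E < +oo)%E.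
  move=> hd; apply: (@le_lt_trans _ _ (\int[leb]_t (w1 t)%:E + \int[leb]_t (w2 t)%:E)%E); last first.
    exact: lte_add_pinfty.
  apply: lime_le.
    by apply: is_cvg_nneseries => n _ _; apply: integral_ge0 => t _; rewrite lee_fin cabs_ge0.
  apply: nearW => N /=; rewrite -ge0_integral_sum//; last 2 first.
  - by move=> n; apply/measurable_EFinP; exact: (measurable_cabs (mu h n)).
  - by move=> n t _; rewrite lee_fin cabs_ge0.
  rewrite -ge0_integralD//; last 4 first.
  - by move=> t _; rewrite lee_fin.
  - exact/measurable_EFinP.
  - by move=> t _; rewrite lee_fin.
  - exact/measurable_EFinP.
  apply: ge0_le_integral => //.
  - by move=> t _; apply: sume_ge0 => n _; rewrite lee_fin cabs_ge0.
  - by apply: emeasurable_sum => n; apply/measurable_EFinP; exact: (measurable_cabs (mu h n)).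
  - by apply: emeasurable_funD; exact/measurable_EFinP.
  - by move=> t _; rewrite sumEFin -EFinD lee_fin big_mkord hsum.
have dd : cabs (d%:C : R[i]) <= d by rewrite cabs_real gtr0_norm.
have iu n : cintegrable leb setT (u_ d%:C n).
  apply/cintegrable_ltyP => //; split; first exact: mu.
  apply: le_lt_trans (hint _ dd).
  apply: (@le_trans _ _ (\sum_(0 <= k < n.+1) \int[leb]_(t in setT) (cabs (u_ d%:C k t))%:E)%E).
    rewrite big_nat_recr//= leeDr// sume_ge0// => k _.
    by apply: integral_ge0 => t _; rewrite lee_fin cabs_ge0.
  by apply: nneseries_lim_ge => k _ _; apply: integral_ge0 => t _; rewrite lee_fin cabs_ge0.
have dn : (d%:C : R[i]) != 0 by rewrite fmorph_eq0 gt_eqF.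
(* The coefficient is written as the term at h = d divided by d^n, because integrability was
   obtained for that term. *)
exists (fun n => cint leb setT (u_ d%:C n) * (d%:C)^-1 ^+ n); apply/nbhsC; exists d => // z zd.
rewrite series_psum; set h := z - s.
have pt (t : R) : setT t -> series (fun n => u_ h n t : R[i]^o) @ \oo --> (f t * cpow t (z - 1) : R[i]^o).
  move=> _; have -> : f t * cpow t (z - 1) = f t * cpow t (s - 1) * cpow t h.
    by rewrite -mulrA -cpowD; congr (_ * cpow _ _); rewrite /h; ring.
  rewrite (cpow_cexp t h).
  have c0 : (fun N => f t * cpow t (s - 1) * \sum_(k < N) (h * (ln t)%:C) ^+ k / k`!%:R) @ \oo -->
      (f t * cpow t (s - 1) * cexp (h * (ln t)%:C) : R[i]^o).
    have ec := @cvg_cexp R (h * (ln t)%:C).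
    have kc : (fun _ : nat => f t * cpow t (s - 1)) @ \oo --> (f t * cpow t (s - 1) : R[i]^o) by exact: cvgC_cst.
    exact: (cvgC_seqM kc ec).
  apply: cvgC_eq c0 => N.
  rewrite /series /= big_mkord mulr_sumr; apply: eq_bigr => n _; rewrite /u_; congr (_ * _).
  by rewrite exprMn rmorphM rmorphXn fmorphV rmorph_nat -mulrA mulrC.
have [_] := @cint_series _ (measurableTypeR R) R leb setT measurableT (u_ h)
  (fun t => f t * cpow t (z - 1)) (mu h) pt (hint h (ltW zd)).
apply: cvgC_eq => N; rewrite /series /= big_mkord; apply: eq_bigr => n _.
rewrite -mulrA -exprMn -cintZr//; apply: eq_cint => t _.
rewrite /u_ -[RHS]mulrA; congr (_ * _); rewrite -[RHS]mulrA; congr (_ * _).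
by rewrite -exprMn mulrA mulfV// mul1r.
Qed.

End MellinAnalytic.

(** * The functional equation on the critical line *)

Section Bernoulli.
Variable R : realType.
Implicit Types (x y u : R) (n k N M : nat).

Lemma is_derive_mulx u x : is_derive x 1 (fun y => u * y) u.
Proof.
have := @is_deriveZ R R^o R^o id u x 1 1 (is_derive_id x 1).
by rewrite /GRing.scale /= mulr1.
Qed.

Lemma is_derive_eqR (f : R -> R) x a b : is_derive x 1 f a -> a = b -> is_derive x 1 f b.
Proof. by move=> + <-. Qed.

Lemma is_derive_cosM u x : is_derive x 1 (fun y => cos (u * y)) (- (u * sin (u * x))).
Proof.
have := @is_derive1_comp R (@cos R) (fun y => u * y) x _ _ (is_derive_cos (u * x)) (is_derive_mulx u x).
move=> h; suff -> : - (u * sin (u * x)) = - sin (u * x) * u by exact: h.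
by rewrite mulNr mulrC.
Qed.

Lemma is_derive_sinM u x : is_derive x 1 (fun y => sin (u * y)) (u * cos (u * x)).
Proof.
have := @is_derive1_comp R (@sin R) (fun y => u * y) x _ _ (is_derive_sin (u * x)) (is_derive_mulx u x).
move=> h; suff -> : u * cos (u * x) = cos (u * x) * u by exact: h.
by rewrite mulrC.
Qed.

Lemma is_derive_bigsum (F dF : nat -> R -> R) x N : (forall k, is_derive x 1 (F k) (dF k x)) ->
  is_derive x 1 (fun y => \sum_(k < N) F k y) (\sum_(k < N) dF k x).
Proof.
move=> dF1; elim: N => [|N ih].
  rewrite big_ord0 (_ : (fun _ => _) = cst 0); last by apply/funext => y; rewrite big_ord0.
  exact: is_derive_cst.
rewrite big_ord_recr (_ : (fun _ => _) = (fun y => \sum_(k < N) F k y) + F N); first exact: is_deriveD.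
by apply/funext => y; rewrite big_ord_recr.
Qed.

(** Writing the Fourier series with 1 - cos makes all terms nonnegative and zero at integers, and
    absorbs the constant term: the value of the sum of 1 / n^2 never has to be computed. *)
Definition bern_term n x : R := (1 - cos (2 * pi * n.+1%:R * x)) / (pi ^+ 2 * n.+1%:R ^+ 2).

Definition bern_sum N x : R := \sum_(n < N) bern_term n x.

Let pi0 : (pi : R) != 0. Proof. by rewrite gt_eqF// pi_gt0. Qed.

Let n0 n : n.+1%:R != 0 :> R. Proof. by rewrite pnatr_eq0. Qed.

Lemma is_derive_bern_term n x :
  is_derive x 1 (bern_term n) (2 * sin (2 * pi * n.+1%:R * x) / (pi * n.+1%:R)).
Proof.
have h := is_derive_cosM (2 * pi * n.+1%:R) x.
have h1 := @is_deriveB R R^o R^o (cst (1 : R)) _ x 1 _ _ (is_derive_cst (1 : R) x 1) h.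
have := @is_deriveZ R R^o R^o _ (pi ^+ 2 * n.+1%:R ^+ 2)^-1 x 1 _ h1.
rewrite (_ : _ \*: _ = bern_term n); last first.
  by apply/funext => y; rewrite /bern_term [RHS]mulrC.
move=> /is_derive_eqR; apply; rewrite /GRing.scale /=.
have := n0 n; move: (n.+1%:R : R) (pi : R) pi0 => a p p0 a0.
by field; rewrite a0 p0.
Qed.

Lemma is_derive_bern_term2 n x :
  is_derive x 1 (fun x => 2 * sin (2 * pi * n.+1%:R * x) / (pi * n.+1%:R)) (4 * cos (2 * pi * n.+1%:R * x)).
Proof.
have h := is_derive_sinM (2 * pi * n.+1%:R) x.
have := @is_deriveZ R R^o R^o _ (2 / (pi * n.+1%:R)) x 1 _ h.
rewrite (_ : _ \*: _ = fun x => 2 * sin (2 * pi * n.+1%:R * x) / (pi * n.+1%:R)); last first.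
  by apply/funext => y; rewrite [RHS]mulrAC.
move=> /is_derive_eqR; apply; rewrite /GRing.scale /=.
have := n0 n; move: (n.+1%:R : R) (pi : R) pi0 => a p p0 a0.
by field; rewrite a0 p0.
Qed.

(* The inner sums are Dirichlet kernels; their sums are nonnegative, unlike each of them. *)
Lemma fejer_kernel x N : (\sum_(k < N) (1 + \sum_(n < k) 2 * cos (2 * pi * n.+1%:R * x))) *
  sin (pi * x) ^+ 2 = sin (N%:R * (pi * x)) ^+ 2.
Proof.
set a := pi * x.
have D k : (1 + \sum_(n < k) 2 * cos (2 * pi * n.+1%:R * x)) * sin a = sin ((2 * k%:R + 1) * a).
  elim: k => [|k ih]; first by rewrite big_ord0 addr0 mulr0 add0r !mul1r.
  rewrite big_ord_recr /= addrA mulrDl ih.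
  rewrite (_ : 2 * pi * k.+1%:R * x = (2 * k%:R + 1) * a + a); last by rewrite -natr1 /a; ring.
  rewrite (_ : (2 * k.+1%:R + 1) * a = (2 * k%:R + 1) * a + a + a); last by rewrite -natr1; ring.
  set b := (2 * k%:R + 1) * a.
  rewrite (sinD (b + a)) (sinD b) (cosD b).
  have := cos2Dsin2 a; move: (sin a) (cos a) (sin b) (cos b) => sa ca sb cb.
  move=> e; apply/eqP; rewrite -subr_eq0; apply/eqP.
  have -> : sb + 2 * (cb * ca - sb * sa) * sa - ((sb * ca + cb * sa) * ca + (cb * ca - sb * sa) * sa)
    = sb * (1 - (ca ^+ 2 + sa ^+ 2)) by ring.
  by rewrite e subrr mulr0.
elim: N => [|N ih]; first by rewrite big_ord0 !mul0r sin0 expr0n.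
rewrite big_ord_recr /= mulrDl ih (_ : (1 + _) * _ = sin ((2 * N%:R + 1) * a) * sin a); last first.
  by rewrite expr2 mulrA D.
rewrite (_ : (2 * N%:R + 1) * a = N%:R * a + (N%:R * a + a)); last by ring.
rewrite (_ : N.+1%:R * a = N%:R * a + a); last by rewrite -natr1; ring.
set b := N%:R * a; rewrite (sinD b (b + a)) (sinD b) (cosD b).
have := cos2Dsin2 a; have := cos2Dsin2 b; move: (sin a) (cos a) (sin b) (cos b) => sa ca sb cb eb ea.
apply/eqP; rewrite -subr_eq0; apply/eqP.
have -> : sb ^+ 2 + (sb * (cb * ca - sb * sa) + cb * (sb * ca + cb * sa)) * sa - (sb * ca + cb * sa) ^+ 2
  = sb ^+ 2 * (1 - (ca ^+ 2 + sa ^+ 2)) by ring.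
by rewrite ea subrr mulr0.
Qed.

Lemma sin_le_half x y : 0 <= x <= y -> y <= 2^-1 -> sin (pi * x) <= sin (pi * y).
Proof.
move=> /andP[x0 xy] y2; rewrite -subr_ge0.
have p0 := pi_gt0 R.
pose m := pi * ((x + y) / 2); pose d := pi * ((y - x) / 2).
have -> : sin (pi * y) = sin (m + d) by congr sin; rewrite /m /d; field.
have -> : sin (pi * x) = sin (m - d) by congr sin; rewrite /m /d; field.
rewrite sinD sinB (_ : _ - _ = 2 * cos m * sin d); last by ring.
have m1 : - (pi / 2) <= m <= pi / 2.
  apply/andP; split; first by rewrite (@le_trans _ _ 0)// ?oppr_le0 ?mulr_ge0 ?(ltW p0)// addr_ge0// (le_trans x0).
  by rewrite ler_pM2l//; lra.
have d1 : 0 <= d <= pi.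
  by rewrite mulr_ge0 ?(ltW p0)//=; [rewrite ger_pMr//; lra|lra].
by rewrite !mulr_ge0// ?cos_ge0_pihalf ?sin_ge0_pi.
Qed.

Lemma sin_pi_nat n : sin (pi * n%:R) = 0 :> R.
Proof.
elim: n => [|n ih]; first by rewrite mulr0 sin0.
by rewrite -natr1 mulrDr mulr1 sinDpi ih oppr0.
Qed.

Lemma cos_pi_even n : cos (pi * (2 * n)%:R) = 1 :> R.
Proof.
have -> : pi * (2 * n)%:R = pi * n%:R + pi * n%:R :> R by rewrite natrM; ring.
by have := cos2Dsin2 (pi * n%:R : R); rewrite cosD sin_pi_nat expr0n addr0 mulr0 subr0 -expr2.
Qed.

(* The second derivative of the sum is twice a Fejer kernel, hence bounded on
   [[x, 1/2]], and its first derivative vanishes at 1/2. *)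
Lemma cesaro_bern_bound x N : 0 < x < 2^-1 ->
  `|\sum_(k < N) ((bern_sum k x - (x - x ^+ 2)) - (bern_sum k 2^-1 - (2^-1 - 2^-1 ^+ 2)))|
    <= (sin (pi * x) ^+ 2)^-1.
Proof.
move=> /andP[x0 x2].
pose G y := \sum_(k < N) (bern_sum k y - (y - y ^+ 2)).
pose G1 y := \sum_(k < N) (\sum_(n < k) (2 * sin (2 * pi * n.+1%:R * y) / (pi * n.+1%:R)) - (1 - 2 * y)).
pose G2 y := \sum_(k < N) (\sum_(n < k) (4 * cos (2 * pi * n.+1%:R * y)) + 2).
have sq y : is_derive y 1 (fun y => y - y ^+ 2) (1 - 2 * y).
  have h2 := @is_deriveM R R^o id id y 1 _ _ (is_derive_id y 1) (is_derive_id y 1).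
  have := @is_deriveB R R^o R^o id _ y 1 _ _ (is_derive_id y 1) h2.
  rewrite (_ : id - id * id = fun y : R => y - y ^+ 2); last by apply/funext => z; rewrite expr2.
  by move=> /is_derive_eqR; apply; rewrite /GRing.scale /=; ring.
have dG y : is_derive y 1 G (G1 y).
  apply: (is_derive_bigsum (F := fun k y => bern_sum k y - (y - y ^+ 2))
    (dF := fun k y => \sum_(n < k) (2 * sin (2 * pi * n.+1%:R * y) / (pi * n.+1%:R)) - (1 - 2 * y))) => k.
  apply: (@is_deriveB R R^o R^o (bern_sum k) _ y 1 _ _ _ (sq y)).
  by apply: (is_derive_bigsum (F := bern_term)
    (dF := fun n y => 2 * sin (2 * pi * n.+1%:R * y) / (pi * n.+1%:R))) => n; exact: is_derive_bern_term.
have lin y : is_derive y 1 (fun y => 1 - 2 * y) (- 2).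
  have := @is_deriveB R R^o R^o (cst (1 : R)) _ y 1 _ _ (is_derive_cst (1 : R) y 1) (is_derive_mulx 2 y).
  by move=> /is_derive_eqR; apply; rewrite sub0r.
have dG1 y : is_derive y 1 G1 (G2 y).
  apply: (is_derive_bigsum
    (F := fun k y => \sum_(n < k) (2 * sin (2 * pi * n.+1%:R * y) / (pi * n.+1%:R)) - (1 - 2 * y))
    (dF := fun k y => \sum_(n < k) (4 * cos (2 * pi * n.+1%:R * y)) + 2)) => k.
  have h : is_derive y 1 (fun y => \sum_(n < k) (2 * sin (2 * pi * n.+1%:R * y) / (pi * n.+1%:R)))
     (\sum_(n < k) (4 * cos (2 * pi * n.+1%:R * y))).
    by apply: (is_derive_bigsum (F := fun n y => 2 * sin (2 * pi * n.+1%:R * y) / (pi * n.+1%:R))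
      (dF := fun n y => 4 * cos (2 * pi * n.+1%:R * y))) => n; exact: is_derive_bern_term2.
  have := @is_deriveB R R^o R^o _ _ y 1 _ _ h (lin y).
  by move=> /is_derive_eqR; apply; rewrite opprK.
have cont (F dF : R -> R) a b : (forall y, is_derive y 1 F (dF y)) -> {within `[a, b], continuous F}.
  by move=> dF1; apply: derivable_within_continuous => y _; exact: (@ex_derive _ _ _ _ _ _ _ (dF1 y)).
have sx : 0 < sin (pi * x).
  have p0 := pi_gt0 R; apply: sin_gt0_pi; rewrite mulr_gt0//= gtr_pMr//; lra.
have G2E y : G2 y * sin (pi * y) ^+ 2 = 2 * sin (N%:R * (pi * y)) ^+ 2.
  rewrite -fejer_kernel mulrA mulr_sumr; congr (_ * _); apply: eq_bigr => k _.
  rewrite [RHS]mulrDr mulr1 [RHS]addrC mulr_sumr; congr (_ + _); apply: eq_bigr => n _; ring.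
pose C := (sin (pi * x) ^+ 2)^-1.
have C0 : 0 < C by rewrite invr_gt0 exprn_gt0.
have G2b y : x <= y <= 2^-1 -> `|G2 y| <= 2 * C.
  move=> /andP[xy y2]; have sy := sin_le_half (introT andP (conj (ltW x0) xy)) y2.
  have sy1 := lt_le_trans sx sy.
  have sy0 : 0 < sin (pi * y) ^+ 2 by rewrite exprn_gt0// (lt_le_trans sx).
  have -> : G2 y = 2 * sin (N%:R * (pi * y)) ^+ 2 / sin (pi * y) ^+ 2.
    by rewrite -G2E mulfK// gt_eqF.
  rewrite ger0_norm; last by rewrite mulr_ge0 ?invr_ge0 ?sqr_ge0// mulr_ge0 ?sqr_ge0.
  rewrite -mulrA ler_pM2l//; apply: (@le_trans _ _ (1 * (sin (pi * y) ^+ 2)^-1)).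
    by rewrite ler_wpM2r ?invr_ge0 ?(ltW sy0)//.
  rewrite mul1r /C lef_pV2 ?posrE ?exprn_gt0//.
  by apply: lerXn2r => //; rewrite nnegrE ltW// (lt_le_trans sx).
have G1h : G1 2^-1 = 0.
  rewrite /G1 big1// => k _; rewrite big1 ?sub0r => [|n _].
    by rewrite mulfV ?subrr ?oppr0// pnatr_eq0.
  by rewrite (_ : 2 * pi * n.+1%:R * 2^-1 = pi * n.+1%:R); [rewrite sin_pi_nat mulr0 mul0r|field].
have [e /[!in_itv]/= /andP[xe e2] eG] := MVT x2 (fun y _ => dG y) (cont _ _ _ _ dG).
have [e' /[!in_itv]/= /andP[ee e'2] eG'] := MVT e2 (fun y _ => dG1 y) (cont _ _ _ _ dG1).
rewrite sumrB -/(G x) -/(G 2^-1) distrC eG normrM.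
have h1 : `|G1 e| <= C.
  have -> : `|G1 e| = `|G1 2^-1 - G1 e| by rewrite G1h sub0r normrN.
  rewrite eG' normrM; have := G2b e' _; rewrite (ltW (lt_trans xe ee)) (ltW e'2) => /(_ isT) h.
  apply: (@le_trans _ _ (2 * C * 2^-1)); last by rewrite mulrAC mulfV ?mul1r// pnatr_eq0.
  by apply: ler_pM => //; rewrite ger0_norm ?subr_ge0 ?(ltW e2)//; lra.
rewrite -/C -[leRHS]mulr1; apply: ler_pM => //.
by rewrite ger0_norm ?subr_ge0 ?(ltW x2)//; lra.
Qed.

Lemma bern_term_ge0 n x : 0 <= bern_term n x.
Proof. by rewrite divr_ge0 ?subr_ge0 ?cos_le1// mulr_ge0 ?sqr_ge0. Qed.

Lemma bern_term_le_sq n x : bern_term n x <= 2 * x ^+ 2.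
Proof.
have p0 : 0 < pi ^+ 2 * n.+1%:R ^+ 2 :> R by rewrite mulr_gt0// exprn_gt0// ?pi_gt0// ltr0n.
rewrite ler_pdivrMr//; set a := pi * n.+1%:R * x.
have -> : 2 * pi * n.+1%:R * x = a + a by rewrite /a; ring.
rewrite cosD.
have -> : 1 - (cos a * cos a - sin a * sin a) = 2 * sin a ^+ 2 by have := cos2Dsin2 a; lra.
rewrite (_ : 2 * x ^+ 2 * _ = 2 * a ^+ 2); last by rewrite /a; ring.
rewrite ler_pM2l// -[leLHS]real_normK ?num_real// -[leRHS]real_normK ?num_real//.
by apply: lerXn2r; rewrite ?nnegrE// norm_sin_le.
Qed.

Lemma bern_term_le_inv n x : bern_term n.+1 x <= n.+1%:R^-1 - n.+2%:R^-1.
Proof.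
have -> : n.+1%:R^-1 - n.+2%:R^-1 = (n.+1%:R * n.+2%:R)^-1 :> R.
  rewrite -[n.+2%:R]natr1; have : 0 < n.+1%:R :> R by rewrite ltr0n.
  by move: (n.+1%:R : R) => a a0; field; apply/andP; split; rewrite gt_eqF//; lra.
have p4 : 4 <= (pi : R) ^+ 2.
  have := pi_ge2 R => h; rewrite (_ : 4 = 2 ^+ 2); last by rewrite -natrX.
  by apply: lerXn2r; rewrite ?nnegrE// pi_ge0.
apply: (@le_trans _ _ (2 / (4 * n.+2%:R ^+ 2))).
  apply: ler_pM.
  - by rewrite subr_ge0 cos_le1.
  - by rewrite invr_ge0 mulr_ge0 ?sqr_ge0.
  - by have := cos_geN1 (2 * pi * n.+2%:R * x); lra.
  - by rewrite lef_pV2 ?posrE ?mulr_gt0 ?exprn_gt0 ?pi_gt0 ?ltr0n// ler_pM2r// exprn_gt0// ltr0n.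
rewrite ler_pdivrMr ?mulr_gt0 ?exprn_gt0 ?ltr0n// mulrC ler_pdivlMr ?mulr_gt0 ?ltr0n//.
have h1 : n.+1%:R <= n.+2%:R :> R by rewrite ler_nat.
have h2 : 0 <= n.+2%:R :> R by [].
rewrite -subr_ge0 in h1; have := mulr_ge0 h2 h1; have := sqr_ge0 (n.+2%:R : R); nra.
Qed.

(** The first M + 1 terms are at most 2 x^2 each; the later ones are bounded by differences 1/j -
    1/(j+1), which telescope to 1 / (M + 1). The free choice of [M] is what bounds the sum near
    0. *)
Lemma bern_sum_le N M x : bern_sum N x <= 2 * M.+1%:R * x ^+ 2 + M.+1%:R^-1.
Proof.
have key k : bern_sum (M.+1 + k) x <= 2 * M.+1%:R * x ^+ 2 + (M.+1%:R^-1 - (M.+1 + k)%:R^-1).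
  elim: k => [|k ih].
    rewrite addn0 subrr addr0 /bern_sum; apply: (@le_trans _ _ (\sum_(n < M.+1) 2 * x ^+ 2)).
      by apply: ler_sum => n _; exact: bern_term_le_sq.
    by rewrite sumr_const card_ord -[leLHS]mulr_natr mulrAC.
  rewrite addnS /bern_sum big_ord_recr /= -/(bern_sum _ _).
  rewrite addSn in ih *.
  by apply: (le_trans (lerD ih (bern_term_le_inv (M + k) x))); rewrite -addrA lerD2l addrA subrK.
have mono k j : bern_sum k x <= bern_sum (k + j) x.
  elim: j => [|j ih]; first by rewrite addn0.
  by rewrite addnS /bern_sum big_ord_recr /= (le_trans ih)// lerDl bern_term_ge0.
have := le_trans (mono N M.+1) _; apply; rewrite addnC (le_trans (key N))//.
by rewrite lerD2l gerBl invr_ge0.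
Qed.

Lemma is_cvg_bern_sum x : cvgn (bern_sum ^~ x).
Proof.
apply: nondecreasing_is_cvgn.
  apply/nondecreasing_seqP => n; rewrite /bern_sum big_ord_recr /= lerDl.
  exact: bern_term_ge0.
exists (2 * 1%:R * x ^+ 2 + 1%:R^-1) => _ [n _ <-]; exact: (bern_sum_le n 0 x).
Qed.

(** Monotonicity already makes the partial sums converge, and the Cesaro means of the difference of
    both sides are O(1/n) by [cesaro_bern_bound]; the limit of the difference is therefore 0. *)
Lemma bern_sum_const x : 0 < x <= 2^-1 ->
  limn (bern_sum ^~ x) - (x - x ^+ 2) = limn (bern_sum ^~ 2^-1) - (2^-1 - 2^-1 ^+ 2).
Proof.
move=> /andP[x0]; rewrite le_eqVlt => /predU1P[->//|x2].
pose v k := (bern_sum k x - (x - x ^+ 2)) - (bern_sum k 2^-1 - (2^-1 - 2^-1 ^+ 2)).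
have hv : v @ \oo --> (limn (bern_sum ^~ x) - (x - x ^+ 2)) - (limn (bern_sum ^~ 2^-1) - (2^-1 - 2^-1 ^+ 2)).
  by apply: cvgB; apply: cvgB; do ?[exact: cvg_cst|exact: is_cvg_bern_sum].
have h0 : arithmetic_mean v @ \oo --> 0.
  apply/norm_cvg0P; apply: (@squeeze_cvgr _ _ _ _ (cst 0) (fun n => (sin (pi * x) ^+ 2)^-1 * n.+1%:R^-1)).
  - apply: nearW => n /=; rewrite normr_ge0 /=.
    rewrite normrM normfV normr_nat mulrC ler_wpM2r ?invr_ge0//.
    rewrite /series /= big_mkord; apply: cesaro_bern_bound; first by rewrite x0.
  - exact: cvg_cst.
  - rewrite -[X in _ --> X](mulr0 ((sin (pi * x) ^+ 2)^-1)); apply: cvgMr.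
    exact: (@cvg_harmonic R).
by apply/eqP; rewrite -subr_eq0; apply/eqP; exact: (cvg_unique _ (cesaro hv) h0).
Qed.

(** The constant is found by letting x tend to 0: at x = 1 / (2 (M + 1)) both terms of [bern_sum_le]
    are of order 1 / M. *)
Lemma bern_sum_half : limn (bern_sum ^~ 2^-1) - (2^-1 - 2^-1 ^+ 2) = 0 :> R.
Proof.
set kap := LHS.
suff h M : `|kap| <= 2 * M.+1%:R^-1.
  apply/eqP; rewrite -normr_le0.
  have hc : (fun M : nat => 2 * M.+1%:R^-1 : R) @ \oo --> 0.
    by rewrite -[X in _ --> X](mulr0 2); apply: cvgMr; exact: (@cvg_harmonic R).
  by rewrite -(cvg_lim _ hc)//; apply: limr_ge; [apply/cvg_ex; exists 0|exact: nearW].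
pose x : R := (2 * M.+1%:R)^-1.
have M0 : 0 < M.+1%:R :> R by rewrite ltr0n.
have x0 : 0 < x by rewrite invr_gt0 mulr_gt0.
have x2 : x <= 2^-1 by rewrite lef_pV2 ?posrE ?mulr_gt0// ler_peMr// ler1n.
rewrite /kap -(@bern_sum_const x) ?x0//.
have l0 : 0 <= limn (bern_sum ^~ x).
  by apply: limr_ge; [exact: is_cvg_bern_sum|apply: nearW => n; apply: sumr_ge0 => k _; exact: bern_term_ge0].
have l1 : limn (bern_sum ^~ x) <= 2 * M.+1%:R * x ^+ 2 + M.+1%:R^-1.
  by apply: limr_le; [exact: is_cvg_bern_sum|apply: nearW => n; exact: bern_sum_le].
have xM : 2 * M.+1%:R * x = 1 by rewrite mulfV// gt_eqF// mulr_gt0.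
have xi : M.+1%:R^-1 = 2 * x by rewrite /x; field; rewrite gt_eqF.
rewrite expr2 mulrA xM mul1r xi in l1; rewrite xi.
have xx : 0 <= x ^+ 2 by rewrite sqr_ge0.
have xx2 : x ^+ 2 <= x by rewrite expr2 ger_pMr//; lra.
by rewrite ler_norml; apply/andP; split; lra.
Qed.

Definition tri x : R := (x - (Num.truncn x)%:R) - (x - (Num.truncn x)%:R) ^+ 2.

Lemma cvg_bern_sum x : 0 <= x -> (bern_sum ^~ x) @ \oo --> tri x.
Proof.
have half y : 0 < y <= 2^-1 -> (bern_sum ^~ y) @ \oo --> y - y ^+ 2.
  move=> y2; have := bern_sum_const y2; rewrite bern_sum_half => /eqP.
  by rewrite subr_eq0 => /eqP <-; exact: is_cvg_bern_sum.
have unit_itv y : 0 <= y < 1 -> (bern_sum ^~ y) @ \oo --> y - y ^+ 2.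
  move=> /andP[]; rewrite le_eqVlt => /predU1P[<-|y0] y1.
    rewrite expr0n subr0 (_ : bern_sum ^~ 0 = cst 0); first exact: cvg_cst.
    by apply/funext => n; rewrite /bern_sum big1// => k _; rewrite /bern_term mulr0 cos0 subrr mul0r.
  have [y2|y2] := leP y 2^-1; first by apply: half; rewrite y0.
  rewrite (_ : y - y ^+ 2 = (1 - y) - (1 - y) ^+ 2); last by ring.
  rewrite (_ : bern_sum ^~ y = bern_sum ^~ (1 - y)); first by apply: half; lra.
  apply/funext => n; apply: eq_bigr => k _; rewrite /bern_term; congr ((1 - _) / _).
  rewrite (_ : 2 * pi * k.+1%:R * (1 - y) = pi * (2 * k.+1)%:R - 2 * pi * k.+1%:R * y); last by rewrite natrM; ring.
  rewrite cosB sin_pi_nat mul0r addr0.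
  by rewrite cos_pi_even mul1r.
move=> x0; have /andP[t1 t2] := truncn_itv x0; set m := Num.truncn x in t1 t2.
rewrite /tri -/m; set y := x - m%:R.
rewrite (_ : bern_sum ^~ x = bern_sum ^~ y); first by apply: unit_itv; rewrite /y; apply/andP; split; rewrite ?subr_ge0// ltrBlDr addrC natr1.
apply/funext => n; apply: eq_bigr => k _; rewrite /bern_term; congr ((1 - _) / _).
rewrite (_ : 2 * pi * k.+1%:R * x = pi * (2 * (k.+1 * m))%:R + 2 * pi * k.+1%:R * y); last by rewrite /y !natrM; ring.
rewrite cosD sin_pi_nat mul0r subr0.
by rewrite cos_pi_even mul1r.
Qed.

End Bernoulli.

(** * Kernels whose dilates sum to {t} - {t}^2 *)

Section ZetaKernels.
Variable R : realType.
Local Notation leb := (@lebesgue_measure R).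
Implicit Types (f g q : R -> R[i]) (c t u x : R) (s z w : R[i]) (n k N : nat).

(* [(1 - cos (2 pi t)) / (pi t)^2] *)
Definition fejer t : R[i] := if 0 < t then (bern_term 0 t / t ^+ 2)%:C else 0.

Lemma fejer_le0 t : t <= 0 -> fejer t = 0.
Proof. by rewrite /fejer ltNge => ->. Qed.

Lemma cmeasurable_fejer : cmeasurable setT fejer.
Proof.
rewrite (_ : fejer = fun t => (bern_term 0 t * (t ^+ 2)^-1)%:C * (\1_(`]0, +oo[%classic : set R) t)%:C).
  apply: cmeasurableM; last by apply: cmeasurable_indic; exact: measurable_itv.
  apply: cmeasurable_real; apply: measurable_funM.
    apply: continuous_measurable_fun => x.
    by have [/derivable1_diffP/differentiable_continuous] := is_derive_bern_term 0 x.
  by apply: (measurableT_comp (@measurable_inv R)); exact: measurable_funX.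
apply/funext => t; rewrite /fejer indicE mem_setE in_itv /= andbT.
by case: ifPn => _; rewrite ?mulr1 ?mulr0.
Qed.

Lemma tail_pow_nat n t : tail_pow n%:R t = if 1 <= t then ((t ^+ n)^-1)%:C else 0 :> R[i].
Proof.
rewrite /tail_pow; case: ifPn => // t1.
by rewrite cpowN cpow_nat ?(lt_le_trans ltr01)// -fmorphV.
Qed.

Lemma tail_pow1 t : tail_pow 1 t = if 1 <= t then (t^-1)%:C else 0 :> R[i].
Proof. by rewrite -[1]/(1%:R) tail_pow_nat expr1. Qed.

Lemma head_pow_nat n t : head_pow n%:R t = if 0 < t <= 1 then ((t ^+ n)^-1)%:C else 0 :> R[i].
Proof.
rewrite /head_pow; case: ifPn => // /andP[t0 _].
by rewrite cpowN cpow_nat// -fmorphV.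
Qed.

Lemma tail_pow0 t : tail_pow 0 t = if 1 <= t then 1 else 0 :> R[i].
Proof. by have := tail_pow_nat 0 t; rewrite expr0 invr1. Qed.

Lemma head_pow1 t : head_pow 1 t = if 0 < t <= 1 then (t^-1)%:C else 0 :> R[i].
Proof. by have := head_pow_nat 1 t; rewrite expr1. Qed.

Lemma head_pow0 t : head_pow 0 t = if 0 < t <= 1 then 1 else 0 :> R[i].
Proof. by have := head_pow_nat 0 t; rewrite expr0 invr1. Qed.

Lemma mellin_class_fejer c : 0 < c < 2 -> mellin_class c fejer.
Proof.
move=> /andP[c0 c2]; have L0 : mellin_class c (head_pow (0%:R : R[i])) by exact: mellin_class_head_pow.
have L2 : mellin_class c (tail_pow (2%:R : R[i])).
  by apply: mellin_class_tail_pow; rewrite -(rmorph_nat (real_complex R)).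
apply: (mellin_class_le cmeasurable_fejer fejer_le0 (mellin_classZ 2 L0) L2) => t t0.
have p2 : 0 < t ^+ 2 by rewrite exprn_gt0.
rewrite head_pow_nat tail_pow_nat /fejer t0 /= cabs_real ger0_norm; last first.
  by rewrite divr_ge0 ?bern_term_ge0// ltW.
have c2E : cabs (2 : R[i]) = 2.
  have -> : (2 : R[i]) = (2 : R)%:C by rewrite rmorph_nat.
  by rewrite cabs_real ger0_norm.
have [t1|t1] := leP t 1.
  rewrite Normc.normcM c2E expr0 invr1 (cabs_real 1) normr1 mulr1.
  apply: (@le_trans _ _ 2); last by rewrite lerDl cabs_ge0.
  by rewrite ler_pdivrMr// bern_term_le_sq.
rewrite (ltW t1) mulr0 cabs0 add0r cabs_real ger0_norm ?invr_ge0 ?(ltW p2)//.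
rewrite ler_piMl ?invr_ge0 ?(ltW p2)// /bern_term.
rewrite ler_pdivrMr; last by rewrite mulr_gt0// exprn_gt0// pi_gt0.
have := cos_geN1 (2 * pi * 1%:R * t); have := pi_ge2 R; rewrite expr1n mulr1 mul1r; nra.
Qed.

Lemma mconv_tail2 q t : (forall u, u <= 0 -> q u = 0) -> 0 < t ->
  cintegrable leb `[0, t] (fun u => u%:C * q u) ->
  mconv (tail_pow 2) q t = ((t ^+ 2)^-1)%:C * cint leb `[0, t] (fun u => u%:C * q u).
Proof.
move=> q0 t0 iq; rewrite -cintZ// [RHS]cint_indic; last exact: measurable_itv.
apply: eq_cint => u _; rewrite indicE mem_setE in_itv /= -[2]/(2%:R) tail_pow_nat.
have [u0|u0] := leP u 0; first by rewrite q0// !mulr0 !mul0r.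
rewrite (ltW u0) /= ler_pdivlMr// mul1r.
case: (leP u t) => ut; last by rewrite mul0r mul0r mulr0.
rewrite mulr1 [LHS]mulrAC -rmorphM [RHS]mulrA -rmorphM; congr (_%:C * _).
by field; rewrite !gt_eqF.
Qed.

(** The integral of u S(u) = sin (2 pi u) / pi over [0, t] is elementary. This links [sinc], whose
    transform is confined to 0 < Re s < 1, to a kernel whose transform reaches Re s < 2 and hence
    meets the domain of the Dirichlet series. *)
Lemma mconv_sinc_fejer t : 2 * mconv (tail_pow 2) (@sinc R) t = fejer t.
Proof.
have [t0|t0] := leP t 0.
  have half : 0 < (2^-1 : R) < 1 by apply/andP; split; lra.
  have L2 : mellin_class 2^-1 (tail_pow (2%:R : R[i])).
    by apply: mellin_class_tail_pow; rewrite -(rmorph_nat (real_complex R)) /=; lra.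
  have [_ h _] := mellin_class_mconv L2 (mellin_class_sinc half).
  by rewrite (h _ t0) mulr0 fejer_le0.
have p0 := pi_gt0 R.
have E (u : R) : 0 <= u <= t -> u%:C * sinc u = (pi^-1 * sin (2 * pi * u))%:C.
  move=> /andP[]; rewrite le_eqVlt => /predU1P[<- _|u0 _].
    by rewrite mul0r mulr0 sin0 mulr0.
  rewrite /sinc u0 -rmorphM; congr _%:C; move: (sin _) => v; move: (pi : R) p0 => p p0.
  by field; rewrite !gt_eqF.
have cs (u : R) : {for u, continuous (fun u : R => pi^-1 * sin (2 * pi * u))}.
  apply: cvgMr; have [/derivable1_diffP/differentiable_continuous h _] := is_derive_sinM (2 * pi) u.
  exact: h.
have iq : cintegrable leb `[0, t] (fun u => (pi^-1 * sin (2 * pi * u))%:C).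
  split => /=; last exact: integrable0.
  by apply: continuous_itv_integrable => u _; exact: cs.
have E' : {in (`[0, t]%classic : set R), (fun u : R => (pi^-1 * sin (2 * pi * u))%:C) =1 (fun u => u%:C * sinc u)}.
  by move=> u; rewrite mem_setE in_itv /= => /E.
have iq' : cintegrable leb `[0, t] (fun u => u%:C * sinc u).
  apply: (@eq_cintegrable _ (measurableTypeR R) R leb _ _ _ _ E' iq); exact: measurable_itv.
rewrite (mconv_tail2 (@sinc_le0 R) t0 iq').
rewrite (_ : cint _ _ _ = cint leb `[0, t] (fun u => (pi^-1 * sin (2 * pi * u))%:C)); last first.
  by apply: eq_cint => u ut; rewrite E'.
pose P (u : R) := - (2 * pi ^+ 2)^-1 * cos (2 * pi * u).
have ri : Rintegral leb `[0, t] (fun u => pi^-1 * sin (2 * pi * u)) = P t - P 0.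
  apply: (@Rintegral_itv_derive R P); [exact: ltW| |by move=> u _; exact: cs].
  move=> u _; have := @is_deriveZ R R^o R^o _ (- (2 * pi ^+ 2)^-1) u 1 _ (is_derive_cosM (2 * pi) u).
  move=> /is_derive_eqR; apply; rewrite /GRing.scale /=.
  by move: (sin _) => v; move: (pi : R) p0 => p p0; field; rewrite gt_eqF.
rewrite cint_real ri /P.
rewrite mulr0 cos0 /fejer t0 /bern_term -(rmorph_nat (real_complex R)) -2!rmorphM; congr _%:C.
rewrite (_ : 2 * pi * 1%:R * t = 2 * pi * t); last by rewrite mulr1.
by move: (cos _) => v; move: (pi : R) p0 => p p0; field; rewrite !gt_eqF.
Qed.

Lemma mellin_fejer s : 0 < complex.Re s < 1 -> mellin fejer s = 2 / (2 - s) * mellin (@sinc R) s.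
Proof.
move=> s01; have /andP[s0 s1] := s01.
have Re2 : complex.Re (2 : R[i]) = 2 by rewrite -(rmorph_nat (real_complex R)).
have L2 : mellin_class (complex.Re s) (tail_pow (2 : R[i])).
  by apply: mellin_class_tail_pow; rewrite Re2; lra.
have Ls := mellin_class_sinc s01.
have -> : fejer = (fun t => 2 * mconv (tail_pow 2) (@sinc R) t) by apply/funext => t; rewrite mconv_sinc_fejer.
rewrite (mellinZ _ (mellin_class_mconv L2 Ls))// (mellin_mconv L2 Ls)// mellin_tail_pow ?mulrA//.
by rewrite Re2; lra.
Qed.

Definition tri_ker t : R[i] := if 0 < t then (tri t / t ^+ 2)%:C else 0.

(** Because fejer(n t) = bern_term (n-1) t / t^2, the sum over dilates is the Fourier series above.
    The trivial weight and the inverted dilation factor match the format of [mellin_zeta]. *)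
Lemma cvg_fejer_tri t : series (fun n => (1%:C : R[i]) * fejer (t / n.+1%:R^-1) : R[i]^o) @ \oo -->
  (tri_ker t : R[i]^o).
Proof.
rewrite /tri_ker; case: ifPn => [t0|]; last first.
  rewrite -leNgt => t0; apply: (@cvgC_stationary R 0) => N _.
  rewrite /series /= big1// => k _; rewrite fejer_le0 ?mulr0// invrK.
  by rewrite mulr_le0_ge0.
have c1 : (fun N => bern_sum N t / t ^+ 2) @ \oo --> tri t / t ^+ 2.
  by apply: cvgMl; exact: cvg_bern_sum (ltW t0).
apply: (@cvgC_eq R (fun N => (bern_sum N t / t ^+ 2)%:C)); last first.
  by apply/cvgC_ReIm; split; [exact: c1|exact: cvg_cst].
move=> N; rewrite /series /= big_mkord /bern_sum mulr_suml rmorph_sum; apply: eq_bigr => k _.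
rewrite mul1r invrK /fejer mulr_gt0//; congr _%:C; rewrite /bern_term.
rewrite (_ : 2 * pi * 1%:R * (t * k.+1%:R) = 2 * pi * k.+1%:R * t); last by ring.
have k0 : k.+1%:R != 0 :> R by rewrite pnatr_eq0.
have p0 : (pi : R) != 0 by rewrite gt_eqF// pi_gt0.
move: (cos _) => v; move: (k.+1%:R : R) k0 (pi : R) p0 => a a0 p p0.
by field; rewrite a0 p0 gt_eqF.
Qed.

Lemma tri_bounds x : 0 <= x -> 0 <= tri x <= 1.
Proof.
move=> x0; have /andP[t1 t2] := truncn_itv x0; rewrite /tri.
have : x - (Num.truncn x)%:R < 1 by rewrite ltrBlDr addrC natr1.
have : 0 <= x - (Num.truncn x)%:R by rewrite subr_ge0.
move: (x - _) => y y0 y1; apply/andP; split; nra.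
Qed.

Lemma tri_unit x : 0 < x <= 1 -> tri x = x - x ^+ 2.
Proof.
move=> /andP[x0]; rewrite le_eqVlt => /predU1P[->|x1]; rewrite /tri.
  have -> : Num.truncn (1 : R) = 1%N by exact: (@natrK R 1).
  by rewrite subrr expr1n expr0n !subrr.
have -> : Num.truncn x = 0%N.
  have /andP[h _] := truncn_itv (ltW x0); apply/eqP; rewrite -leqn0 -ltnS -(ltr_nat R).
  exact: le_lt_trans h x1.
by rewrite subr0.
Qed.

(** On ]0, 1] the function [tri_ker] equals 1 / t - 1. Removing that part leaves a function
    supported in [1, oo[, whose transform is analytic on all of Re s < 2; the removed part
    contributes 1 / (s - 1) - 1 / s. *)
Definition tri_tail t : R[i] := tri_ker t - head_pow 1 t + head_pow 0 t.

Lemma tri_tailE t : tri_tail t = if 1 <= t then (tri t / t ^+ 2)%:C else 0.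
Proof.
rewrite /tri_tail /tri_ker head_pow1 head_pow0.
case: (ltP 0 t) => [t0|t0] /=; last by rewrite subr0 addr0 leNgt (le_lt_trans t0 ltr01).
have [t1|t1|t1] := ltgtP t 1.
- rewrite -rmorphB -rmorphD; rewrite tri_unit ?t0 ?(ltW t1)// (_ : _ + _ = 0)//.
  by field; rewrite gt_eqF.
- by rewrite subr0 addr0.
- by rewrite t1 invr1 subrK.
Qed.

Lemma cmeasurable_tri_ker : cmeasurable setT tri_ker.
Proof.
have h (t : R) := @cvg_fejer_tri t.
apply: (@cmeasurable_cvg _ _ _ setT (fun N t => series (fun n => (1%:C : R[i]) * fejer (t / n.+1%:R^-1) : R[i]^o) N)).
- exact: measurableT.
- move=> N; rewrite /series /=; elim: N => [|N ih].
    by under eq_fun do rewrite big_geq//; exact: cmeasurable_cst.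
  under eq_fun do rewrite big_nat_recr//=; apply: cmeasurableD => //.
  apply: cmeasurableM; first exact: cmeasurable_cst.
  have [mr mi] := cmeasurable_fejer; split.
    by apply: (measurableT_comp mr); exact: measurable_funM.
  by apply: (measurableT_comp mi); exact: measurable_funM.
- by move=> t _; exact: h.
Qed.

Lemma mellin_class_tri_tail c : c < 2 -> mellin_class c tri_tail.
Proof.
move=> c2; have L2 : mellin_class c (tail_pow (2%:R : R[i])).
  by apply: mellin_class_tail_pow; rewrite -(rmorph_nat (real_complex R)).
apply: (mellin_class_le _ _ L2 L2).
- apply: cmeasurableD; last exact: cmeasurable_head_pow.
  by apply: cmeasurableB; [exact: cmeasurable_tri_ker|exact: cmeasurable_head_pow].
- by move=> t t0; rewrite tri_tailE leNgt (le_lt_trans t0 ltr01).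
move=> t t0; rewrite tri_tailE tail_pow_nat; case: ifPn => t1; last by rewrite cabs0 addr0.
have /andP[h0 h1] := tri_bounds (ltW t0).
have p2 : 0 <= (t ^+ 2)^-1 by rewrite invr_ge0 sqr_ge0.
rewrite !cabs_real !ger0_norm// ?mulr_ge0//.
have : tri t / t ^+ 2 <= (t ^+ 2)^-1 by rewrite ler_piMl.
lra.
Qed.

Lemma mellin_tri_ker s : 1 < complex.Re s < 2 ->
  mellin tri_ker s = mellin tri_tail s + ((s - 1)^-1 - s^-1).
Proof.
move=> /andP[c1 c2].
have -> : tri_ker = fun t => tri_tail t + (head_pow 1 t - head_pow 0 t).
  by apply/funext => t; rewrite /tri_tail; ring.
have L1 : mellin_class (complex.Re s) (@head_pow R 1) by exact: mellin_class_head_pow.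
have L0 : mellin_class (complex.Re s) (@head_pow R 0) by apply: mellin_class_head_pow => /=; lra.
rewrite (mellinD (mellin_class_tri_tail c2) (mellin_classB L1 L0))// (mellinB L1 L0)//.
by rewrite !mellin_head_pow//= ?subr0//; lra.
Qed.

Definition ramp t : R[i] := tail_pow 1 t - tail_pow 2 t.

(** Only the indices up to m, the integer part of [t], contribute, and the sum is m / t - m (m + 1)
    / (2 t^2). On the transform side it produces zeta (1 - s) for Re s < 0. *)
Lemma cvg_ramp t : series (fun n => ((n.+1%:R^-1)%:C : R[i]) * ramp (t / n.+1%:R) : R[i]^o) @ \oo -->
  (2^-1 * (tail_pow 0 t - tail_pow 1 t + tri_tail t) : R[i]^o).
Proof.
have rE (x : R) : ramp x = if 1 <= x then (x^-1 - (x ^+ 2)^-1)%:C else 0.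
  rewrite /ramp tail_pow1 -[2]/(2%:R) tail_pow_nat; case: ifP => _; last by rewrite subrr.
  by rewrite rmorphB.
have n0 k : 0 < k.+1%:R :> R by rewrite ltr0n.
rewrite tri_tailE tail_pow1 tail_pow0.
case: (leP 1 t) => t1; last first.
  rewrite subrr addr0 mulr0; apply: (@cvgC_stationary R 0) => N _.
  rewrite /series /= big1// => k _; rewrite rE leNgt ltr_pdivrMr// mul1r.
  by rewrite (lt_le_trans t1) ?ler1n// mulr0.
have t0 : 0 < t by rewrite (lt_le_trans ltr01).
have /andP[m1 m2] := truncn_itv (ltW t0); set m := Num.truncn t in m1 m2.
apply: (@cvgC_stationary R m) => N mN.
have S j : (j <= m)%N -> \sum_(k < j) ((k.+1%:R^-1)%:C : R[i]) * ramp (t / k.+1%:R) =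
    (j%:R / t - j%:R * (j%:R + 1) / (2 * t ^+ 2))%:C.
  elim: j => [|j ih] jm; first by rewrite big_ord0 !mul0r subrr.
  rewrite big_ord_recr /= (ih (ltnW jm)) rE ler_pdivlMr// mul1r.
  rewrite (le_trans _ m1) ?ler_nat// -rmorphM -rmorphD; congr _%:C.
  rewrite -natr1; have := n0 j; rewrite -natr1; move: (j%:R : R) => a a0.
  by field; rewrite !gt_eqF.
rewrite /series /= (big_cat_nat (leq0n m) mN)/= [X in _ + X]big_nat [X in _ + X]big1 ?addr0; last first.
  move=> k /andP[mk _]; rewrite rE leNgt ltr_pdivrMr// mul1r (lt_le_trans m2) ?mulr0//.
  by rewrite ler_nat ltnS.
rewrite big_mkord S// -(rmorph_nat (real_complex R) 2) -fmorphV -rmorphB -rmorphD -rmorphM.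
congr _%:C; rewrite /tri -/m; move: (m%:R : R) => a.
by field; rewrite gt_eqF.
Qed.

Lemma mellin_class_ramp c : c < 1 -> mellin_class c ramp.
Proof.
move=> c1; apply: mellin_classB; apply: mellin_class_tail_pow => //.
by rewrite -(rmorph_nat (real_complex R)) /=; lra.
Qed.

Lemma mellin_ramp s : complex.Re s < 1 -> mellin ramp s = (1 - s)^-1 - (2 - s)^-1.
Proof.
move=> s1; have Re2 : complex.Re (2 : R[i]) = 2 by rewrite -(rmorph_nat (real_complex R)).
have L1 : mellin_class (complex.Re s) (@tail_pow R 1) by exact: mellin_class_tail_pow.
have L2 : mellin_class (complex.Re s) (@tail_pow R 2) by apply: mellin_class_tail_pow; rewrite Re2; lra.
by rewrite (mellinB L1 L2)// !mellin_tail_pow// Re2; lra.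
Qed.

End ZetaKernels.

(** * Continuation of zeta and its values on the critical line *)

Section ZetaLine.
Variable R : realType.
Local Notation leb := (@lebesgue_measure R).
Variable zeta : R[i] -> R[i].
Hypothesis Hzeta : is_riemann_zeta zeta.
Implicit Types (f g : R -> R[i]) (c t tau x : R) (s z v : R[i]) (n k N : nat).

Let zeta_sum s : 1 < complex.Re s ->
  (fun N => \sum_(n < N) cpow n.+1%:R (- s)) @ \oo --> (zeta s : R[i]^o).
Proof. by move=> /Hzeta.1; apply: cvgC_eq => N; rewrite /series /= big_mkord. Qed.

Let zeta_analytic s : s != 1 -> analytic_at zeta s.
Proof. exact: Hzeta.2. Qed.

Lemma zeta_sum_bounded c N : 1 < c ->
  \sum_(n < N) expR (- (c * ln n.+1%:R)) <= complex.Re (zeta c%:C).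
Proof.
move=> c1; have /cvgC_ReIm[h _] := @zeta_sum c%:C c1.
have E M : complex.Re (\sum_(n < M) cpow n.+1%:R (- c%:C)) = \sum_(n < M) expR (- (c * ln n.+1%:R)).
  rewrite (raddf_sum (@complex.Re R)); apply: eq_bigr => n _.
  by rewrite -rmorphN cpow_real /= mulNr.
rewrite -(cvg_lim _ h)// -E; apply: nondecreasing_cvgn_le.
  apply/nondecreasing_seqP => M; rewrite !E big_ord_recr /= lerDl; exact: expR_ge0.
by apply/cvg_ex; eexists; exact: h.
Qed.

(** Summation over dilates multiplies the transform by the Dirichlet series; absolute convergence
    comes from zeta at Re z. The weights are kept general in order to cover z = 1 - s with [ramp]
    and z = s with [fejer]. *)
Lemma mellin_zeta c g (F : R -> R[i]) (w u : nat -> R) s z : mellin_class c g ->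
  complex.Re s = c -> 1 < complex.Re z -> (forall n, 0 < u n) ->
  (forall n, (w n)%:C * cpow (u n) s = cpow n.+1%:R (- z)) ->
  (forall t, series (fun n => (w n)%:C * g (t / u n) : R[i]^o) @ \oo --> (F t : R[i]^o)) ->
  mellin F s = zeta z * mellin g s.
Proof.
move=> Lg sc z1 u0 wu gF; have [mg g0 Ig] := Lg.
have msc n : cmeasurable setT (fun t => g (t / u n)).
  have [mr mi] := mg; split.
    by apply: (measurableT_comp mr); exact: measurable_funM.
  by apply: (measurableT_comp mi); exact: measurable_funM.
pose f_ n t := (w n)%:C * g (t / u n) * cpow t (s - 1).
have mf n : cmeasurable setT (f_ n).
  apply: cmeasurableM; last exact: cmeasurable_cpow_id.
  by apply: cmeasurableM => //; exact: cmeasurable_cst.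
have L n : mellin_class c (fun t => g (t / u n)).
  split => // [t t0|]; first by rewrite g0// mulr_le0_ge0// invr_ge0 ltW.
  by rewrite (mellin_scale_abs Lg (u0 n)) lte_mul_pinfty// lee_fin expR_ge0.
pose K := fine (\int[leb]_t (cabs (g t) * expR ((c - 1) * ln t))%:E)%E.
have K_ge0 : (0 <= \int[leb]_t (cabs (g t) * expR ((c - 1) * ln t))%:E)%E.
  by apply: integral_ge0 => t _; rewrite lee_fin mulr_ge0 ?cabs_ge0 ?expR_ge0.
have KE : (\int[leb]_t (cabs (g t) * expR ((c - 1) * ln t))%:E)%E = K%:E.
  by rewrite fineK// ge0_fin_numE.
have K0 : 0 <= K by rewrite -lee_fin -KE.
have wE n : `|w n| * expR (c * ln (u n)) = expR (- (complex.Re z * ln n.+1%:R)).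
  have := congr1 (@Normc.normc R) (wu n).
  by rewrite (Normc.normcM (w n)%:C) cabs_real !cabs_cpow sc ReN mulNr.
have I n : (\int[leb]_(t in setT) (cabs (f_ n t))%:E)%E = (expR (- (complex.Re z * ln n.+1%:R)) * K)%:E.
  transitivity (\int[leb]_(t in setT) (`|w n|%:E * (cabs (g (t / u n)) * expR ((c - 1) * ln t))%:E))%E.
    apply: eq_integral => t _; rewrite -EFinM /f_ -mulrA (Normc.normcM (w n)%:C) cabs_real.
    by rewrite (cabs_mellin (fun t => g (t / u n))) sc.
  rewrite ge0_integralZl//; last 2 first.
  - apply/measurable_EFinP; apply: measurable_funM; last exact: measurable_mellin_weight.
    exact: (measurable_cabs (msc n)).
  - by move=> t _; rewrite lee_fin mulr_ge0 ?cabs_ge0 ?expR_ge0.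
  by rewrite (mellin_scale_abs Lg (u0 n)) KE -!EFinM mulrA wE.
have hint : (\sum_(0 <= n <oo) \int[leb]_(t in setT) (cabs (f_ n t))%:E < +oo)%E.
  apply: (@le_lt_trans _ _ (complex.Re (zeta (complex.Re z)%:C) * K)%:E); last exact: ltry.
  apply: lime_le.
    by apply: is_cvg_nneseries => n _ _; apply: integral_ge0 => t _; rewrite lee_fin cabs_ge0.
  apply: nearW => N; under eq_bigr do rewrite I.
  by rewrite sumEFin lee_fin -mulr_suml ler_wpM2r// big_mkord zeta_sum_bounded.
have pt (t : R) : setT t -> series (fun n => f_ n t : R[i]^o) @ \oo --> (F t * cpow t (s - 1) : R[i]^o).
  move=> _; have kc : (fun _ : nat => cpow t (s - 1)) @ \oo --> (cpow t (s - 1) : R[i]^o) by exact: cvgC_cst.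
  apply: cvgC_eq (cvgC_seqM (gF t) kc) => N.
  by rewrite /series /= mulr_suml.
have [_ h1] := @cint_series _ (measurableTypeR R) R leb setT measurableT f_
  (fun t => F t * cpow t (s - 1)) mf pt hint.
have h2 : (fun N => \sum_(n < N) cpow n.+1%:R (- z) * mellin g s) @ \oo --> (mellin F s : R[i]^o).
  apply: cvgC_eq h1 => N; rewrite /series /= big_mkord; apply: eq_bigr => n _.
  rewrite -wu -mulrA -(mellin_scale Lg sc (u0 n)) -(mellinZ _ (L n) sc).
  by [].
apply: (cvgC_unique h2).
have kc : (fun _ : nat => mellin g s) @ \oo --> (mellin g s : R[i]^o) by exact: cvgC_cst.
by apply: cvgC_eq (cvgC_seqM (zeta_sum z1) kc) => N; rewrite mulr_suml.
Qed.

Lemma near_strip (a b : R) s : a < complex.Re s < b ->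
  \forall z \near (s : R[i]^o), a < complex.Re z < b.
Proof.
move=> /andP[sa sb]; apply/nbhsC.
exists (Num.min (complex.Re s - a) (b - complex.Re s)); first by rewrite lt_min !subr_gt0 sa.
move=> z; rewrite lt_min => /andP[h1 h2]; have := Re_le_cabs (z - s).
by rewrite ReD ReN ler_norml => /andP[h3 h4]; apply/andP; split; lra.
Qed.

Lemma near_nonreal s : complex.Im s != 0 -> \forall z \near (s : R[i]^o), complex.Im z != 0.
Proof.
move=> s0; apply/nbhsC; exists `|complex.Im s|; first by rewrite normr_gt0.
move=> z zs; apply: contraTneq zs => z0; rewrite -leNgt.
by have := Im_le_cabs (z - s); rewrite ImD ImN z0 sub0r normrN.
Qed.

Lemma Re_nat n : complex.Re (n%:R : R[i]) = n%:R.
Proof. by rewrite -(rmorph_nat (real_complex R)). Qed.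

Lemma analytic_sub (w : R[i]) s : analytic_at (fun z => w - z) s.
Proof.
apply: (@analytic_at_near _ (fun z => w + (-1) * z)).
  by apply/nbhsC; exists 1 => // z _; rewrite mulN1r.
by apply: analyticD (analytic_cst _ _) _; apply: analyticM (analytic_cst _ _) (analytic_id _).
Qed.

Lemma analytic_zeta1 s : s != 0 -> analytic_at (fun z => zeta (1 - z)) s.
Proof.
move=> s0; apply: analytic_sub1; apply: zeta_analytic.
by apply: contraNneq s0 => /(congr1 (fun z => 1 - z)); rewrite subKr subrr => ->.
Qed.

(** The transform of the sum of dilated ramps is evaluated in two ways. Denominators are cleared so
    that the right-hand side makes sense up to Re s < 2. *)
Lemma zeta_left s : complex.Re s < 0 ->
  2 * s * zeta (1 - s) = s - 2 + s * (1 - s) * (2 - s) * mellin (@tri_tail R) s.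
Proof.
move=> s0.
have s1 : complex.Re s < 1 by lra.
have s2 : complex.Re s < 2 by lra.
have r1 : 1 < complex.Re (1 - s) by rewrite ReD ReN /=; lra.
have L := mellin_class_ramp s1.
have n0 (n : nat) : 0 < n.+1%:R :> R by rewrite ltr0n.
have wu n : (n.+1%:R^-1)%:C * cpow n.+1%:R s = cpow n.+1%:R (- (1 - s)).
  rewrite (_ : - (1 - s) = s + - 1); last by rewrite opprB.
  by rewrite cpowD cpowN cpow_id// -fmorphV mulrC.
have := mellin_zeta L erefl r1 n0 wu (@cvg_ramp R).
have L0 : mellin_class (complex.Re s) (@tail_pow R 0) by exact: mellin_class_tail_pow.
have L1 : mellin_class (complex.Re s) (@tail_pow R 1) by exact: mellin_class_tail_pow.
have Lt := mellin_class_tri_tail s2.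
rewrite (mellinZ _ (mellin_classD (mellin_classB L0 L1) Lt))// (mellinD (mellin_classB L0 L1) Lt)//.
rewrite (mellinB L0 L1)// !mellin_tail_pow// mellin_ramp// sub0r => e.
have a0 : s != 0 by apply: contraTneq s0 => ->; rewrite ltxx.
have a1 : 1 - s != 0 by apply: contraTneq s1 => /eqP; rewrite subr_eq0 => /eqP <-; rewrite /= ltxx.
have a2 : 2 - s != 0 by apply: contraTneq s2 => /eqP; rewrite subr_eq0 => /eqP <-; rewrite Re_nat ltxx.
move: (mellin _ s) (zeta _) e => m ze e.
have {}e : ze * (1 - s)^-1 * (2 - s)^-1 = 2^-1 * ((- s)^-1 - (1 - s)^-1 + m).
  by rewrite e; field; rewrite a1 a2.
have -> : 2 * s * ze = 2 * s * (1 - s) * (2 - s) * (ze * (1 - s)^-1 * (2 - s)^-1).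
  by field; rewrite a1 a2.
by rewrite e; field; rewrite a0 a1.
Qed.

Lemma nonreal_seg s (x t : R) : complex.Im s != 0 -> complex.Im (s + t%:C * x%:C) != 0.
Proof. by rewrite ImD ImM /= mulr0 mul0r !addr0. Qed.

Lemma Re_seg s (x t : R) : complex.Re (s + t%:C * x%:C) = complex.Re s + t * x.
Proof. by rewrite ReD ReM /= mulr0 subr0. Qed.

Lemma nonreal_neq s (a : R) : complex.Im s != 0 -> s != a%:C.
Proof. by apply: contraNneq => ->. Qed.

(** The identity is continued from abscissa -1, where [zeta_left] holds nearby, along a horizontal
    segment. Staying off the real axis avoids s = 0, where zeta (1 - s) is not known to be
    analytic. *)
Lemma zeta_half_plane s : complex.Im s != 0 -> complex.Re s < 2 ->
  2 * s * zeta (1 - s) = s - 2 + s * (1 - s) * (2 - s) * mellin (@tri_tail R) s.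
Proof.
move=> s0 s2; have [sneg|spos] := ltP (complex.Re s) 0; first exact: zeta_left.
pose x := complex.Re s + 1; pose p := s - x%:C.
have pR : complex.Re p = -1 by rewrite /p /x ReD ReN /=; ring.
have p0 : complex.Im p != 0 by rewrite /p ImD ImN /= subr0.
have -> : s = p + x%:C by rewrite /p subrK.
have x0 : 0 < x by rewrite /x; lra.
have bnd t : 0 <= t <= 1 -> complex.Re (p + t%:C * x%:C) < 2.
  move=> /andP[t0 t1]; rewrite Re_seg pR.
  have : t * x <= x by rewrite ger_pMl.
  by rewrite {2}/x; lra.
apply: (@analytic_segment _ (fun s => 2 * s * zeta (1 - s))
  (fun s => s - 2 + s * (1 - s) * (2 - s) * mellin (@tri_tail R) s)) => [t _|t t01|].
- apply: analyticM; first exact: analyticM (analytic_cst _ _) (analytic_id _).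
  by apply: analytic_zeta1; apply: (nonreal_neq 0); exact: nonreal_seg.
- apply: analyticD; first exact: analyticD (analytic_id _) (analytic_cst _ _).
  apply: analyticM; first exact: analyticM (analyticM (analytic_id _) (analytic_sub _ _)) (analytic_sub _ _).
  have b := bnd _ t01; set q := p + _ in b *.
  have d0 : 0 < (2 - complex.Re q) / 2 by rewrite divr_gt0// subr_gt0.
  by apply: (@analytic_mellin _ (complex.Re q) _ _ _ d0) => //; apply: mellin_class_tri_tail; lra.
- have : -2 < complex.Re p < 0 by rewrite pR; apply/andP; split; lra.
  by move=> /near_strip; apply: filterS => z /andP[_]; exact: zeta_left.
Qed.

(** The sum of Fejer dilates expresses the transform of [tri_tail] through zeta (s), and
    [zeta_half_plane] expresses it through zeta (1 - s); eliminating it gives the functional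
    equation. *)
Lemma zeta_right s : complex.Im s != 0 -> 1 < complex.Re s < 2 ->
  2 * zeta (1 - s) = (1 - s) * (2 - s) * zeta s * mellin (@fejer R) s.
Proof.
move=> s0 /andP[s1 s2].
have h := zeta_half_plane s0 s2.
have s02 : 0 < complex.Re s < 2 by lra.
have n0 (n : nat) : 0 < n.+1%:R^-1 :> R by rewrite invr_gt0 ltr0n.
have wu n : 1%:C * cpow n.+1%:R^-1 s = cpow n.+1%:R (- s) by rewrite mul1r cpowV ?ltr0n.
have := mellin_zeta (mellin_class_fejer s02) erefl s1 n0 wu (@cvg_fejer_tri R).
rewrite mellin_tri_ker ?s1// => e.
have a0 : s != 0 by exact: (nonreal_neq 0).
have a1 : s - 1 != 0 by rewrite subr_eq0; exact: (nonreal_neq 1).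
move: h e; move: (mellin _ s) (mellin _ s) (zeta s) (zeta _) => mf m z1 ze h e.
have {}e : m = z1 * mf - ((s - 1)^-1 - s^-1) by rewrite -e addrK.
apply: (mulfI a0); have -> : s * (2 * ze) = 2 * s * ze by ring.
by rewrite h e; field; rewrite a0 a1.
Qed.

(** The Fejer form of the equation is continued from abscissa 3/2 to 1/2, and only there is the
    Fejer transform replaced by that of [sinc]. The segment stays off the real axis because tau !=
    0. *)
Lemma zeta_functional_line tau : tau != 0 ->
  zeta (1 - line tau) = (1 - line tau) * mellin (@sinc R) (line tau) * zeta (line tau).
Proof.
move=> t0; pose p : R[i] := (3 / 2) +i* tau.
have lE : line tau = p + (-1)%:C by apply: cplx_eqP; rewrite /= ?addr0//; lra.
have pI : complex.Im p != 0 by [].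
suff : 2 * zeta (1 - line tau) =
    (1 - line tau) * (2 - line tau) * zeta (line tau) * mellin (@fejer R) (line tau).
  rewrite mellin_fejer /=; last by apply/andP; split; lra.
  have a2 : 2 - line tau != 0.
    rewrite subr_eq0 eq_sym -(rmorph_nat (real_complex R)); exact: nonreal_neq.
  move: (mellin _ _) (zeta _) (zeta _) a2 => m z1 z2; move: (line tau) => s a2 e.
  have n2 : (2 : R[i]) != 0 by rewrite pnatr_eq0.
  by apply: (mulfI n2); rewrite e; field.
rewrite lE; apply: (@analytic_segment _ (fun s => 2 * zeta (1 - s))
  (fun s => (1 - s) * (2 - s) * zeta s * mellin (@fejer R) s)) => [t _|t /andP[t1 t2]|].
- apply: analyticM (analytic_cst _ _) _.
  by apply: analytic_zeta1; apply: (nonreal_neq 0); exact: nonreal_seg.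
- have qI := nonreal_seg (-1) t pI; have qR := Re_seg p (-1) t.
  set q := p + _ in qI qR *.
  apply: analyticM; last first.
    (* The abscissas run through [1/2, 3/2]; widened by 1/4 they remain in ]0, 2[, where the Fejer
       transform is defined. *)
    by apply: (@analytic_mellin _ (complex.Re q) 4^-1) => //; apply: mellin_class_fejer;
      rewrite qR /=; apply/andP; split; lra.
  apply: analyticM; last by apply: zeta_analytic; exact: (nonreal_neq 1).
  by apply: analyticM (analytic_sub _ _) (analytic_sub _ _).
- have : 1 < complex.Re p < 2 by rewrite /=; apply/andP; split; lra.
  by move=> /near_strip hs; apply: filterS2 hs (near_nonreal pI) => z h1 h2; exact: zeta_right.
Qed.

Lemma zeta_conj_line tau : tau != 0 -> zeta (1 - line tau) = conjc (zeta (line tau)).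
Proof.
move=> t0; set s := line tau.
have sI : complex.Im s != 0 by [].
have s2 : complex.Re s < 2 by rewrite /=; lra.
have sJ : conjc s = 1 - s by apply: cplx_eqP; rewrite /=; lra.
have sJI : complex.Im (1 - s) != 0 by rewrite ImD ImN /= add0r oppr_eq0.
have sJ2 : complex.Re (1 - s) < 2 by rewrite ReD ReN /=; lra.
have h1 := zeta_half_plane sI s2; have h2 := zeta_half_plane sJI sJ2.
rewrite subKr in h2.
have mJ : mellin (@tri_tail R) (1 - s) = conjc (mellin (@tri_tail R) s).
  rewrite /mellin -(cintJ measurableT (cintegrable_mellin (mellin_class_tri_tail s2) erefl)).
  have cE : conjc (s - 1) = 1 - s - 1 by apply: cplx_eqP; rewrite /=; lra.
  apply: eq_cint => t _; rewrite rmorphM; congr (_ * _); last by rewrite -cE -conj_cpow.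
  rewrite tri_tailE; case: ifP => _; apply: cplx_eqP => //=; lra.
have sK : conjc (1 - s) = s by rewrite -sJ conjcK.
have a1 : 1 - s != 0 by apply: (nonreal_neq 0).
have n2 : 2 * (1 - s) != 0 by rewrite mulf_neq0// pnatr_eq0.
have c2 : conjc (2 : R[i]) = 2 by rewrite rmorph_nat.
apply: (can_inj (@conjcK R)); rewrite conjcK; apply: (mulfI n2); rewrite h2.
have := congr1 (@conjc R) h1.
have cM (x y : R[i]) : conjc (x * y) = conjc x * conjc y.
  by apply: cplx_eqP; rewrite ?ReJ ?ImJ ?ReM ?ImM ?ReJ ?ImJ; ring.
have cD (x y : R[i]) : conjc (x + y) = conjc x + conjc y.
  by apply: cplx_eqP; rewrite ?ReJ ?ImJ ?ReD ?ImD ?ReJ ?ImJ ?opprD.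
have cB (x y : R[i]) : conjc (x - y) = conjc x - conjc y.
  by rewrite cD; congr (_ + _); apply: cplx_eqP; rewrite ?ReJ ?ImJ ?ReN ?ImN ?ReJ ?ImJ.
by rewrite cM cM c2 sJ cD cB c2 sJ 3!cM sJ sK cB c2 sJ -mJ.
Qed.

Lemma zeta_neq0_right tau : zeta (2 +i* tau) != 0.
Proof.
set z := _ +i* _; have z1 : 1 < complex.Re z by rewrite /=; lra.
have n0 n : 0 < n.+1%:R :> R by rewrite ltr0n.
(* The first term is 1/4 and each later 1 / j^2 is at most 1/(j-1) - 1/j. What counts is 3/4 < 1:
   the term 1 of the Dirichlet series cannot be cancelled. *)
have b k : (0 < k)%N -> \sum_(n < k) cabs (cpow n.+2%:R (- z)) <= 3 / 4 - k.+1%:R^-1.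
  case: k => // k _; have E n : cabs (cpow n.+2%:R (- z)) = (n.+2%:R ^+ 2)^-1.
    by rewrite cabs_cpow ReN /= mulNr expRN expRM_natl lnK ?posrE.
  elim: k => [|k ih]; first by rewrite big_ord1 E (_ : (2 ^+ 2)^-1 = 4^-1 :> R); [lra|rewrite -natrX].
  rewrite big_ord_recr /= E; apply: (le_trans (lerD ih (lexx _))).
  rewrite -addrA lerD2l -[k.+3%:R]natr1; have := n0 k.+1; move: (k.+2%:R : R) => a a0.
  have a1 : 0 < a + 1 by rewrite addr_gt0.
  rewrite -subr_ge0 (_ : _ - _ = (a * ((a + 1) ^+ 2))^-1); last by field; rewrite !gt_eqF.
  by rewrite invr_ge0 mulr_ge0 ?sqr_ge0 ?(ltW a0).
have c1 : (fun N => \sum_(n < N.+1) cpow n.+1%:R (- z) - 1) @ \oo --> (zeta z - 1 : R[i]^o).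
  have kc : (fun _ : nat => 1 : R[i]) @ \oo --> (1 : R[i]^o) by exact: cvgC_cst.
  apply: cvgC_seqB kc.
  by rewrite (@cvg_shiftS R[i]^o (fun N => \sum_(n < N) cpow n.+1%:R (- z))); exact: zeta_sum.
have : cabs (zeta z - 1) <= 3 / 4.
  apply: (cabs_lim_le c1); exists 1%N => // N /= N1.
  rewrite big_ord_recl cpow1 addrAC subrr add0r.
  apply: (le_trans (cabs_sum _ _ _)); apply: (le_trans (b _ N1)).
  by rewrite gerBl invr_ge0.
apply: contraTneq => ->; rewrite sub0r cabsN (cabs_real 1) normr1; lra.
Qed.

(** Otherwise zeta would vanish near this point, and by continuation along the horizontal segment
    also at 2 + i tau, against [zeta_neq0_right]. *)
Lemma zeta_line_isolated tau : tau != 0 ->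
  exists2 r : R, 0 < r & forall tau', 0 < `|tau' - tau| < r -> zeta (line tau') != 0.
Proof.
move=> t0; have lI : complex.Im (line tau) != 0 by [].
have la : analytic_at zeta (line tau) by apply: zeta_analytic; exact: (nonreal_neq 1).
have [[r r0 hr]|[r r0 hr]] := analytic_isolated la; last first.
  exists r => // tau' h; apply: hr.
  suff -> : cabs (line tau' - line tau) = `|tau' - tau| by [].
  by rewrite cabsE /= subrr expr0n add0r sqrtr_sqr.
have seg t : 0 <= t <= 1 -> analytic_at zeta (line tau + t%:C * (3 / 2)%:C).
  by move=> _; apply: zeta_analytic; apply: (nonreal_neq 1); exact: nonreal_seg.
have near0 : \forall z \near (line tau : R[i]^o), zeta z = 0 by apply/nbhsC; exists r.
have /nbhsC[e e0 he] := analytic_segment0 seg near0.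
have /negP[] := zeta_neq0_right tau; apply/eqP.
have -> : 2 +i* tau = line tau + (3 / 2)%:C by apply: cplx_eqP; rewrite /= ?addr0//; lra.
by apply: he; rewrite subrr cabs0.
Qed.

(** Each zero with tau != 0 is the only one in some interval with rational end points, so the zeros
    are countable and hence negligible. *)
Lemma zeta_line_neq0 : {ae leb, forall tau, zeta (line tau) != 0}.
Proof.
pose Z := [set tau : R | tau != 0 /\ zeta (line tau) = 0].
pose F (pq : rat * rat) := [set tau | Z tau /\ ratr pq.1 < tau < ratr pq.2 /\
  forall tau', Z tau' -> ratr pq.1 < tau' < ratr pq.2 -> tau' = tau].
have cZ : countable (\bigcup_pq F pq).
  apply: bigcup_countable => // pq _.
  have [->|/set0P[t Ft]] := eqVneq (F pq) set0; first exact: countable0.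
  apply: (@sub_countable _ _ _ [set t]); last exact: countable1.
  by apply: subset_card_le => t' [Zt' [pt' _]] /=; apply: Ft.2.2.
have ZF : Z `<=` \bigcup_pq F pq.
  move=> t Zt; have [r r0 hr] := zeta_line_isolated Zt.1.
  have /rat_in_itvoo[p /[!in_itv]/= /andP[p1 p2]] : t - r < t by rewrite ltrBlDr ltrDl.
  have /rat_in_itvoo[q /[!in_itv]/= /andP[q1 q2]] : t < t + r by rewrite ltrDl.
  exists (p, q) => //; split=> //=; split; first by rewrite p2.
  move=> t' Zt' /andP[h1 h2]; apply/eqP; rewrite -[_ == _]negbK; apply/negP => tt'.
  suff /hr : 0 < `|t' - t| < r by rewrite Zt'.2 eqxx.
  rewrite normr_gt0 subr_eq0 tt' /= ltr_norml; apply/andP; split; lra.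
have aeF : {ae leb, forall tau, ~ (\bigcup_pq F pq) tau}.
  exists (\bigcup_pq F pq); split; [exact: countable_measurable|exact: countable_lebesgue_measure0|].
  by move=> tau /= /contrapT.
have ae0 : {ae leb, forall tau, tau != 0} by apply: (@ae_neq R 0) => tau /eqP.
apply: ae_imp2 aeF ae0 => tau hF t0; apply/eqP => z0.
by apply: hF; apply: ZF.
Qed.

End ZetaLine.

(** * The scalar products *)

Section Kernel.
Variable R : realType.
Local Notation leb := (@lebesgue_measure R).
Implicit Types (f g h phi F : R -> R[i]) (t u p lam : R) (s z w rho : R[i]) (k : nat).

Let Pos : set R := `]0, +oo[%classic.

Lemma near_lt_eq u p : u <> p -> \forall t \near u, (t < p) = (u < p) /\ (p < t) = (p < u).
Proof.
move=> /eqP up; apply/nbhs_ballP; exists `|u - p|; first by rewrite /= normr_gt0 subr_eq0.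
move=> t; rewrite /ball /= ltr_norml => /andP[h1 h2].
have [p0|p0] := ltP u p.
  rewrite ltr0_norm ?subr_lt0// in h1 h2.
  have tp : t < p by lra.
  by rewrite tp (ltNge p t) (ltW tp) (ltNge p u) (ltW p0).
have pu : p < u by rewrite lt_neqAle eq_sym up.
rewrite gtr0_norm ?subr_gt0// in h1 h2.
have pt : p < t by lra.
by rewrite pt pu ltNge (ltW pt).
Qed.

Lemma near_cst_cvg f u (c : R[i]) : (\forall t \near u, f t = c) -> f t @[t --> u] --> (c : R[i]^o).
Proof.
move=> h; apply/cvgC_cabs; apply/(@cvgrPdist_lt _ R^o) => e e0; apply: filterS h => t ->.
by rewrite subrr cabs0 subrr normr0.
Qed.

Lemma chi1_psi : @chi1 R = fun t => psi 0 0 t - psi 0 1 t.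
Proof.
apply/funext => t; rewrite /chi1 /psi /chi; case: ifPn => [/andP[t0 _]|_]; last by rewrite !mulr0 subrr.
by rewrite oppr0 cpow0 !mulr1 -rmorphB expr0 expr1 lnV ?posrE// opprK.
Qed.

Lemma mellin_class_chi1 : mellin_class 2^-1 (@chi1 R).
Proof.
have h : complex.Re (0 : R[i]) < 2^-1 by rewrite /= invr_gt0 ltr0n.
by rewrite chi1_psi; apply: mellin_classB; [have [] := mellin_psi 0 h|have [] := mellin_psi 1 h].
Qed.

Lemma mellin_chi1 s : complex.Re s = 2^-1 -> mellin (@chi1 R) s = (s - 1) / s ^+ 2.
Proof.
move=> sc; have h : complex.Re (0 : R[i]) < 2^-1 by rewrite /= invr_gt0 ltr0n.
have [L0 E0] := mellin_psi 0 h; have [L1 E1] := mellin_psi 1 h.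
have s0 : s != 0 by apply: contra_eq_neq sc => ->; rewrite eq_sym invr_neq0.
by rewrite chi1_psi (mellinB L0 L1 sc) (E0 _ sc) (E1 _ sc) subr0 expr1 fact0 (_ : 1`! = 1)%N//; field.
Qed.

Lemma half_bounded_chi1 : half_bounded (@chi1 R).
Proof.
(* Here 5 = 1 + 4: the constant 1 of chi_1, and the constant of [ln_pow_le] for the first power of
   the logarithm. *)
exists 5 => t t0; rewrite /chi1 /chi t0 /=; case: ifPn => t1; last first.
  by rewrite mulr0 cabs0 mulr_ge0// expR_ge0.
rewrite mulr1 cabs_real; have l0 : 0 <= - ln t by rewrite oppr_ge0 ln_le0.
have := ln_pow_le 1 l0; rewrite !expr1 mulr1 => h.
have h2 : expR (4^-1 * - ln t) <= expR (- (2^-1 * ln t)) by rewrite ler_expR; lra.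
have : expR 0 <= expR (- (2^-1 * ln t)) by rewrite ler_expR; lra.
rewrite expR0 => h3; apply: (le_trans (ler_normD _ _)).
rewrite normr1 -normrN ger0_norm//; lra.
Qed.

Lemma cvg_chi1 u : 0 < u -> u <> 1 -> chi1 t @[t --> u] --> (chi1 u : R[i]^o).
Proof.
move=> u0 u1; have [l1|l1] := ltP u 1.
  apply: (@cvg_trans _ ((fun t => (1 + ln t)%:C : R[i]^o) @ u)).
    apply: near_eq_cvg; near=> t.
    have [h1 _] : (t < 1) = (u < 1) /\ (1 < t) = (1 < u) by near: t; exact: near_lt_eq.
    have [_ h0] : (t < 0) = (u < 0) /\ (0 < t) = (0 < u).
      by near: t; apply: near_lt_eq => e; rewrite e ltxx in u0.
    by rewrite /chi1 /chi h0 u0 ltW ?mulr1// h1.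
  have -> : chi1 u = (1 + ln u)%:C by rewrite /chi1 /chi u0 (ltW l1) mulr1.
  have c : (1 + ln t)%:C @[t --> u] --> ((1 + ln u)%:C : R[i]^o).
    apply/cvgC_ReIm; split => /=; last exact: cvg_cst.
    by apply: cvgD; [exact: cvg_cst|exact: continuous_ln].
  exact: c.
have l2 : 1 < u by rewrite lt_neqAle l1 andbT eq_sym; apply/eqP.
have -> : chi1 u = 0 by rewrite /chi1 /chi (leNgt u) l2 andbF mulr0.
apply: near_cst_cvg; near=> t.
have [_ h1] : (t < 1) = (u < 1) /\ (1 < t) = (1 < u) by near: t; exact: near_lt_eq.
by rewrite /chi1 /chi (leNgt t) h1 l2 andbF mulr0.
Unshelve. all: by end_near.
Qed.

(** This is (1 - Q_lam) G. Its jump at [lam] is the exceptional point allowed in the Parseval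
    formulas. *)
Definition kGl lam t : R[i] := kG t * (\1_(`]-oo, lam[%classic : set R) t)%:C.

Lemma kGlE lam t : kGl lam t = if t < lam then kG t else 0.
Proof.
rewrite /kGl indicE mem_setE in_itv /=.
by case: ifPn => _; rewrite ?mulr1 ?mulr0.
Qed.

Lemma mellin_class_kGl lam : mellin_class 2^-1 (kGl lam).
Proof. by apply: mellin_class_mul_indic; [exact: measurable_itv|exact: mellin_class_kG (half01 R)]. Qed.

Lemma half_bounded_kGl lam : half_bounded (kGl lam).
Proof.
have [B h] := half_bounded_kG R; exists B => t t0; rewrite kGlE; case: ifP => _; first exact: h.
by rewrite cabs0 (le_trans (cabs_ge0 _) (h t t0)).
Qed.

Lemma cvg_kGl lam u : 0 < u -> u <> lam -> kGl lam t @[t --> u] --> (kGl lam u : R[i]^o).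
Proof.
move=> u0 ul; rewrite kGlE; case: ifPn => l1.
  apply: (@cvg_trans _ ((fun t => kG t : R[i]^o) @ u)); last exact: cvg_kG.
  apply: near_eq_cvg; near=> t.
  have [h _] : (t < lam) = (u < lam) /\ (lam < t) = (lam < u) by near: t; exact: near_lt_eq.
  by rewrite kGlE h l1.
apply: near_cst_cvg; near=> t.
have [h _] : (t < lam) = (u < lam) /\ (lam < t) = (lam < u) by near: t; exact: near_lt_eq.
by rewrite kGlE h (negbTE l1).
Unshelve. all: by end_near.
Qed.

Lemma L2_cmeasurable (D : set R) f : L2 D f -> cmeasurable D f.
Proof. by case. Qed.

Lemma sqL2norm_kG : (sqL2norm Pos (@kG R) < +oo)%E.
Proof.
rewrite sqL2norm_zext (_ : zext _ = @kG R).
  exact: sqL2norm_half_bounded (mellin_class_kG (half01 R)) (half_bounded_kG R).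
by apply/funext => t; rewrite /zext; case: ltP => // /kG_le0.
Qed.

Lemma sqL2norm_chi1 : (sqL2norm Pos (@chi1 R) < +oo)%E.
Proof.
rewrite sqL2norm_zext (_ : zext _ = @chi1 R).
  exact: sqL2norm_half_bounded mellin_class_chi1 half_bounded_chi1.
by apply/funext => t; rewrite /zext /chi1 /chi; case: (ltP 0 t) => //= _; rewrite mulr0.
Qed.

Lemma cmeasurableS (D : set R) f : measurable D -> cmeasurable setT f -> cmeasurable D f.
Proof. by move=> mD [rf jf]; split; exact: measurable_funTS. Qed.

Lemma inner_kGl lam g : L2 Pos g ->
  inner (@kG R) g - inner (@kG R) (Q lam g) = inner (kGl lam) g.
Proof.
move=> Lg; have mg := L2_cmeasurable Lg; have [_ _ hg] := Lg.
have mP : measurable Pos by exact: measurable_itv.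
have mk : cmeasurable Pos (@kG R) by apply: cmeasurableS => //; exact: cmeasurable_kG.
have I := cintegrable_pairing mP mk mg sqL2norm_kG hg.
have QE t : kG t * conjc (Q lam g t) = kG t * conjc (g t) * (\1_(`[lam, +oo[%classic : set R) t)%:C.
  rewrite /Q indicE mem_setE in_itv /= andbT; case: ifP => _; rewrite ?mulr1//.
  by rewrite rmorph0 !mulr0.
have I2 : cintegrable leb Pos (fun t => kG t * conjc (Q lam g t)).
  apply: (@le_cintegrable _ (measurableTypeR R) R leb Pos mP _ (fun t => cabs (kG t * conjc (g t)))).
  - under [X in cmeasurable _ X]eq_fun do rewrite QE.
    apply: cmeasurableM; first exact: (cintegrable_meas I).
    by apply: cmeasurable_indic; exact: measurable_itv.
  - exact: (@cintegrable_cabs _ (measurableTypeR R) R leb Pos mP _ I).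
  - move=> t _; rewrite QE (Normc.normcM (kG t * _)) cabs_real indicE.
    by case: (_ \in _); rewrite ?normr1 ?normr0 ?mulr1 ?mulr0// cabs_ge0.
rewrite -[inner _ g in LHS]/(cint leb Pos (fun t => kG t * conjc (g t))).
rewrite -[inner _ (Q lam g)]/(cint leb Pos (fun t => kG t * conjc (Q lam g t))).
rewrite -(@cintB _ (measurableTypeR R) R leb Pos mP _ _ I I2); apply: eq_cint => t _; rewrite kGlE /Q.
by case: (ltP t lam) => _; rewrite ?rmorph0 ?mulr0 ?subr0 ?subrr ?mul0r.
Qed.

(* On ]0, lam[ one has [t^(-3/4) <= lam^(1/8) t^(-7/8)]. *)
Lemma kGl_kgs_bound (W : R) k : exists2 D : R, 0 <= D & forall w lam, 0 < lam < 1 ->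
  complex.Re w <= 2^-1 -> cabs w <= W ->
  cintegrable leb setT (fun t => kGl lam t * conjc (kgs w k t)) ->
  cabs (cint leb setT (fun t => kGl lam t * conjc (kgs w k t))) <= D * expR (8^-1 * ln lam).
Proof.
have [C hC] := kgs_bound W k.
(* Membership at abscissa 1/8 of the indicator of ]0, 1] means that t^(-7/8) is integrable there.
   The factor 6 in the constant below is the bound of [kG]. *)
have L : mellin_class (8^-1) (@head_pow R 0) by apply: mellin_class_head_pow => /=; rewrite invr_gt0.
have [mh h0 Ih] := L.
pose K := fine (\int[leb]_t (cabs (@head_pow R 0 t) * expR ((8^-1 - 1) * ln t))%:E)%E.
have K_ge0 : (0 <= \int[leb]_t (cabs (@head_pow R 0 t) * expR ((8^-1 - 1) * ln t))%:E)%E.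
  by apply: integral_ge0 => t _; rewrite lee_fin mulr_ge0 ?cabs_ge0 ?expR_ge0.
have KE : (\int[leb]_t (cabs (@head_pow R 0 t) * expR ((8^-1 - 1) * ln t))%:E)%E = K%:E.
  by rewrite fineK// ge0_fin_numE.
have K0 : 0 <= K by rewrite -lee_fin -KE.
exists (6 * `|C| * K *+ 2); first by rewrite mulrn_wge0// !mulr_ge0.
move=> w lam /andP[l0 l1] w2 wW I.
rewrite (mulrnAl (6 * `|C| * K)); apply: (@le_cabs_cint _ (measurableTypeR R) R leb setT measurableT _ _ I).
pose A := 6 * `|C| * expR (8^-1 * ln lam).
have A0 : 0 <= A by rewrite !mulr_ge0 ?expR_ge0.
apply: (@le_trans _ _ (\int[leb]_t (A%:E * (cabs (@head_pow R 0 t) * expR ((8^-1 - 1) * ln t))%:E))%E).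
  apply: ge0_le_integral => //.
  - by move=> t _; rewrite lee_fin cabs_ge0.
  - by apply/measurable_EFinP; apply: measurable_cabs; exact: (cintegrable_meas I).
  - apply: emeasurable_funM; first exact: measurable_cst.
    apply/measurable_EFinP; apply: measurable_funM; first exact: measurable_cabs.
    exact: measurable_mellin_weight.
  - move=> t _; rewrite -EFinM lee_fin kGlE head_pow0.
    have [t0|t0] := leP t 0.
      by rewrite kG_le0// if_same mul0r cabs0 !mulr_ge0 ?cabs_ge0 ?expR_ge0.
    case: ifPn => tl; last by rewrite mul0r cabs0 !mulr_ge0 ?cabs_ge0 ?expR_ge0.
    rewrite (ltW (lt_trans tl l1)) /= (cabs_real 1) normr1 mul1r (Normc.normcM (kG t)) cabsJ.
    have tb : 0 < t <= 1 by rewrite t0 (ltW (lt_trans tl l1)).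
    have k1 := hC w t tb w2 wW.
    apply: (@le_trans _ _ (6 * (`|C| * expR (- (3 / 4 * ln t))))).
      apply: ler_pM; rewrite ?cabs_ge0 ?kG_bounded//.
      by apply: (le_trans k1); rewrite ler_wpM2r ?expR_ge0// ler_norm.
    rewrite /A mulrA -[leRHS]mulrA -expRD ler_wpM2l ?mulr_ge0// ler_expR.
    have : ln t <= ln lam by rewrite ler_ln ?posrE// ltW.
    lra.
rewrite ge0_integralZl//; last 2 first.
- apply/measurable_EFinP; apply: measurable_funM; first exact: measurable_cabs.
  exact: measurable_mellin_weight.
- by move=> t _; rewrite lee_fin mulr_ge0 ?cabs_ge0 ?expR_ge0.
by rewrite KE -EFinM lee_fin /A mulrAC.
Qed.

(** On ]0, 1] the integrand equals psi_{conj w,k} - psi_{conj w,k+1}, so the scalar product is the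
    difference of their transforms at s = 1. *)
Lemma inner_chi1_psi w k : complex.Re w < 2^-1 -> inner (@chi1 R) (psi w k) =
  k`!%:R / (1 - conjc w) ^+ k.+1 - k.+1`!%:R / (1 - conjc w) ^+ k.+2.
Proof.
move=> w2; have wJ : complex.Re (conjc w) < 1 by rewrite ReJ; lra.
have [L1 E1] := mellin_psi k wJ; have [L2 E2] := mellin_psi k.+1 wJ.
have Re1 : complex.Re (1 : R[i]) = 1 by [].
rewrite -(E1 1 Re1) -(E2 1 Re1) -(mellinB L1 L2 Re1) /mellin subrr.
rewrite -[LHS]/(cint leb Pos (fun t => chi1 t * conjc (psi w k t))) [LHS]cint_indic; last exact: measurable_itv.
apply: eq_cint => t _; rewrite cpow0 mulr1 indicE mem_setE in_itv /= andbT /chi1 /psi /chi.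
case: (ltP 0 t) => t0 /=; last by rewrite !mulr0 subrr.
case: ifPn => t1; last by rewrite !(mulr0, mul0r) subrr.
have e : conjc (((ln t^-1) ^+ k)%:C * cpow t (- w) * 1) = ((ln t^-1) ^+ k)%:C * cpow t (- conjc w).
  rewrite mulr1 rmorphM; congr (_ * _); first by apply: cplx_eqP => //=; rewrite oppr0.
  by rewrite [LHS]conj_cpow rmorphN.
rewrite e !mulr1 mulrA -rmorphM -mulrBl -rmorphB; congr (_%:C * _).
by rewrite exprS lnV ?posrE//; ring.
Qed.

End Kernel.

(** * Scalar products with V^-1 Q V psi and with its limit *)

Section Assembly.
Variable R : realType.
Local Notation leb := (@lebesgue_measure R).
Variable zeta : R[i] -> R[i].
Hypothesis Hzeta : is_riemann_zeta zeta.
Implicit Types (f g h phi F : R -> R[i]) (t u tau lam : R) (s z w rho : R[i]) (k : nat).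

Let Pos : set R := `]0, +oo[%classic.

Lemma line_neq0 tau : line tau != 0.
Proof. by rewrite eq_complex /= negb_and invr_eq0 pnatr_eq0. Qed.

Lemma line_conj tau : 1 - line tau = conjc (line tau).
Proof. by apply: cplx_eqP; rewrite /=; lra. Qed.

Lemma sub1_line_neq0 tau : 1 - line tau != 0.
Proof. by rewrite line_conj eq_complex /= negb_and invr_eq0 pnatr_eq0. Qed.

Lemma ae_neq0 : {ae leb, forall tau, tau != 0}.
Proof. by apply: (@ae_neq R 0) => tau /eqP. Qed.

(** |V| = 1 because on the line both 1 - s and zeta (1 - s) are the conjugates of s and zeta (s). At
    a zero of zeta the value of [Vmult] is 0 by the convention on inverses, so the first identity
    can only hold almost everywhere. *)
Lemma Vmult_ae : {ae leb, forall tau,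
  Vmult zeta (line tau) * conjc (Vmult zeta (line tau)) = 1 /\
  Vmult zeta (line tau) = line tau ^+ 3 / (1 - line tau) ^+ 2 * mellin (@sinc R) (line tau)}.
Proof.
apply: ae_imp2 (zeta_line_neq0 Hzeta) ae_neq0 => tau z0 t0.
have s1 := sub1_line_neq0 tau; have s0 := line_neq0 tau; split.
  have n1 : (cabs (Vmult zeta (line tau)) = 1).
    rewrite /Vmult (zeta_conj_line Hzeta t0) line_conj Normc.normcM cabsX !Normc.normcM.
    have ci (x : R[i]) : cabs x^-1 = (cabs x)^-1.
      have [->|x0] := eqVneq x 0; first by rewrite invr0 cabs0 invr0.
      have cx : cabs x != 0 by rewrite cabs_eq0.
      by apply: (mulfI cx); rewrite -Normc.normcM !mulfV// (cabs_real 1) normr1.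
    by rewrite !ci !cabsJ !mulfV ?cabs_eq0// expr1n mulr1.
  have := sqr_cabs (Vmult zeta (line tau)); rewrite n1 expr1n => e.
  by move: (Vmult _ _) e => [a b] /= e; apply: cplx_eqP => /=; lra.
rewrite /Vmult (zeta_functional_line Hzeta t0).
move: (zeta _) (mellin _ _) z0 => x m x0; field; by rewrite x0 s1.
Qed.

Lemma mellin_kG_V : {ae leb, forall tau,
  mellin (@kG R) (line tau) = Vmult zeta (line tau) * mellin (@chi1 R) (line tau)}.
Proof.
apply: ae_imp Vmult_ae => tau [_ ->]; rewrite mellin_kG ?mellin_chi1 ?half01//.
have := line_neq0 tau; have := sub1_line_neq0 tau.
by move: (mellin _ _) => m; move: (line tau) => s s1 s0; field; rewrite s0 s1.
Qed.

Lemma mellin_kgs_V w k : complex.Re w < 2^-1 -> {ae leb, forall tau,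
  mellin (kgs w k) (line tau) = Vmult zeta (line tau) * mellin (psi w k) (line tau)}.
Proof.
move=> w2; have [_ E] := mellin_psi k w2.
apply: ae_imp Vmult_ae => tau [_ ->]; rewrite mellin_kgs ?half01// mellin_kq ?half01// E//.
have sw : (line tau - w) ^+ k.+1 != 0.
  rewrite expf_neq0// subr_eq0; apply: contraTneq w2 => <-; by rewrite /= ltxx.
have := line_neq0 tau; have := sub1_line_neq0 tau.
move: (mellin _ _) (_ ^+ k.+1) (k`!%:R) sw => m x y x0; move: (line tau) => s s1 s0.
by field; rewrite s1 x0.
Qed.

(* Plancherel on both sides, using [|V| = 1] and [kG = V chi1]. *)
Lemma inner_kG_V h g F : is_mellin h F -> is_mellin g (fun tau => Vmult zeta (line tau) * F tau) ->
  inner (@kG R) g = inner (@chi1 R) h.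
Proof.
move=> hF gF; have LG := mellin_class_kG (half01 R).
have cG (u : R) : 0 < u -> u <> 0 -> kG t @[t --> u] --> (kG u : R[i]^o) by move=> u0 _; exact: cvg_kG.
have p1 := mellin_pairing LG (half_bounded_kG R) cG gF.
have p2 := mellin_pairing (@mellin_class_chi1 R) (@half_bounded_chi1 R) (@cvg_chi1 R) hF.
have pi0 : (2 * pi : R)%:C != 0 by rewrite fmorph_eq0 mulf_neq0 ?pnatr_eq0// gt_eqF// pi_gt0.
apply: (mulfI pi0); rewrite -[LHS]p1 -[RHS]p2.
have [_ LF _] := hF; have [_ LVF _] := gF.
have [mG _ _] := LG; have [mc _ _] := @mellin_class_chi1 R.
apply: (@cint_ae_eq _ (measurableTypeR R) R leb setT measurableT).
- apply: cmeasurableM; first exact: cmeasurable_mellin_line.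
  by apply: cmeasurableJ; exact: L2_cmeasurable LVF.
- apply: cmeasurableM; first exact: cmeasurable_mellin_line.
  by apply: cmeasurableJ; exact: L2_cmeasurable LF.
apply: ae_imp2 mellin_kG_V Vmult_ae => tau -> [VV _] _.
rewrite rmorphM mulrACA VV mul1r.
by [].
Qed.

(** The function [g] is known only through its L^2 transform, which agrees almost everywhere with
    that of the explicit [kgs]. Testing both against [kGl], by [mellin_pairing] for [g] and
    [mellin_parseval] for [kgs], identifies the scalar products without inverting a transform.
    Integrability on ]0, oo[ holds since [kGl] is O(t^(-1/2)) and [kgs] belongs to the class of
    abscissa 1/2. *)
Lemma inner_kGl_kgs lam w k g F : complex.Re w < 2^-1 -> is_mellin (psi w k) F ->
  is_mellin g (fun tau => Vmult zeta (line tau) * F tau) ->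
  cintegrable leb setT (fun t => kGl lam t * conjc (kgs w k t)) /\
  inner (kGl lam) g = cint leb setT (fun t => kGl lam t * conjc (kgs w k t)).
Proof.
move=> w2 hF gF; have [Lpsi _] := mellin_psi k w2.
have Lk := mellin_class_kgs k (half01 R) w2.
have [mk k0 _] := Lk; have Ll := mellin_class_kGl lam; have [ml l0 _] := Ll.
have hl := half_bounded_kGl lam.
have p1 := mellin_pairing Ll hl (@cvg_kGl R lam) gF.
have [_ LVF _] := gF; have mVF := L2_cmeasurable LVF; have [_ _ hVF] := LVF.
have mMl := cmeasurable_mellin_line ml; have mMk := cmeasurable_mellin_line mk.
have E : {ae leb, forall tau, setT tau ->
    mellin (kGl lam) (line tau) * conjc (Vmult zeta (line tau) * F tau) =
    mellin (kGl lam) (line tau) * conjc (mellin (kgs w k) (line tau))}.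
  by apply: ae_imp2 (is_mellin_ae Lpsi hF) (mellin_kgs_V k w2) => tau -> -> _.
have mR : cmeasurable setT (fun tau => mellin (kGl lam) (line tau) * conjc (mellin (kgs w k) (line tau))).
  by apply: cmeasurableM => //; exact: cmeasurableJ.
have mL : cmeasurable setT (fun tau => mellin (kGl lam) (line tau) * conjc (Vmult zeta (line tau) * F tau)).
  by apply: cmeasurableM => //; exact: cmeasurableJ.
have IL := cintegrable_pairing measurableT mMl mVF (sqL2norm_mellin_half_bounded Ll hl) hVF.
have IR := @cintegrable_ae_eq _ (measurableTypeR R) R leb setT measurableT _ _ mR E IL.
have p2 := mellin_parseval Ll hl (@cvg_kGl R lam) Lk IR.
have pi0 : (2 * pi : R)%:C != 0 by rewrite fmorph_eq0 mulf_neq0 ?pnatr_eq0// gt_eqF// pi_gt0.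
split; last first.
  apply: (mulfI pi0); rewrite -[LHS]p1 -[RHS]p2.
  exact: (@cint_ae_eq _ (measurableTypeR R) R leb setT measurableT _ _ mL mR E).
have [B hB] := hl.
apply/cintegrable_ltyP => //; split; first by apply: cmeasurableM => //; exact: cmeasurableJ.
have B0 : 0 <= B by have := le_trans (cabs_ge0 _) (hB 1 ltr01); rewrite ln1 mulr0 oppr0 expR0 mulr1.
have [_ _ Ik] := Lk.
apply: (@le_lt_trans _ _ (\int[leb]_t (B%:E * (cabs (kgs w k t) * expR ((2^-1 - 1) * ln t))%:E))%E).
  apply: ge0_le_integral => //.
  - by move=> t _; rewrite lee_fin cabs_ge0.
  - apply/measurable_EFinP; apply: measurable_cabs.
    by apply: cmeasurableM => //; exact: cmeasurableJ.
  - apply: emeasurable_funM; first exact: measurable_cst.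
    apply/measurable_EFinP; apply: measurable_funM; first exact: measurable_cabs.
    exact: measurable_mellin_weight.
  - move=> t _; rewrite -EFinM lee_fin; have [t0|t0] := leP t 0.
      by rewrite l0// mul0r cabs0 !mulr_ge0 ?cabs_ge0 ?expR_ge0.
    rewrite (Normc.normcM (kGl lam t)) cabsJ [leRHS]mulrCA [leRHS]mulrC ler_wpM2r ?cabs_ge0//.
    rewrite (_ : (2^-1 - 1) * ln t = - (2^-1 * ln t)); last by field.
    exact: hB.
rewrite ge0_integralZl//; last 2 first.
- apply/measurable_EFinP; apply: measurable_funM; first exact: measurable_cabs.
  exact: measurable_mellin_weight.
- by move=> t _; rewrite lee_fin mulr_ge0 ?cabs_ge0 ?expR_ge0.
exact: lte_mul_pinfty.
Qed.

(** By unitarity the two scalar products are those of G with Q_lam g and with g = V psi, so their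
    difference involves only ]0, lam[. The constant depends on [w] only through the bound [W], so it
    survives the limit at the critical line. *)
Lemma inner_VinvQV (W : R) k : exists2 D : R, 0 <= D & forall lam w h, 0 < lam < 1 ->
  complex.Re w < 2^-1 -> cabs w <= W -> is_VinvQV zeta lam (psi w k) h ->
  cabs (inner (@chi1 R) h - inner (@chi1 R) (psi w k)) <= D * expR (8^-1 * ln lam).
Proof.
have [D D0 hD] := kGl_kgs_bound W k; exists D => // lam w h l01 w2 wW [g [[F [hF gF]] [F' [hF' gF']]]].
rewrite -(inner_kG_V hF gF) -(inner_kG_V hF' gF') cabs_dist inner_kGl; last by case: gF.
have [I ->] := inner_kGl_kgs lam w2 hF gF.
exact: hD (ltW w2) wW I.
Qed.

(** The pair [L], [B] serves both cases of the theorem: L = 0 with a bound [B] for k >= 1, and the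
    expected limit [L] with B = 0 for k = 0. The constant 20 is the Lipschitz constant found in
    [inner_chi1_psi0_near]. *)
Lemma inner_Y_bound rho k : complex.Re rho = 2^-1 -> exists2 D : R, 0 <= D &
  forall lam Y (L : R[i]) (B : R), 0 < lam < 1 -> is_Y zeta lam rho k Y ->
  (forall w, complex.Re w < 2^-1 -> cabs (inner (@chi1 R) (psi w k) - L) <= B + 20 * cabs (w - rho)) ->
  cabs (inner (@chi1 R) Y - L) <= D * expR (8^-1 * ln lam) + B.
Proof.
move=> rho2; have [D D0 hD] := inner_VinvQV (cabs rho + 1) k; exists D => //.
move=> lam Y L B l01 [LY [H [HH HY]]] hL.
have mP : measurable Pos by exact: measurable_itv.
have mc : cmeasurable Pos (@chi1 R).
  by apply: cmeasurableS => //; have [] := @mellin_class_chi1 R.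
have LH w : complex.Re w < 2^-1 -> L2 Pos (H w).
  by move=> /HH[g [_ [F [[]]]]].
have mD : \forall w \near within [set w | complex.Re w < 2^-1] (nbhs (rho : R[i]^o)),
    cmeasurable Pos (fun t => H w t - Y t).
  rewrite /within; apply/nbhsC; exists 1 => // w _ w2.
  by apply: cmeasurableB; [exact: L2_cmeasurable (LH w w2)|exact: L2_cmeasurable LY].
have c0 : cint leb Pos (fun t => chi1 t * conjc (H w t - Y t))
    @[w --> within [set w | complex.Re w < 2^-1] (nbhs (rho : R[i]^o))] --> (0 : R[i]^o).
  exact: (pairing_cvg0 mP mc (@sqL2norm_chi1 R) mD HY).
apply/ler_addgt0Pr => e e0.
move/cvgC_cabs : c0 => /(@cvgrPdist_lt _ R^o) /(_ (e / 2)) h.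
have e2 : 0 < e / 2 by rewrite divr_gt0.
have {h} := h e2; rewrite /within /= => /nbhsC[r r0 hr].
(* Below [r] the scalar product with H w is within e / 2 of that with Y; e / 40 makes 20 d at most e
   / 2; and 1 keeps |w| <= |rho| + 1, the bound fixed beforehand. *)
pose d := Num.min (r / 2) (Num.min (e / 40) 1).
have d0 : 0 < d by rewrite !lt_min !divr_gt0/=.
pose w := rho - d%:C.
have wd : cabs (w - rho) = d by rewrite /w addrAC subrr add0r cabsN cabs_real gtr0_norm.
have w2 : complex.Re w < 2^-1 by rewrite /w ReD ReN /= rho2; lra.
have dr : d < r by rewrite (@le_lt_trans _ _ (r / 2))// ?ge_min ?lexx//; lra.
have de : d <= e / 40 by rewrite !ge_min lexx orbT.
have d1 : d <= 1 by rewrite !ge_min lexx !orbT.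
have := hr w; rewrite wd => /(_ dr w2); rewrite subr0 sub0r normrN ger0_norm ?cabs_ge0// => h1.
have hE : cint leb Pos (fun t => chi1 t * conjc (H w t - Y t)) = inner (@chi1 R) (H w) - inner (@chi1 R) Y.
  have [_ _ h2] := LH w w2; have [_ _ hY] := LY.
  have I1 := cintegrable_pairing mP mc (L2_cmeasurable (LH w w2)) (@sqL2norm_chi1 R) h2.
  have I2 := cintegrable_pairing mP mc (L2_cmeasurable LY) (@sqL2norm_chi1 R) hY.
  rewrite -[inner _ (H w)]/(cint leb Pos (fun t => chi1 t * conjc (H w t))).
  rewrite -[inner _ Y]/(cint leb Pos (fun t => chi1 t * conjc (Y t))).
  by rewrite -(@cintB _ (measurableTypeR R) R leb Pos mP _ _ I1 I2); apply: eq_cint => t _; rewrite rmorphB mulrBr.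
rewrite hE in h1.
have wW : cabs w <= cabs rho + 1 by rewrite (le_trans (cabsB _ _))// cabs_real gtr0_norm// lerD2l.
have h3 := hD lam w (H w) l01 w2 wW (HH w w2); have h4 := hL w w2.
have -> : inner (@chi1 R) Y - L = (inner (@chi1 R) (psi w k) - L) +
   (inner (@chi1 R) (H w) - inner (@chi1 R) (psi w k)) - (inner (@chi1 R) (H w) - inner (@chi1 R) Y) by ring.
rewrite (le_trans (cabsB _ _))//; apply: (le_trans (lerD (cabsD _ _) (lexx _))).
rewrite wd in h4; lra.
Qed.

End Assembly.

(** * The limits as lambda tends to 0 *)

Section Conclusion.
Variable R : realType.
Implicit Types (lam e : R) (s w rho : R[i]) (k : nat).

Lemma cabs_inv_le2 (u : R[i]) : 2^-1 < complex.Re u -> cabs u^-1 <= 2.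
Proof.
move=> u2; have u0 : u != 0 by apply: contraTneq u2 => ->; rewrite -leNgt /= invr_ge0.
have cu : 2^-1 < cabs u by rewrite (lt_le_trans u2)// (le_trans (ler_norm _))// Re_le_cabs.
have cu0 : 0 < cabs u by rewrite cabs_gt0.
have : cabs u^-1 * cabs u = 1 by rewrite -Normc.normcM mulVf// (cabs_real 1) normr1.
have : 0 <= cabs u^-1 by exact: cabs_ge0.
nra.
Qed.

Lemma Re_sub1_conj w : complex.Re w < 2^-1 -> 2^-1 < complex.Re (1 - conjc w).
Proof. by rewrite ReD ReN ReJ /=; lra. Qed.

Lemma inner_chi1_psi_bound k : exists2 B : R, 0 <= B & forall w, complex.Re w < 2^-1 ->
  cabs (inner (@chi1 R) (psi w k)) <= B.
Proof.
exists (k`!%:R * 2 ^+ k.+1 + k.+1`!%:R * 2 ^+ k.+2).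
  by rewrite addr_ge0// mulr_ge0// exprn_ge0.
move=> w w2; rewrite inner_chi1_psi//; have h := cabs_inv_le2 (Re_sub1_conj w2).
have key n j : cabs (n%:R / (1 - conjc w) ^+ j) <= n%:R * 2 ^+ j.
  rewrite Normc.normcM -exprVn cabsX -(rmorph_nat (real_complex R)) cabs_real normr_nat.
  by rewrite ler_wpM2l//; apply: lerXn2r => //; rewrite nnegrE ?cabs_ge0.
by rewrite (le_trans (cabsB _ _))// lerD.
Qed.

(** With u = 1 - conj w the scalar product is 1/u - 1/u^2, and u becomes rho at w = rho because rho
    = 1 - conj rho. The inverses of u and rho have modulus at most 2, whence 20 = 2 * 2 * (1 + 2 +
    2). *)
Lemma inner_chi1_psi0_near rho w : complex.Re rho = 2^-1 -> complex.Re w < 2^-1 ->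
  cabs (inner (@chi1 R) (psi w 0) - (rho - 1) / rho ^+ 2) <= 20 * cabs (w - rho).
Proof.
move=> r2 w2; rewrite inner_chi1_psi//; set u := 1 - conjc w.
have u2 : 2^-1 < complex.Re u by exact: Re_sub1_conj.
have hu := cabs_inv_le2 u2.
have rE : rho = 1 - conjc rho by apply: cplx_eqP; rewrite ?ReD ?ImD ?ReN ?ImN ?ReJ ?ImJ /= ?r2; lra.
have r0 : rho != 0.
  by apply/eqP => z; move: r2; rewrite z /= => /eqP; rewrite eq_sym invr_eq0 pnatr_eq0.
have cr : 2^-1 <= cabs rho by rewrite -r2 (le_trans (ler_norm _))// Re_le_cabs.
have hr : cabs rho^-1 <= 2.
  have : cabs rho^-1 * cabs rho = 1 by rewrite -Normc.normcM mulVf// (cabs_real 1) normr1.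
  have : 0 <= cabs rho^-1 by exact: cabs_ge0.
  nra.
have u0 : u != 0 by apply: contraTneq u2 => ->; rewrite -leNgt /= invr_ge0.
have ur : rho - u = conjc (w - rho).
  rewrite {1}rE /u; apply: cplx_eqP; rewrite ?(ReD, ImD, ReN, ImN, ReJ, ImJ) /=; ring.
rewrite fact0 (_ : 1`! = 1)%N// (_ : _ - _ - _ = (rho - u) * (u^-1 * rho^-1 * (1 - (u^-1 + rho^-1)))); last first.
  by field; rewrite u0 r0.
rewrite ur 3!Normc.normcM cabsJ mulrC ler_wpM2r ?cabs_ge0//.
have h1 : cabs (1 - (u^-1 + rho^-1)) <= 5.
  rewrite (le_trans (cabsB _ _))// (cabs_real 1) normr1.
  have := cabsD u^-1 rho^-1; lra.
have h2 : cabs u^-1 * cabs rho^-1 <= 2 * 2 by rewrite ler_pM ?cabs_ge0.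
have -> : (20 : R) = 2 * 2 * 5 by rewrite -!natrM.
by rewrite ler_pM// ?mulr_ge0 ?cabs_ge0.
Qed.

Lemma near0_lt (a : R) : 0 < a -> \forall lam \near (0 : R)^'+, 0 < lam < a.
Proof.
move=> a0; near=> lam; apply/andP; split; near: lam.
  exact: nbhs_right_gt.
exact: nbhs_right_lt.
Unshelve. all: by end_near.
Qed.

Lemma cvg_pow8 (D : R) : 0 <= D -> D * expR (8^-1 * ln lam) @[lam --> (0 : R)^'+] --> 0.
Proof.
move=> D0; apply/(@cvgrPdist_lt _ R^o) => e e0.
have a0 : 0 < e / (D + 1) by rewrite divr_gt0// ltr_wpDl.
near=> lam.
have /andP[l0 l1] : 0 < lam < expR (8 * ln (e / (D + 1))) by near: lam; apply: near0_lt; exact: expR_gt0.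
rewrite sub0r normrN ger0_norm ?mulr_ge0 ?expR_ge0//.
have h : expR (8^-1 * ln lam) < e / (D + 1).
  rewrite -[ltRHS]lnK ?posrE// ltr_expR.
  have : ln lam < 8 * ln (e / (D + 1)) by rewrite -ltr_expR lnK.
  lra.
apply: (@le_lt_trans _ _ ((D + 1) * expR (8^-1 * ln lam))); first by rewrite ler_wpM2r ?expR_ge0// lerDl.
by rewrite mulrC -ltr_pdivlMr// ltr_wpDl.
Unshelve. all: by end_near.
Qed.

Lemma cvg_inv_ln (D : R) : 0 <= D -> D * (ln lam^-1)^-1 @[lam --> (0 : R)^'+] --> 0.
Proof.
move=> D0; apply/(@cvgrPdist_lt _ R^o) => e e0.
have D1 : 0 < D + 1 by rewrite ltr_wpDl.
near=> lam.
have /andP[l0 l1] : 0 < lam < expR (- ((D + 1) / e)) by near: lam; apply: near0_lt; exact: expR_gt0.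
have h : (D + 1) / e < ln lam^-1.
  rewrite lnV ?posrE// ltrNr -ltr_expR lnK// ?posrE//.
have h0 : 0 < (D + 1) / e by rewrite divr_gt0.
have L0 : 0 < ln lam^-1 by exact: lt_trans h.
rewrite sub0r normrN ger0_norm; last by rewrite mulr_ge0// invr_ge0 ltW.
rewrite ltr_pdivrMr// mulrC -ltr_pdivrMr// (le_lt_trans _ h)// ler_wpM2r ?invr_ge0 ?(ltW e0)//.
by rewrite lerDl.
Unshelve. all: by end_near.
Qed.

(** The square root cancels the exponent -1/2 of the normalisation, so only the power -k of the
    logarithm separates the two cases of the theorem. *)
Lemma inner_X_of_Y lam k (Y : R -> R[i]) : 0 < lam < 1 -> L2 `]0, +oo[ Y ->
  (Num.sqrt (ln lam^-1))%:C * inner (@chi1 R) (X_of_Y lam k Y) =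
  ((ln lam^-1) ^- k)%:C * inner (@chi1 R) Y.
Proof.
move=> /andP[l0 l1] LY; have mP : measurable (`]0, +oo[ : set R) by exact: measurable_itv.
have mc : cmeasurable (`]0, +oo[%classic : set R) (@chi1 R).
  by apply: cmeasurableS => //; have [] := @mellin_class_chi1 R.
have [_ _ hY] := LY.
have I := cintegrable_pairing mP mc (L2_cmeasurable LY) (@sqL2norm_chi1 R) hY.
have L0 : 0 < ln lam^-1 by rewrite lnV ?posrE// oppr_gt0 ln_lt0// l0.
set c := (ln lam^-1) `^ (- 2^-1 - k%:R).
have -> : inner (@chi1 R) (X_of_Y lam k Y) = c%:C * inner (@chi1 R) Y.
  rewrite -[inner _ Y]/(cint (@lebesgue_measure R) `]0, +oo[ (fun t => chi1 t * conjc (Y t))).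
  rewrite -(@cintZ _ (measurableTypeR R) R _ _ mP _ _ I).
  apply: eq_cint => t _; rewrite /X_of_Y rmorphM mulrCA; congr (_ * _).
  by apply: cplx_eqP; rewrite ?ReJ ?ImJ /= ?oppr0.
rewrite mulrA -rmorphM; congr (_%:C * _).
rewrite -powR12_sqrt ?(ltW L0)// /c -powRD; last by apply/implyP => _; rewrite gt_eqF.
rewrite addrA addrN sub0r powRN powR_mulrn//; exact: ltW.
Qed.

End Conclusion.

Theorem theorem5p4 (R : realType) (zeta : R[i] -> R[i]) (rho : R[i])
    (m k : nat) (Y : R -> R -> R[i]) :
  is_riemann_zeta zeta ->
  complex.Re rho = 2^-1 ->
  zero_of_multiplicity zeta rho m ->
  (k < m)%N ->
  (forall lam : R, 0 < lam < 1 -> is_Y zeta lam rho k (Y lam)) ->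
  ((1 <= k)%N ->
     (Num.sqrt (ln lam^-1))%:C * inner (@chi1 R) (X_of_Y lam k (Y lam))
       @[lam --> (0 : R)^'+] --> (0 : R[i]^o)) /\
  (k = 0%N ->
     (Num.sqrt (ln lam^-1))%:C * inner (@chi1 R) (X_of_Y lam k (Y lam))
       @[lam --> (0 : R)^'+] --> ((rho - 1) / rho ^+ 2 : R[i]^o)).
Proof.
move=> Hz rho2 _ _ HY.
have LY lam : 0 < lam < 1 -> L2 `]0, +oo[ (Y lam) by case/HY.
have [D D0 hD] := inner_Y_bound Hz k rho2.
split=> hk.
  have [B B0 hB] := inner_chi1_psi_bound R k.
  apply/cvgC_cabs; apply: (@squeeze_cvgr _ _ _ _ (cst 0) (fun lam => (D + B) * (ln lam^-1)^-1)).
  - near=> lam.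
    have l01 : 0 < lam < 1 by near: lam; apply: near0_lt.
    (* Below exp (- 1) the logarithm of 1 / lam is at least 1, so its power -k is at most its power
       -1 and one majorant serves all k >= 1. *)
    have /andP[l0 le] : 0 < lam < expR (- 1) by near: lam; apply: near0_lt; exact: expR_gt0.
    have L1 : 1 <= ln lam^-1.
      by rewrite lnV ?posrE// lerNr -ler_expR lnK ?posrE// ltW.
    have L0 : 0 < ln lam^-1 by exact: lt_le_trans L1.
    rewrite subr0 cabs_ge0 /= inner_X_of_Y//; last exact: LY.
    have hl w : complex.Re w < 2^-1 ->
        cabs (inner (@chi1 R) (psi w k) - 0) <= B + 20 * cabs (w - rho).
      by move=> w2; rewrite subr0 (le_trans (hB w w2))// lerDl mulr_ge0 ?cabs_ge0.
    have := hD lam (Y lam) 0 B l01 (HY lam l01) hl; rewrite subr0 => hy.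
    rewrite Normc.normcM cabs_real mulrC ger0_norm; last by rewrite invr_ge0 exprn_ge0// ltW.
    apply: ler_pM; rewrite ?cabs_ge0 ?invr_ge0 ?exprn_ge0 ?(ltW L0)//.
      apply: (le_trans hy); rewrite lerD2r ler_piMr// -expR0 ler_expR.
      by have /andP[_ /ltW l1] := l01; rewrite pmulr_rle0 ?ln_le0.
    rewrite lef_pV2 ?posrE ?exprn_gt0//.
    by case: k hk {hD HY hB hl} => // k _; rewrite exprS ler_peMr ?(ltW L0)// exprn_ege1.
  - exact: cvg_cst.
  - by apply: cvg_inv_ln; rewrite addr_ge0.
move: hk hD HY => -> hD HY.
apply/cvgC_cabs; apply: (@squeeze_cvgr _ _ _ _ (cst 0) (fun lam => D * expR (8^-1 * ln lam))).
- near=> lam.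
  have l01 : 0 < lam < 1 by near: lam; apply: near0_lt.
  rewrite cabs_ge0 /= inner_X_of_Y//; last exact: LY.
  rewrite expr0 invr1 mul1r -[leRHS]addr0.
  apply: hD l01 (HY lam l01) _ => w w2; rewrite add0r.
  exact: inner_chi1_psi0_near.
- exact: cvg_cst.
- exact: cvg_pow8.
Unshelve. all: by end_near.
Qed.
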